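(* Let $r\in\mathbb{N}_0\cup\{\infty\}$ and $k\in\mathbb{N}_0\cup\{\infty\}$. Let $\pi_1:E_1\to X$ and $\pi_2:E_2\to X$ be $C^r$-vector bundles over the same $\sigma$-compact, finite-dimensional base $X$, with typical fibres $F_1$ and $F_2$, respectively. Let $f:U\to E_2$ be a bundle map, defined on an $\mathbb{R}$-balanced open neighbourhood $U$ of the zero-section in $E_1$, such that (a) $f(0_x)=0_x$ for all $x\in X$; (b) $f$ is partially $C^k$ in the vector variable; and (c) the functions $\delta^jf:U\oplus E_1^{2^j-1}\to E_2$ are of class $C^r$, for every $j\in\mathbb{N}_0$ with $j\le k$. Then $$C^r_K(X,f):\ C^r_K(X,U)\to C^r_K(X,E_2),\qquad\sigma\mapsto f\circ\sigma$$ is a mapping of class $C^k$, for every compact subset $K$ of $X$. For all $j\in\mathbb{N}_0$ with $j\le k$, we have $$d^jC^r_K(X,f)=C^r_K(X,\delta^jf):\ C^r_K(X,U\oplus E_1^{2^j-1})\to C^r_K(X,E_2),$$ identifying $C^r_K(X,U)\times C^r_K(X,E_1)^{2^j-1}$ with $C^r_K(X,U\oplus E_1^{2^j-1})$ in the natural way.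
   Context: Conventions. Locally convex spaces are real or complex and Hausdorff; manifolds are Hausdorff and modelled on locally convex spaces. Differentiability is always over $\mathbb{R}$: for locally convex spaces $E,F$ and $U\subseteq E$ open, $f:U\to F$ is $C^0$ if continuous ($d^0f:=f$); $C^1$ if it is continuous, $df(x,h):=\lim_{t\to0}t^{-1}(f(x+th)-f(x))$ exists for all $(x,h)\in U\times E$, and $df:U\times E\to F$ is continuous; recursively, for $k\ge2$, $C^k$ if it is $C^{k-1}$ and $d^{k-1}f:U\times E^{2^{k-1}-1}\to F$ is $C^1$, and then $d^kf:=d(d^{k-1}f):U\times E^{2^k-1}\to F$; and $C^\infty$ (smooth) if $C^k$ for all $k$. $C^r$-manifolds are defined by charts with $C^r$ transition maps ($C^0$-diffeomorphism means homeomorphism). Function spaces. For a $C^r$-manifold $Y$ and a locally convex space $F$, put $T^0Y:=Y$ and, for a $C^r$-map $\gamma:Y\to F$, $d^0\gamma:=\gamma$, $d\gamma:=\mathrm{pr}_2\circ T\gamma:TY\to F$, $d^n\gamma:=d(d^{n-1}\gamma):T^nY\to F$. The space $C^r(Y,F)$ carries the initial topology with respect to the maps $\gamma\mapsto d^n\gamma\in C(T^nY,F)$ ($n\in\mathbb{N}_0$, $n\le r$), the targets having the compact-open topology. Vector bundles. A $C^r$-vector bundle over a $C^r$-manifold $X$ with typical fibre a locally convex space $F$ (over $\mathbb{R}$ or $\mathbb{C}$) is a $C^r$-manifold $E$ with a $C^r$-surjection $\pi:E\to X$ and a vector space structure on each fibre $E_x=\pi^{-1}(\{x\})$ such that each $x_0\in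 X$ has an open neighbourhood $X_\psi$ with a $C^r$-diffeomorphism $\psi:\pi^{-1}(X_\psi)\to X_\psi\times F$ (a local trivialization) satisfying $\psi(E_x)=\{x\}\times F$ and $\mathrm{pr}_F\circ\psi|_{E_x}$ linear for all $x\in X_\psi$. $C^r(X,E)$ is the space of $C^r$-sections, $\sigma_\psi:=\mathrm{pr}_F\circ\psi\circ\sigma|_{X_\psi}:X_\psi\to F$, and $C^r(X,E)$ carries the initial topology with respect to the maps $\sigma\mapsto\sigma_\psi\in C^r(X_\psi,F)$, $\psi$ ranging over all local trivializations. For $K\subseteq X$ compact, $C^r_K(X,E)$ is the subspace of sections supported in $K$, with the induced topology. $0_x$ is the zero element of $E_x$; the zero-section is $0_X=\{0_x:x\in X\}$. Sums $E_1\oplus E_2=\bigcup_x(E_1)_x\times(E_2)_x$ of bundles over $X$ are formed fibrewise, with trivializations $\phi_1\oplus\phi_2$; $E^m$ is the $m$-fold sum; for $U\subseteq E_1$ open, $U\oplus E_2:=\bigcup_x(U\cap(E_1)_x)\times(E_2)_x$, an open subset of $E_1\oplus E_2$. A neighbourhood $U$ of $0_X$ in $E$ is $\mathbb{R}$-balanced if $[-1,1]\cdot(U\cap E_x)\subseteq U\cap E_x$ for all $x$. $C^r_K(X,U):=\{\sigma\in C^r_K(X,E):\operatorname{im}\sigma\subseteq U\}$, which is open in $C^r_K(X,E)$ if $U$ is an $\mathbb{R}$-balanced open neighbourhood of $0_X$. Bundle maps. For $U\subseteq E_1$ an open neighbourhood of $0_X$, $f:U\to E_2$ is a bundle map if $f(U\cap(E_1)_x)\subseteq(E_2)_x$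 for all $x$. For local trivializations $\psi$ of $E_1$ and $\phi$ of $E_2$, define $f_{\phi,\psi}:U_{\phi,\psi}\to F_2$ on $U_{\phi,\psi}:=\psi(U\cap\pi_1^{-1}(X_\psi\cap X_\phi))\subseteq(X_\psi\cap X_\phi)\times F_1$ by $\phi(f(\psi^{-1}(x,v)))=(x,f_{\phi,\psi}(x,v))$. A map $g:W\to F_2$ on an open set $W\subseteq Y\times F_1$ ($Y$ a Hausdorff space) is partially $C^k$ in the second argument if each $g(x,\cdot)$ is $C^k$ and the maps $d_2^jg:W\times F_1^{2^j-1}\to F_2$, $d_2^jg(x,\cdot):=d^j(g(x,\cdot))$, are continuous for all $j\in\mathbb{N}_0$, $j\le k$. The bundle map $f$ is partially $C^k$ in the vector variable if all $f_{\phi,\psi}$ are partially $C^k$ in the second argument. Then (for $k\ge1$) $\delta f:U\oplus E_1\to E_2$ is the unique bundle map with $(\delta f)_{\phi,\psi\oplus\psi}=d_2(f_{\phi,\psi})$ for all $\phi,\psi$; it is partially $C^{k-1}$ in the vector variable, and recursively $\delta^0f:=f$, $\delta^jf:=\delta(\delta^{j-1}f):U\oplus E_1^{2^j-1}\to E_2$ for $1\le j\le k$. *)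

(* Defs.v *)
From HB Require Import structures.
From mathcomp Require Import all_boot all_order all_algebra.
From mathcomp Require Import complex.
From mathcomp Require Import all_classical all_reals all_analysis.
Import numFieldNormedType.Exports.

Set Implicit Arguments.
Unset Strict Implicit.
Unset Printing Implicit Defensive.

Import Order.TTheory GRing.Theory Num.Theory.
Local Open Scope classical_set_scope.
Local Open Scope ring_scope.

(** Orders of differentiability in N u {oo}: [Some n] is n and [None] is oo. *)

Definition le_order (n : nat) (r : option nat) : bool :=
  if r is Some m then (n <= m)%N else true.

(** Ground fields: [scalars R true] is C and [scalars R false] is R. *)

Definition scalars (R : realType) (cplx : bool) : numFieldType :=
  if cplx then (R[i] : numFieldType) else R.

Definition of_real (R : realType) (cplx : bool) : R -> scalars R cplx :=
  if cplx as b return R -> scalars R b then fun a => (a%:C)%C else id.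

Arguments of_real {R} cplx.

Section of_real.
Context (R : realType) (cplx : bool).
Local Notation rho := (@of_real R cplx).

Lemma of_real1 : rho 1 = 1.
Proof. by case: cplx => //=; exact: rmorph1. Qed.

Lemma of_realD a b : rho (a + b) = rho a + rho b.
Proof. by case: cplx => //=; exact: rmorphD. Qed.

Lemma of_realM a b : rho (a * b) = rho a * rho b.
Proof. by case: cplx => //=; exact: rmorphM. Qed.

Lemma of_real_ge0 a : (0 <= rho a) = (0 <= a).
Proof. by case: cplx => //=; rewrite lecE/= eqxx. Qed.

Lemma of_real_continuous : continuous (rho : R^o -> (scalars R cplx)^o).
Proof.
rewrite /of_real; case: cplx => /=; last by move=> x; exact: cvg_id.
move=> x; apply/(@cvgrPdist_lt R[i] R[i]^o) => -[e e'].
rewrite ltcE/= => /andP[/eqP -> e0].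
near=> y; rewrite -rmorphB/= normc_def/= expr0n addr0 sqrtr_sqr ltcR.
near: y; exact: (@cvgr_dist_lt R R^o _ (nbhs x) _ id x cvg_id).
Unshelve. all: by end_near. Qed.

End of_real.

(** A locally convex space over R or C, viewed as a locally convex space over R. *)

Definition real_lcs (R : realType) (cplx : bool) (F : tvsType (scalars R cplx))
  : Type := F.

Section real_lcs.
Context (R : realType) (cplx : bool) (F : tvsType (scalars R cplx)).
Local Notation V := (real_lcs F).
Local Notation rho := (@of_real R cplx).

HB.instance Definition _ := Uniform.copy V F.
HB.instance Definition _ := GRing.Zmodule.copy V F.

Let scale (a : R) (v : V) : V := rho a *: (v : F).

Let scaleA a b v : scale a (scale b v) = scale (a * b) v.
Proof. by rewrite /scale scalerA of_realM. Qed.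

Let scale1 : left_id 1 scale.
Proof. by move=> v; rewrite /scale of_real1 scale1r. Qed.

Let scaleDr : right_distributive scale +%R.
Proof. by move=> a v w; rewrite /scale; exact: scalerDr. Qed.

Let scaleDl v : {morph scale^~ v : a b / a + b}.
Proof. by move=> a b; rewrite /scale of_realD; exact: scalerDl. Qed.

HB.instance Definition _ :=
  GRing.Zmodule_isLmodule.Build R V scaleA scale1 scaleDr scaleDl.

Lemma real_scaleE (a : R) (v : V) : a *: v = rho a *: (v : F) :> F.
Proof. by []. Qed.

Let V_add_continuous : continuous (fun x : V * V => x.1 + x.2).
Proof. exact: (@add_continuous F). Qed.

Let V_scale_continuous : continuous (fun z : R^o * V => z.1 *: z.2).
Proof.
move=> [a v]; pose g (z : R^o * V) : (scalars R cplx)^o * F := (rho z.1, z.2).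
apply: (@continuous_comp _ _ _ g (fun z => z.1 *: z.2) (a, v)); last first.
  exact: scale_continuous.
apply: (@cvg_pair _ _ _ _ (nbhs (rho a : (scalars R cplx)^o)) (nbhs (v : F))).
- apply: (@continuous_comp _ _ _ fst (rho : R^o -> (scalars R cplx)^o) (a, v)).
    exact: cvg_fst.
  exact: of_real_continuous.
- exact: cvg_snd.
Qed.

Let V_locally_convex :
  exists2 B : set_system V, (forall b, b \in B -> convex_set b) & basis B.
Proof.
have [B Bconv Bbasis] := @locally_convex _ F.
exists B => // b /Bconv bconv x y l xb yb.
have l0 : 0 <= rho l%:num by rewrite of_real_ge0.
have rhoN : rho (1 - l%:num) = 1 - rho l%:num.
  have := of_realD cplx (1 - l%:num) l%:num.
  by rewrite subrK of_real1 => ->; rewrite addrK.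
have l1 : rho l%:num <= 1 by rewrite -subr_ge0 -rhoN of_real_ge0 subr_ge0.
have li : Itv.spec (@Itv.num_sem (scalars R cplx))
    (Itv.Real `[0%Z, 1%Z]) (rho l%:num).
  by apply/and3P; split; rewrite /= ?num_real ?ger0_real// bnd_simp.
by have := bconv x y (Itv.mk li) xb yb; rewrite /conv/= /unstable.onem -rhoN.
Qed.

HB.instance Definition _ :=
  PreTopologicalNmodule_isTopologicalNmodule.Build V V_add_continuous.
HB.instance Definition _ :=
  TopologicalNmodule_isTopologicalLmodule.Build R V V_scale_continuous.
HB.instance Definition _ := Uniform_isTvs.Build R V V_locally_convex.

End real_lcs.

(** ** Differential calculus over R in the sense of Michal and Bastiani *)

(** The definitions make sense for any real vector space with a topology; this
    allows them to be applied to spaces of sections below. *)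

HB.instance Definition _ (K : numDomainType) (E F : preTopologicalLmodType K) :=
  GRing.Lmodule.on (E * F)%type.

Section calculus.
Context {R : realType}.
Implicit Types E F : preTopologicalLmodType R.

(** [pow2 E n] is E^(2^n) and [dom2 n U] is U x E^(2^n - 1). *)
Fixpoint pow2 E (n : nat) : preTopologicalLmodType R :=
  if n is m.+1 then (pow2 E m * pow2 E m)%type else E.

Fixpoint dom2 E (n : nat) : set E -> set (pow2 E n) :=
  match n return set E -> set (pow2 E n) with
  | 0 => id
  | m.+1 => fun U => @dom2 E m U `*` setT
  end.
#[global] Arguments dom2 {E} n U.

Definition diffquot E F (f : E -> F) (x h : E) (t : R) : F :=
  t^-1 *: (f (x + t *: h) - f x).

(** [df(x, h)], with value 0 if the limit does not exist. *)
Definition diff1 E F (f : E -> F) (p : E * E) : F :=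
  xget 0 [set y | diffquot f p.1 p.2 t @[t --> 0^'] --> y].

Fixpoint diffn E F (n : nat) (f : E -> F) : pow2 E n -> F :=
  match n return pow2 E n -> F with
  | 0 => f
  | m.+1 => diff1 (@diffn E F m f)
  end.
#[global] Arguments diffn {E F} n f.

(** All predicates [.. U f] below concern the restriction of [f] to the open
    set [U]; the values of [f] outside [U] are irrelevant. *)

Definition C1_on E F (U : set E) (f : E -> F) : Prop :=
  [/\ {within U, continuous f},
      forall x h, U x -> (exists y : F, diffquot f x h t @[t --> 0^'] --> y) &
      {within U `*` setT, continuous (diff1 f)}].

Fixpoint Cn_on E F (n : nat) (U : set E) (f : E -> F) : Prop :=
  if n is m.+1 then Cn_on m U f /\ C1_on (dom2 m U) (diffn m f)
  else {within U, continuous f}.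

Definition C_on E F (r : option nat) (U : set E) (f : E -> F) : Prop :=
  forall n, le_order n r -> Cn_on n U f.

(** [g x v] is defined for [(x, v) \in W], where [W] is open in [Y x E] for some
    subspace [Y] of [X]. *)
Definition partially_C_on (X : topologicalType) E F (k : option nat)
    (W : set (X * E)) (g : X -> E -> F) : Prop :=
  (forall x, C_on k [set v | W (x, v)] (g x)) /\
  (forall j, le_order j k ->
     {within [set p : X * pow2 E j | dom2 j [set v | W (p.1, v)] p.2],
       continuous (fun p : X * pow2 E j => diffn j (g p.1) p.2)}).

End calculus.

(** ** Manifolds *)

(** A chart is a map [cmap] on [cdom]; [cinv] is its inverse. The values of
    [cmap] outside [cdom] and of [cinv] outside [cimg] are irrelevant. *)

Record chart (M E : Type) := Chart {
  cdom : set M ; cmap : M -> E ; cinv : E -> M }.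

HB.instance Definition _ (M E : Type) := gen_eqMixin (chart M E).
HB.instance Definition _ (M E : Type) := gen_choiceMixin (chart M E).

Definition cimg M E (c : chart M E) : set E := cmap c @` cdom c.

(** The topology on [M] generated by the preimages of open sets under the charts
    of a given atlas. *)

Definition chart_space (M : Type) (E : topologicalType) (A : set (chart M E))
  : Type := M.

Section chart_space.
Context (M : Type) (E : topologicalType) (A : set (chart M E)).

Definition chart_subbase : set_system (chart_space A) :=
  [set O | exists c (W : set E), [/\ A c, open W & O = cdom c `&` cmap c @^-1` W]].

HB.instance Definition _ := gen_eqMixin (chart_space A).
HB.instance Definition _ := gen_choiceMixin (chart_space A).
HB.instance Definition _ :=
  isSubBaseTopological.Build (chart_space A) chart_subbase id.

End chart_space.

Record charted (R : realType) := Charted {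
  cspace :> topologicalType ;
  cmodel : tvsType R ;
  atlas : set (chart cspace cmodel) }.

Definition is_manifold (R : realType) (r : option nat) (M : charted R) : Prop :=
  [/\ hausdorff_space M, hausdorff_space (cmodel M),
      (forall y : M, exists2 c, atlas c & cdom c y),
      (forall c : chart M (cmodel M), atlas c ->
         [/\ open (cdom c), open (cimg c),
             (forall y, cdom c y -> cinv c (cmap c y) = y),
             {within cdom c, continuous (cmap c)} &
             {within cimg c, continuous (cinv c)}]) &
      (forall c c' : chart M (cmodel M), atlas c -> atlas c' ->
         C_on r (cmap c @` (cdom c `&` cdom c')) (cmap c' \o cinv c))].

(** The manifold map [f : M -> N] is of class C^r on the open set [A]. *)
Definition C_map_on (R : realType) (M N : charted R) (r : option nat)
    (A : set M) (f : M -> N) : Prop :=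
  {within A, continuous f} /\
  (forall (c : chart M (cmodel M)) (c' : chart N (cmodel N)),
     atlas c -> atlas c' ->
     C_on r (cmap c @` (cdom c `&` A `&` f @^-1` cdom c'))
       (cmap c' \o f \o cinv c)).

Definition prod_charted (R : realType) (M N : charted R) : charted R :=
  @Charted R (M * N)%type (cmodel M * cmodel N)%type
    [set c | exists (a : chart M (cmodel M)) (b : chart N (cmodel N)),
      [/\ atlas a, atlas b &
          c = Chart (cdom a `*` cdom b)
                (fun y => (cmap a y.1, cmap b y.2))
                (fun u => (cinv a u.1, cinv b u.2))]].

Definition lcs_charted (R : realType) (F : tvsType R) : charted R :=
  @Charted R F F [set Chart setT id id].

Definition finite_dimensional (R : realType) (M : charted R) : Prop :=
  exists (d : nat) (e : {linear 'rV[R]_d -> cmodel M}), bijective e.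

Definition sigma_compact (T : topologicalType) : Prop :=
  exists2 A : nat -> set T, (forall i, compact (A i)) & \bigcup_i A i = setT.

(** ** Tangent bundles and the topology on spaces of C^r-functions *)

Section tangent.
Context {R : realType}.
Implicit Type M : charted R.

(** Some chart around [y]. *)
Definition chart_at M (y : M) : chart M (cmodel M) :=
  xget (Chart set0 (fun=> 0) (fun=> y)) [set c | atlas c /\ cdom c y].

(** A tangent vector at [y] is represented by its coordinates in the chart
    [chart_at y]. *)
Definition tangent_chart M (c : chart M (cmodel M)) :
    chart (M * cmodel M) (cmodel M * cmodel M) :=
  Chart (cdom c `*` setT)
    (fun p => (cmap c p.1,
       diff1 (cmap c \o cinv (chart_at p.1)) (cmap (chart_at p.1) p.1, p.2)))
    (fun u => (cinv c u.1,
       diff1 (cmap (chart_at (cinv c u.1)) \o cinv c) u)).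

Definition tangent M : charted R :=
  let A := [set tangent_chart c | c in @atlas R M] in
  @Charted R (@chart_space _ (cmodel M * cmodel M)%type A) _ A.

(** [T^n A] as an open subset of [T^n M], for an open subset [A] of [M]. *)
Fixpoint tangent_dom M (n : nat) (A : set M) : set (iter n tangent M) :=
  match n return set (iter n tangent M) with
  | 0 => A
  | m.+1 => [set p | @tangent_dom M m A p.1]
  end.
#[global] Arguments tangent_dom {M} n A.

Context {F : tvsType R}.

(** The second component of the tangent map of [g : M -> F]. *)
Definition mdiff1 M (g : M -> F) (p : tangent M) : F :=
  diff1 (g \o cinv (chart_at p.1)) (cmap (chart_at p.1) p.1, p.2).

Fixpoint mdiff M (n : nat) (g : M -> F) : iter n tangent M -> F :=
  match n return iter n tangent M -> F with
  | 0 => g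
  | m.+1 => mdiff1 (@mdiff M m g)
  end.
#[global] Arguments mdiff {M} n g.

(** Functions on the open subset [A] of [M] (values outside [A] are
    irrelevant), with the topology of C^r(A, F). *)
Definition C_fun M (r : option nat) (A : set M) : Type := M -> F.

HB.instance Definition _ M r (A : set M) := Choice.copy (C_fun r A) (M -> F).
HB.instance Definition _ M (r : option nat) (A : set M) :=
  Topological.copy (C_fun r A)
    (sup_topology (fun n : {n | le_order n r} =>
       Topological.class (initial_topology
         (fun g : M -> F => (mdiff (projT1 n) g \o set_val
            : {compact-open, tangent_dom (projT1 n) A -> F}))))).

End tangent.

Arguments C_fun {R} F {M} r A.

(** ** Vector bundles *)

(** A bundle over [X] with typical fibre [F] is given by the family of its fibres
    together with a topology and an atlas on its total space. The projection is
    [projT1] and a section is a dependent function. *)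

Record bundle (R : realType) (X : charted R) (cplx : bool)
    (F : tvsType (scalars R cplx)) := Bundle {
  fib : X -> lmodType (scalars R cplx) ;
  total_topology : Topological {x : X & fib x} ;
  total_model : tvsType R ;
  total_atlas : set (chart {x : X & fib x} total_model) }.

Arguments bundle {R} X {cplx} F.

Record trivialization (R : realType) (X : charted R) (cplx : bool)
    (F : tvsType (scalars R cplx)) (E : bundle X F) := Trivialization {
  tdom : set X ;
  tmap : forall x, fib E x -> F ;
  tinv : forall x, F -> fib E x }.

Section bundle.
Context {R : realType} {X : charted R} {cplx : bool}.
Context {F : tvsType (scalars R cplx)}.
Implicit Type E : bundle X F.

Definition total_space E : charted R :=
  @Charted R (Topological.Pack (total_topology E)) (total_model E)
    (@total_atlas _ _ _ _ E).

Definition total_pt E (x : X) (v : fib E x) : total_space E := existT _ x v.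

(** The C^r-diffeomorphism is [(x, v) |-> (x, tmap x v)], from the part of the
    total space over [tdom] onto [tdom] x [F], with [tinv] for its inverse. *)
Definition is_trivialization (r : option nat) E (psi : trivialization E) : Prop :=
  [/\ open (tdom psi),
      (forall x, tdom psi x ->
         [/\ linear (@tmap _ _ _ _ _ psi x), cancel (@tmap _ _ _ _ _ psi x) (tinv psi x)
           & cancel (tinv psi x) (@tmap _ _ _ _ _ psi x)]),
      @C_map_on R (total_space E) (prod_charted X (lcs_charted (real_lcs F))) r
        [set p | tdom psi (projT1 p)]
        (fun p => (projT1 p, tmap psi (projT2 p)))
    & @C_map_on R (prod_charted X (lcs_charted (real_lcs F))) (total_space E) r
        (tdom psi `*` setT)
        (fun q => total_pt (tinv psi q.1 q.2))].

Definition is_vector_bundle (r : option nat) E : Prop :=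
  [/\ hausdorff_space F, is_manifold r (total_space E),
      @C_map_on R (total_space E) X r setT (@projT1 _ _)
    & forall x0 : X, exists2 psi : trivialization E,
        is_trivialization r psi & tdom psi x0].

(** *** Sections *)

Definition section E : Type := forall x, fib E x.

HB.instance Definition _ E := gen_eqMixin (section E).
HB.instance Definition _ E := gen_choiceMixin (section E).

Section section_lmodule.
Context (E : bundle X F).
Implicit Types s t u : section E.

Let add s t : section E := fun x => s x + t x.
Let opp s : section E := fun x => - s x.
Let zero : section E := fun x => 0.
Let scale (a : R) s : section E := fun x => of_real cplx a *: s x.

Let addA : associative add.
Proof. by move=> s t u; apply: functional_extensionality_dep => x; exact: addrA. Qed.
Let addC : commutative add.
Proof. by move=> s t; apply: functional_extensionality_dep => x; exact: addrC. Qed.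
Let add0 : left_id zero add.
Proof. by move=> s; apply: functional_extensionality_dep => x; exact: add0r. Qed.
Let addN : left_inverse zero opp add.
Proof. by move=> s; apply: functional_extensionality_dep => x; exact: addNr. Qed.

HB.instance Definition _ := GRing.isZmodule.Build (section E) addA addC add0 addN.

Let scaleA a b s : scale a (scale b s) = scale (a * b) s.
Proof.
by apply: functional_extensionality_dep => x; rewrite /scale scalerA of_realM.
Qed.
Let scale1 : left_id 1 scale.
Proof.
by move=> s; apply: functional_extensionality_dep => x;
  rewrite /scale of_real1 scale1r.
Qed.
Let scaleDr : right_distributive scale +%R.
Proof.
by move=> a s t; apply: functional_extensionality_dep => x; exact: scalerDr.
Qed.
Let scaleDl s : {morph scale^~ s : a b / a + b}.
Proof.
move=> a b; apply: functional_extensionality_dep => x.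
by rewrite /scale of_realD; exact: scalerDl.
Qed.

HB.instance Definition _ :=
  GRing.Zmodule_isLmodule.Build R (section E) scaleA scale1 scaleDr scaleDl.

End section_lmodule.

Definition C_section r E : set (section E) :=
  [set s | @C_map_on R X (total_space E) r setT (fun x => total_pt (s x))].

Definition CK_section r (K : set X) E : set (section E) :=
  [set s | @C_section r E s /\ closure [set x | s x != 0] `<=` K].

Definition CK_section_in r (K : set X) E (U : set (total_space E)) : set (section E) :=
  [set s | @CK_section r K E s /\ forall x, U (total_pt (s x))].

(** All sections, with the topology of C^r(X, E). *)
Definition section_top (r : option nat) E : Type := section E.

HB.instance Definition _ r E := Choice.on (section_top r E).
HB.instance Definition _ r E := Topological.copy (section_top r E)
  (sup_topology (fun psi : {psi : trivialization E | is_trivialization r psi} =>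
     Topological.class (initial_topology
       (fun s : section E => (fun x => tmap (projT1 psi) (s x))
          : C_fun (real_lcs F) r (tdom (projT1 psi)))))).

End bundle.

Arguments is_trivialization {R X cplx F} r {E} psi.
Arguments C_section {R X cplx F} r E.
Arguments CK_section {R X cplx F} r K E.
Arguments CK_section_in {R X cplx F} r K {E} U.

(** *** The locally convex space C^r_K(X, E) *)

Definition linear_span (R : realType) (V : lmodType R) (A : set V) : {pred V} :=
  fun v => `[< forall L : {pred V}, submod_closed L ->
                 (forall w, A w -> w \in L) -> v \in L >].

Lemma linear_span_submod_closed (R : realType) (V : lmodType R) (A : set V) :
  submod_closed (linear_span A).
Proof.
split; first by apply/asboolP => L [L0 _] _.
move=> a u v /asboolP uA /asboolP vA; apply/asboolP => L Lsub AL.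
by apply: (proj2 Lsub); [exact: uA|exact: vA].
Qed.

HB.instance Definition _ (R : realType) (V : lmodType R) (A : set V) :=
  GRing.isSubmodClosed.Build R V (linear_span A) (linear_span_submod_closed A).

(** [CK_section r K E] is a vector subspace of [section E] if [E] is a C^r-vector
    bundle, and hence equal to its linear span. Using the span, the type below is
    a vector space for all [E], without reference to that fact. *)
Record CK_space (R : realType) (X : charted R) (cplx : bool)
    (F : tvsType (scalars R cplx)) (r : option nat) (K : set X)
    (E : bundle X F) : Type := CKSpace {
  CK_val :> section E ;
  _ : CK_val \in linear_span (CK_section r K E) }.

Section CK_space.
Context {R : realType} {X : charted R} {cplx : bool}.
Context {F : tvsType (scalars R cplx)} (r : option nat) (K : set X).
Context (E : bundle X F).
Local Notation V := (CK_space r K E).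

HB.instance Definition _ := [isSub for @CK_val R X cplx F r K E].
HB.instance Definition _ := [Choice of V by <:].
HB.instance Definition _ := [SubChoice_isSubLmodule of V by <:].
HB.instance Definition _ := Topological.copy V
  (initial_topology (fun s : V => (s : section E) : section_top r E)).

Definition CK_space_in (U : set (total_space E)) : set V :=
  [set s | CK_section_in r K U s].

End CK_space.

Arguments CK_space_in {R X cplx F} r K {E} U.

(** *** Sums *)

Section sum.
Context {R : realType} {X : charted R} {cplx : bool} (r : option nat).
Context {F1 F2 : tvsType (scalars R cplx)}.
Context (E1 : bundle X F1) (E2 : bundle X F2).

Let sum_fib (x : X) : lmodType (scalars R cplx) := (fib E1 x * fib E2 x)%type.
Let sum_model : tvsType R := (cmodel X * real_lcs (F1 * F2)%type)%type.

(** The chart given by a chart of [X] and the trivialization [psi1 (+) psi2]. *)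
Definition sum_chart (c : chart X (cmodel X)) (psi1 : trivialization E1)
    (psi2 : trivialization E2) : chart {x : X & sum_fib x} sum_model :=
  Chart [set p | [/\ cdom c (projT1 p), tdom psi1 (projT1 p)
                   & tdom psi2 (projT1 p)]]
    (fun p => (cmap c (projT1 p),
               (tmap psi1 (projT2 p).1, tmap psi2 (projT2 p).2)))
    (fun u => existT sum_fib (cinv c u.1)
               (tinv psi1 (cinv c u.1) u.2.1, tinv psi2 (cinv c u.1) u.2.2)).

Definition sum_atlas : set (chart {x : X & sum_fib x} sum_model) :=
  [set e | exists c psi1 psi2,
     [/\ atlas c, is_trivialization r psi1, is_trivialization r psi2
       & e = sum_chart c psi1 psi2]].

Definition sum_bundle : bundle X (F1 * F2)%type :=
  @Bundle R X cplx (F1 * F2)%type sum_fib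
    (Topological.class (chart_space sum_atlas)) sum_model sum_atlas.

End sum.

(** [pow_bundle r E n] is E^(2^n) and [pow_dom r n U] is U (+) E^(2^n - 1). *)

Fixpoint pow_fibre (K : numFieldType) (F : tvsType K) (n : nat) : tvsType K :=
  if n is m.+1 then (pow_fibre F m * pow_fibre F m)%type else F.

Section pow.
Context {R : realType} {X : charted R} {cplx : bool} (r : option nat).
Context {F : tvsType (scalars R cplx)}.

Fixpoint pow_bundle (E : bundle X F) (n : nat) : bundle X (pow_fibre F n) :=
  match n return bundle X (pow_fibre F n) with
  | 0 => E
  | m.+1 => sum_bundle r (pow_bundle E m) (pow_bundle E m)
  end.

Fixpoint pow_dom (E : bundle X F) (n : nat) (U : set (total_space E)) :
    set (total_space (pow_bundle E n)) :=
  match n return set (total_space (pow_bundle E n)) with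
  | 0 => U
  | m.+1 => [set p | @pow_dom E m U (total_pt (projT2 p).1)]
  end.

(** The natural map from C^r_K(X, E)^(2^n) to the sections of E^(2^n). *)
Fixpoint pair_sections (K : set X) (E : bundle X F) (n : nat) :
    pow2 (CK_space r K E) n -> section (pow_bundle E n) :=
  match n return pow2 (CK_space r K E) n -> section (pow_bundle E n) with
  | 0 => fun s => s
  | m.+1 => fun s x => (@pair_sections K E m s.1 x, @pair_sections K E m s.2 x)
  end.

Definition CK_pair (K : set X) (E : bundle X F) (n : nat)
    (s : pow2 (CK_space r K E) n) : CK_space r K (pow_bundle E n) :=
  insubd 0 (pair_sections s).

End pow.

Arguments pow_dom {R X cplx} r {F E} n U.
Arguments CK_pair {R X cplx} r {F} K {E} n s.

(** ** Bundle maps *)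

Section bundle_maps.
Context {R : realType} {X : charted R} {c1 c2 : bool} (r : option nat).
Context {F1 : tvsType (scalars R c1)} {F2 : tvsType (scalars R c2)}.

(** A bundle map on an open subset [U] of the total space of [E1] is represented
    by an extension to all of [E1]; the values outside [U] are irrelevant. *)
Definition bundle_map (E1 : bundle X F1) (E2 : bundle X F2) : Type :=
  forall x, fib E1 x -> fib E2 x.

HB.instance Definition _ E1 E2 := gen_eqMixin (bundle_map E1 E2).
HB.instance Definition _ E1 E2 := gen_choiceMixin (bundle_map E1 E2).

Context {E1 : bundle X F1} {E2 : bundle X F2}.
Implicit Types (U : set (total_space E1)) (f : bundle_map E1 E2).

Definition total_map f (p : total_space E1) : total_space E2 :=
  total_pt (f (projT1 p) (projT2 p)).

Definition balanced U : Prop :=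
  forall x (v : fib E1 x) (t : R), `|t| <= 1 ->
    U (total_pt v) -> U (total_pt (of_real c1 t *: v)).

Definition local_rep f (phi : trivialization E2) (psi : trivialization E1)
    (x : X) : real_lcs F1 -> real_lcs F2 :=
  fun v => tmap phi (f x (tinv psi x v)).

Definition local_dom U (phi : trivialization E2) (psi : trivialization E1)
    : set (X * real_lcs F1) :=
  (fun p : total_space E1 => (projT1 p, tmap psi (projT2 p))) @`
    (U `&` [set p | (tdom psi `&` tdom phi) (projT1 p)]).

Definition partially_C_map (k : option nat) U f : Prop :=
  forall (psi : trivialization E1) (phi : trivialization E2),
    is_trivialization r psi -> is_trivialization r phi ->
    partially_C_on k (local_dom U phi psi) (local_rep f phi psi).

(** C^r_K(X, f), the map [s |-> f o s]. *)
Definition CK_map (K : set X) f (s : CK_space r K E1) : CK_space r K E2 :=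
  insubd 0 ((fun x => f x (CK_val s x)) : section E2).

End bundle_maps.

Arguments CK_map {R X c1 c2} r {F1 F2 E1 E2} K f s.

Section delta.
Context {R : realType} {X : charted R} {c1 c2 : bool} (r : option nat).

(** [g] represents [delta f] on [U (+) E1]. *)
Definition is_delta {F1 : tvsType (scalars R c1)} {F2 : tvsType (scalars R c2)}
    {E1 : bundle X F1} {E2 : bundle X F2} (U : set (total_space E1))
    (f : bundle_map E1 E2) (g : bundle_map (sum_bundle r E1 E1) E2) : Prop :=
  forall (psi : trivialization E1) (phi : trivialization E2),
    is_trivialization r psi -> is_trivialization r phi ->
    forall x (v w : fib E1 x), tdom psi x -> tdom phi x -> U (total_pt v) ->
      tmap phi (g x (v, w)) =
      diff1 (local_rep f phi psi x)
        (tmap psi v : real_lcs F1, tmap psi w : real_lcs F1) :> real_lcs F2.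

Context {F1 : tvsType (scalars R c1)} {F2 : tvsType (scalars R c2)}.
Context {E1 : bundle X F1} {E2 : bundle X F2}.

(** [delta^n f], which is determined by [f] on [U (+) E1^(2^n - 1)]. *)
Fixpoint delta (U : set (total_space E1)) (f : bundle_map E1 E2) (n : nat) :
    bundle_map (pow_bundle r E1 n) E2 :=
  match n return bundle_map (pow_bundle r E1 n) E2 with
  | 0 => f
  | m.+1 => xget (fun _ _ => 0) [set g | is_delta (pow_dom r m U) (@delta U f m) g]
  end.

End delta.

Arguments delta {R X c1 c2} r {F1 F2 E1 E2} U f n.

(* Main.v *)
Require Import Defs.
From HB Require Import structures.
From mathcomp Require Import all_boot all_order all_algebra.
From mathcomp Require Import all_classical all_reals all_analysis.
From mathcomp Require Import ring lra.
Import numFieldNormedType.Exports.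

Set Implicit Arguments.
Unset Strict Implicit.
Unset Printing Implicit Defensive.

Import Order.TTheory GRing.Theory Num.Theory.
Local Open Scope classical_set_scope.
Local Open Scope ring_scope.

(** Write [CK(E)] for C^r_K(X, E). Since [X] is finite-dimensional, its iterated
    tangent bundles are locally compact, and the compact-open topologies that
    define the topology of [CK(E)] obey an exponential law: a map [Phi] into
    [CK(E)] is continuous if and only if all iterated differentials of the local
    representatives of [Phi p] are jointly continuous in [p] and in the point
    ([CK_lift] for one direction, [CK_evaluation] for the other). In this way every
    claim about spaces of sections becomes a claim about families [g p] of maps
    between open subsets of locally convex spaces which are of class C^n and whose
    differentials depend continuously on [(p, u)]. The predicate [PC] says this, and
    it is stable under composition ([PC_comp]).

    _Continuity_. In a chart of [X] and in trivializations, [f o s] is the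
    composition of the C^r local representative of [f] with [u |-> (u, s u)]. The
    latter is a [PC]-family with parameter [s], hence so is the former; therefore
    [s |-> f o s] is continuous ([bundle_map_family], [CK_map_continuous]).

    _Derivative_. For sections [s] and [h], put [G t = f o (s + t h)] and
    [H t = (delta f) o (s + t h, h)]. Both are [PC]-families with parameter [t], and
    [H] is the derivative of [G] with respect to [t] at each point of [X]. Then the
    difference quotient [(G t - G 0) / t], extended by [H 0] at [t = 0], is a
    [PC]-family as well ([PC_time_quotient]), hence continuous in [t] as a map to
    [CK(E2)]; continuity at [t = 0] is the wanted differentiability
    ([CK_difference_quotient]). The point is that the derivative in [t] commutes with
    the differentials in [u] ([time_derivative_diff1]). Because the model spaces may
    be incomplete, this is not shown with integrals but with a mean value theorem
    for convex sets ([mean_value_convex]).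

    _Higher derivatives_. Sums of vector bundles are vector bundles
    ([good_sum_bundle]) and sections of [E^(2^j)] are tuples of sections of [E],
    also topologically ([CK_pair_bij], [CK_pair_continuous]). The maps [delta^j f] exist
    because differentials of maps between fibres transform linearly under changes
    of trivializations ([is_delta_exists]), and they are the [j]-th differentials of
    [f] in the fibres ([delta_diffn]), so that they can be differentiated again as
    long as [f] can. Thus the two steps above apply to each [delta^j f], and an
    induction on [j] finishes the proof ([diffn_CK_map_limit], [diffn_CK_map]). *)

(** * Limits and mean values in locally convex spaces *)

Section tvs_limits.
Context {R : realType}.
Implicit Types E F : tvsType R.

Lemma tvs_cvgD E T (G : set_system T) {FG : Filter G} (f g : T -> E) (a b : E) :
  f t @[t --> G] --> a -> g t @[t --> G] --> b ->
  f t + g t @[t --> G] --> a + b.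
Proof.
move=> fa gb.
apply: (@continuous2_cvg _ E E E G _ f g (fun x y => x + y) a b) => //.
exact: (@add_continuous E (a, b)).
Qed.

Lemma tvs_cvgZ E T (G : set_system T) {FG : Filter G} (k : T -> R) (f : T -> E)
    (c : R) (a : E) :
  k t @[t --> G] --> c -> f t @[t --> G] --> a ->
  k t *: f t @[t --> G] --> c *: a.
Proof.
move=> kc fa.
apply: (@continuous2_cvg _ R^o E E G _ k f (fun x y => x *: y) c a) => //.
exact: (@scale_continuous R E (c, a)).
Qed.

Lemma tvs_cvgZl E T (G : set_system T) {FG : Filter G} (f : T -> E)
    (c : R) (a : E) :
  f t @[t --> G] --> a -> c *: f t @[t --> G] --> c *: a.
Proof. by move=> fa; apply: tvs_cvgZ => //; exact: cvg_cst. Qed.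

Lemma tvs_cvgB E T (G : set_system T) {FG : Filter G} (f g : T -> E) (a b : E) :
  f t @[t --> G] --> a -> g t @[t --> G] --> b ->
  f t - g t @[t --> G] --> a - b.
Proof.
move=> fa gb; rewrite -scaleN1r.
under eq_fun do rewrite -scaleN1r.
by apply: tvs_cvgD => //; apply: tvs_cvgZ => //; exact: cvg_cst.
Qed.

Definition convex_in E (C : set E) :=
  forall (x y : E) (t : R), 0 <= t <= 1 -> C x -> C y -> C (t *: x + (1 - t) *: y).

Lemma convex_open_nbhs E (x : E) (A : set E) : nbhs x A ->
  exists C, [/\ open C, C x, convex_in C & C `<=` A].
Proof.
have [B Bc [Bo Bb]] := @locally_convex _ E.
move=> /Bb[C [BC Cx] CA]; exists C; split => //; first exact: Bo.
move=> y z t t01 Cy Cz.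
have li : Itv.spec (@Itv.num_sem R) (Itv.Real `[0%Z, 1%Z]) t.
  by case/andP: t01 => t0 t1; apply/and3P; split; rewrite /= ?num_real// bnd_simp.
have := Bc C (mem_set BC) y z (Itv.mk li) (mem_set Cy) (mem_set Cz).
by rewrite inE /conv/= /unstable.onem.
Qed.

Lemma convex_open_closure E (x : E) (A : set E) : nbhs x A ->
  exists C, [/\ open C, C x, convex_in C & closure C `<=` A].
Proof.
move=> /(uniform_regular (a := x))[B xB BA].
have [C [Co Cx Cc CB]] := convex_open_nbhs xB.
by exists C; split => //; apply: subset_trans BA; exact: closure_subset.
Qed.

(** A mean value theorem without linear functionals: if [C] is a convex
    neighbourhood of all derivatives of [c], then it contains the mean slope. A slope
    over [[a, b]] is a convex combination of the slopes over [[a, m]] and [[m, b]], so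
    the set of [a] such that the slope over [[0, a]] is in [C] contains its supremum
    [s], and it reaches beyond [s] unless [s = 1]. *)
Lemma mean_value_convex E (c d : R -> E) (C : set E) : convex_in C ->
  (forall a, 0 <= a <= 1 -> nbhs (d a) C) ->
  (forall a, 0 <= a <= 1 -> t^-1 *: (c (a + t) - c a) @[t --> 0^'] --> d a) ->
  C (c 1 - c 0).
Proof.
move=> Cc dC cd.
pose Q a b := C ((b - a)^-1 *: (c b - c a)).
have Qtrans a m b : a < m -> m < b -> Q a m -> Q m b -> Q a b.
  move=> am mb Qam Qmb; rewrite /Q.
  have ma : m - a != 0 by rewrite subr_eq0 gt_eqF.
  have bm : b - m != 0 by rewrite subr_eq0 gt_eqF.
  have ba : b - a != 0 by rewrite subr_eq0 gt_eqF// (lt_trans am).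
  have -> : (b - a)^-1 *: (c b - c a) =
    ((m - a) / (b - a)) *: ((m - a)^-1 *: (c m - c a)) +
    (1 - (m - a) / (b - a)) *: ((b - m)^-1 *: (c b - c m)).
    rewrite !scalerA.
    have -> : (m - a) / (b - a) / (m - a) = (b - a)^-1.
      by field; rewrite ?ma ?ba.
    have -> : (1 - (m - a) / (b - a)) / (b - m) = (b - a)^-1.
      by field; rewrite ?bm ?ba.
    by rewrite -scalerDr [X in _ = _ *: X]addrC addrA subrK.
  have ba0 : 0 < b - a by lra.
  apply: Cc => //; apply/andP; split; first by rewrite divr_ge0//; lra.
  by rewrite ler_pdivrMr//; lra.
have near a : 0 <= a <= 1 -> exists2 e, 0 < e &
    (forall b, a < b -> b < a + e -> Q a b) /\
    (forall b, b < a -> a - e < b -> Q b a).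
  move=> a01; have /(cd a a01) := dC a a01.
  move=> [e /= e0 eC]; exists e => //; split=> b ab be.
  - have := eC (b - a); rewrite /= sub0r normrN subrKC; apply.
      by rewrite gtr0_norm; lra.
    by rewrite subr_eq0 gt_eqF.
  - have := eC (b - a); rewrite /= sub0r normrN subrKC /Q.
    rewrite -[X in X^-1 *: _]opprB invrN scaleNr -scalerN opprB; apply.
      by rewrite distrC gtr0_norm; lra.
    by rewrite subr_eq0 lt_eqF.
(* [a = 0] is included since there is no slope over a degenerate interval. *)
pose S := [set a | 0 <= a <= 1 /\ (a = 0 \/ Q 0 a)].
have S0 : S 0 by split; [lra|left].
have Sub : ubound S 1 by move=> a [] /andP[].
have hS : has_sup S by split; [exists 0|exists 1].
pose s := sup S.
have s0 : 0 <= s by exact: sup_upper_bound hS _ S0.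
have s1 : s <= 1 by apply: ge_sup => //; exists 0.
have [e e0 [eR eL]] := near s (introT andP (conj s0 s1)).
have Ss : S s.
  split; first exact/andP.
  have [->|s_neq0] := eqVneq s 0; [by left|right].
  have sgt0 : 0 < s by rewrite lt_neqAle eq_sym s_neq0.
  have [a [a01 Qa] ea] := sup_adherent e0 hS.
  have as_ : a <= s by exact: sup_upper_bound.
  have [a_s|] := ltP a s; last first.
    move=> sa; have as2 : a = s by apply/le_anti; rewrite as_ sa.
    by case: Qa => [a0|]; rewrite ?as2//; move: s_neq0; rewrite -as2 a0 eqxx.
  have Qas := eL _ a_s ea.
  case: Qa => [<-//|Qa].
  have [<-//|a0] := eqVneq a 0.
  by apply: (Qtrans 0 a s) => //; rewrite lt_neqAle eq_sym a0; case/andP: a01.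
have [s_1|s_lt1] := leP 1 s.
  have s11 : s = 1 by apply/le_anti; rewrite s1 s_1.
  case: Ss => _; rewrite s11 => -[/eqP|]; first by rewrite oner_eq0.
  by rewrite /Q subr0 invr1 scale1r.
pose b := Num.min (s + e / 2) 1.
have sb : s < b by rewrite /b lt_min s_lt1 andbT; lra.
have be : b < s + e by rewrite /b gt_min; apply/orP; left; lra.
have b1 : b <= 1 by rewrite /b ge_min lexx orbT.
have Qsb := eR _ sb be.
have : S b.
  split; first by rewrite b1 andbT (le_trans s0)// ltW.
  right; case: Ss => _ [s00|Qs]; first by move: Qsb; rewrite s00.
  have [s00|s00] := eqVneq s 0; first by move: Qsb; rewrite s00.
  by apply: (Qtrans 0 s b) => //; rewrite lt_neqAle eq_sym s00.
by move=> /(sup_upper_bound hS); rewrite leNgt sb.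
Qed.

Lemma cvg_quotientB E (f g : R -> E) (c : R) (f0 g0 f' g' : E) :
  t^-1 *: (f t - f0) @[t --> 0^'] --> f' -> t^-1 *: (g t - g0) @[t --> 0^'] --> g' ->
  t^-1 *: (c *: (f t - g t) - c *: (f0 - g0)) @[t --> 0^'] --> c *: (f' - g').
Proof.
move=> ff gg; have : c *: (t^-1 *: (f t - f0) - t^-1 *: (g t - g0)) @[t --> 0^'] -->
  c *: (f' - g') by apply: tvs_cvgZl; apply: tvs_cvgB.
apply: cvg_trans; apply: near_eq_cvg; apply: nearW => t.
rewrite -!scalerBr !scalerA mulrC; congr (_ *: _).
by rewrite !opprB addrACA [in RHS]addrACA; congr (_ + _); rewrite addrC.
Qed.

Lemma dnbhs0M (t : R) : t != 0 -> s * t @[s --> (0 : R)^'] --> (0 : R)^'.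
Proof.
move=> t0 B /= [e /= e0 eB]; exists (e / `|t|) => /=; first by rewrite divr_gt0// normr_gt0.
move=> s /=; rewrite !sub0r !normrN => se s0; apply: eB => /=.
  by rewrite sub0r normrN normrM -ltr_pdivlMr// normr_gt0.
by rewrite mulf_neq0.
Qed.

(** The mean value theorem on the segment from [s] to [s + t], for [t] of any sign. *)
Lemma mean_value_quotient E (c d : R -> E) (C : set E) (s t : R) : t != 0 ->
  convex_in C ->
  (forall a, 0 <= a <= 1 -> nbhs (d (s + a * t)) C) ->
  (forall a, 0 <= a <= 1 -> let b := s + a * t in
     r^-1 *: (c (b + r) - c b) @[r --> 0^'] --> d b) ->
  C (t^-1 *: (c (s + t) - c s)).
Proof.
move=> t0 Cc dC cd.
have := @mean_value_convex E (fun a => t^-1 *: c (s + a * t)) (fun a => d (s + a * t)) C Cc dC.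
rewrite mul1r mul0r addr0 -scalerBr; apply => a a01.
have := cvg_comp _ _ (dnbhs0M t0) (cd a a01).
apply: cvg_trans; apply: near_eq_cvg; near=> r.
by rewrite /= -scalerBr mulrDl addrA invfM scalerA.
Unshelve. all: by end_near. Qed.

End tvs_limits.

(** * Directional derivatives and the chain rule *)

Section directional_derivatives.
Context {R : realType}.

Definition has_dir (E F : preTopologicalLmodType R) (f : E -> F) (x h : E) : Prop :=
  exists y : F, diffquot f x h t @[t --> 0^'] --> y.

(** Linearity over R in the form in which directions are added to points. *)
Definition lin (E F : lmodType R) (l : E -> F) : Prop :=
  forall (a : R) u v, l (u + a *: v) = l u + a *: l v.

Section pre.
Implicit Types E F G : preTopologicalLmodType R.

Lemma diff1P E F (f : E -> F) x h : has_dir f x h ->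
  diffquot f x h t @[t --> 0^'] --> diff1 f (x, h).
Proof. exact: xgetPex. Qed.

Lemma diff1_eq E F (f : E -> F) x h (y : F) : hausdorff_space F ->
  diffquot f x h t @[t --> 0^'] --> y -> diff1 f (x, h) = y.
Proof.
move=> hF fy; apply: (cvg_unique hF (F := diffquot f x h t @[t --> 0^'])) => //.
by apply: diff1P; exists y.
Qed.

Lemma diff1_dir0 E F (f : E -> F) x : hausdorff_space F -> diff1 f (x, 0) = 0.
Proof.
move=> hF; apply: diff1_eq => //; apply: cvg_near_cst; apply: nearW => t.
by rewrite /diffquot scaler0 addr0 subrr scaler0.
Qed.

Lemma diffquot_congr_cvg E F (f g : E -> F) x h (y : F) :
  (\forall t \near (0 : R), f (x + t *: h) = g (x + t *: h)) ->
  diffquot f x h t @[t --> 0^'] --> y -> diffquot g x h t @[t --> 0^'] --> y.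
Proof.
move=> fg; apply: cvg_trans; apply: near_eq_cvg.
have := nbhs_singleton fg; rewrite scale0r addr0 => fgx.
have := @nbhs_dnbhs R 0 _ fg; apply: filterS => t fgt.
by rewrite /diffquot fgx fgt.
Qed.

(** [diff1 f (x, h)] only depends on the germ of [f] along the line through [x] in
    direction [h]. *)
Lemma diff1_congr E F (f g : E -> F) x h :
  (\forall t \near (0 : R), f (x + t *: h) = g (x + t *: h)) ->
  diff1 f (x, h) = diff1 g (x, h).
Proof.
move=> fg; rewrite /diff1; congr xget; apply/seteqP; split=> y /=;
  apply: diffquot_congr_cvg => //.
by apply: filterS fg.
Qed.

Lemma has_dir_congr E F (f g : E -> F) x h :
  (\forall t \near (0 : R), f (x + t *: h) = g (x + t *: h)) ->
  has_dir f x h -> has_dir g x h.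
Proof. by move=> fg [y fy]; exists y; exact: diffquot_congr_cvg fy. Qed.

Lemma diffquot_precomp E F G (f : F -> G) (l : E -> F) x h : lin l ->
  diffquot (f \o l) x h = diffquot f (l x) (l h).
Proof. by move=> ll; apply/funext => t; rewrite /diffquot /= ll. Qed.

(** Precomposition with a linear map only changes the arguments of the difference
    quotient, so this is an identity before any limit is taken. *)
Lemma diff1_precomp E F G (f : F -> G) (l : E -> F) x h : lin l ->
  diff1 (f \o l) (x, h) = diff1 f (l x, l h).
Proof. by move=> ll; rewrite /diff1 /= diffquot_precomp. Qed.

Lemma has_dir_precomp E F G (f : F -> G) (l : E -> F) x h : lin l ->
  has_dir (f \o l) x h <-> has_dir f (l x) (l h).
Proof. by move=> ll; rewrite /has_dir diffquot_precomp. Qed.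

Lemma diffquot_lin E F (l : E -> F) x h : lin l ->
  diffquot l x h t @[t --> 0^'] --> l h.
Proof.
move=> ll; apply: cvg_near_cst.
near=> t; rewrite /diffquot ll addrAC subrr add0r scalerA mulVf ?scale1r//.
by near: t; exact: nbhs_dnbhs_neq.
Unshelve. all: by end_near. Qed.

Lemma diffquot_pair E F G (f : E -> F) (g : E -> G) x h (y : F) (z : G) :
  diffquot f x h t @[t --> 0^'] --> y -> diffquot g x h t @[t --> 0^'] --> z ->
  diffquot (fun u => (f u, g u) : (F * G)%type) x h t @[t --> 0^'] --> (y, z).
Proof. by move=> fy gz; apply: cvg_pair. Qed.

Lemma hausdorff_pair (S T : topologicalType) :
  hausdorff_space S -> hausdorff_space T -> hausdorff_space (S * T)%type.
Proof.
move=> hS hT [a b] [c d] cl; congr pair.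
- apply: hS => A B aA cB.
  have nA : nbhs (a, b) (A `*` setT) by exists (A, setT) => //; split => //; exact: filterT.
  have nB : nbhs (c, d) (B `*` setT) by exists (B, setT) => //; split => //; exact: filterT.
  by have [[x y] [[Ax _] [Bx _]]] := cl _ _ nA nB; exists x.
- apply: hT => A B aA cB.
  have nA : nbhs (a, b) (setT `*` A) by exists (setT, A) => //; split => //; exact: filterT.
  have nB : nbhs (c, d) (setT `*` B) by exists (setT, B) => //; split => //; exact: filterT.
  by have [[x y] [[_ Ax] [_ Bx]]] := cl _ _ nA nB; exists y.
Qed.

End pre.

Implicit Types E F G : tvsType R.

Lemma line_cvg E (x h : E) : x + t *: h @[t --> (0 : R)] --> x.
Proof.
rewrite -[X in _ --> X]addr0 -(scale0r h).
by apply: tvs_cvgD; [exact: cvg_cst|apply: tvs_cvgZ; [exact: cvg_id|exact: cvg_cst]].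
Qed.

Lemma line_near E (D : set E) (x h : E) : open D -> D x ->
  \forall t \near (0 : R), D (x + t *: h).
Proof. by move=> Do Dx; exact: (@line_cvg E x h D (open_nbhs_nbhs (conj Do Dx))). Qed.

Lemma diff1_congr_on E (F : preTopologicalLmodType R) (D : set E) (f g : E -> F) x h :
  open D -> D x -> (forall y, D y -> f y = g y) -> diff1 f (x, h) = diff1 g (x, h).
Proof.
move=> Do Dx fg; apply: diff1_congr; apply: filterS (line_near h Do Dx) => t; exact: fg.
Qed.

Lemma has_dir_congr_on E (F : preTopologicalLmodType R) (D : set E) (f g : E -> F) x h :
  open D -> D x -> (forall y, D y -> f y = g y) -> has_dir f x h -> has_dir g x h.
Proof.
move=> Do Dx fg; apply: has_dir_congr; apply: filterS (line_near h Do Dx) => t; exact: fg.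
Qed.

(** A directional derivative may be computed along directions that vary with
    the parameter: this is the chain rule along a curve. *)
Lemma diffquot_varying_direction E F (h : E -> F) (D : set E) (y k : E) (K : R -> E) :
  open D -> D y -> (forall x w, D x -> has_dir h x w) ->
  diff1 h z @[z --> within (D `*` setT) (nbhs (y, k))] --> diff1 h (y, k) ->
  K t @[t --> 0^'] --> k ->
  t^-1 *: (h (y + t *: K t) - h y) @[t --> 0^'] --> diff1 h (y, k).
Proof.
move=> Do Dy hD hc Kk A /convex_open_nbhs[C [Co Cx Cc CA]].
have /hc : nbhs (diff1 h (y, k)) C by exact: open_nbhs_nbhs.
move=> [[N1 N2] /= [N1y N2k] NC].
have /convex_open_nbhs[N [No Ny Nc NN]] : nbhs y (N1 `&` D).
  by apply: filterI => //; exact: open_nbhs_nbhs.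
have yK : y + t *: K t @[t --> 0^'] --> y.
  rewrite -[X in _ --> X]addr0 -(scale0r k).
  apply: tvs_cvgD; first exact: cvg_cst.
  apply: tvs_cvgZ => //; exact: nbhs_dnbhs.
(* The directional derivatives of [h] are in [C] all along the segment from [y] to
   [y + t K(t)] when [t] is small, since [N] is convex. *)
change (\forall t \near (0 : R)^', A (t^-1 *: (h (y + t *: K t) - h y))).
near=> t; apply: CA => /=.
have t0 : t != 0 by near: t; exact: nbhs_dnbhs_neq.
have Kt : N2 (K t) by near: t; exact: Kk.
have Nt : N (y + t *: K t) by near: t; apply: yK; exact: open_nbhs_nbhs.
have seg a : 0 <= a <= 1 -> N (y + (a * t) *: K t).
  move=> a01; have := Nc _ _ a a01 Nt Ny.
  rewrite scalerDr scalerA addrAC -scalerDl (_ : a + (1 - a) = 1) ?scale1r//.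
  by rewrite addrC subrK.
have := @mean_value_quotient R F (fun b => h (y + b *: K t))
  (fun b => diff1 h (y + b *: K t, K t)) C 0 t t0 Cc.
rewrite add0r scale0r addr0; apply.
  move=> a /seg /NN[N1a Da]; rewrite add0r; apply: open_nbhs_nbhs; split=> //.
  exact: (NC (_, _)).
move=> a /seg /NN[_ /(hD _ (K t)) /diff1P]; rewrite /= add0r.
apply: cvg_trans; apply: near_eq_cvg; apply: nearW => r.
by rewrite /diffquot scalerDl addrA.
Unshelve. all: by end_near. Qed.

(** The chain rule: [g (x + t w) = g x + t K(t)] where [K(t)] tends to the derivative of
    [g], so the previous lemma applies. *)
Lemma diffquot_comp E F G (g : E -> F) (h : F -> G) (D : set F) (x w : E) :
  open D -> D (g x) -> (forall y k, D y -> has_dir h y k) ->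
  diff1 h z @[z --> within (D `*` setT) (nbhs (g x, diff1 g (x, w)))] -->
    diff1 h (g x, diff1 g (x, w)) ->
  has_dir g x w ->
  diffquot (h \o g) x w t @[t --> 0^'] --> diff1 h (g x, diff1 g (x, w)).
Proof.
move=> Do Dg hD hc /diff1P gx.
have := diffquot_varying_direction Do Dg hD hc gx.
apply: cvg_trans; apply: near_eq_cvg; near=> t.
rewrite /diffquot /= scalerA divff ?scale1r; first by rewrite subrKC.
by near: t; exact: nbhs_dnbhs_neq.
Unshelve. all: by end_near. Qed.

End directional_derivatives.

(** * Families of class C^n with a continuous parameter *)

Section within_continuity.
Implicit Types S T V : topologicalType.

Lemma withinP S T (W : set S) (f : S -> T) :
  {within W, continuous f} <->
  (forall z, W z -> f y @[y --> within W (nbhs z)] --> f z).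
Proof. exact: subspace_continuousP. Qed.

Lemma withinN S T (W : set S) (f : S -> T) :
  {within W, continuous f} <->
  (forall z, W z -> forall A, nbhs (f z) A -> nbhs z (fun y => W y -> A (f y))).
Proof. exact: subspace_continuousP. Qed.

Lemma within_congr S T (W : set S) (f g : S -> T) :
  (forall z, W z -> f z = g z) -> {within W, continuous f} -> {within W, continuous g}.
Proof.
move=> fg fc; apply: (@subspace_eq_continuous S W T f) => // z /set_mem; exact: fg.
Qed.

Lemma within_comp S T V (W : set S) (W' : set T) (f : S -> T) (g : T -> V) :
  (forall z, W z -> W' (f z)) ->
  {within W, continuous f} -> {within W', continuous g} ->
  {within W, continuous (g \o f)}.
Proof.
move=> WW' /withinN fc /withinN gc; apply/withinN => z Wz A.
move=> /(gc _ (WW' _ Wz))/(fc _ Wz).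
by apply: filterS => y H Wy; apply: H => //; exact: WW'.
Qed.

Lemma within_pair S T V (W : set S) (f : S -> T) (g : S -> V) :
  {within W, continuous f} -> {within W, continuous g} ->
  {within W, continuous (fun z => (f z, g z))}.
Proof.
by move=> /withinP fc /withinP gc; apply/withinP => z Wz; apply: cvg_pair; [exact: fc|exact: gc].
Qed.

Lemma within_continuous S T (W : set S) (f : S -> T) :
  continuous f -> {within W, continuous f}.
Proof. by move=> fc; exact: continuous_subspaceT. Qed.

Lemma within_fst S T (W : set (S * T)) : {within W, continuous fst}.
Proof. by apply: within_continuous => z; exact: cvg_fst. Qed.

Lemma within_snd S T (W : set (S * T)) : {within W, continuous snd}.
Proof. by apply: within_continuous => z; exact: cvg_snd. Qed.

Lemma open_fst S T (A : set S) : open A -> open [set z : S * T | A z.1].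
Proof. by move=> Ao; apply: (@open_comp _ _ fst A) => // z _; exact: cvg_fst. Qed.

Lemma open_snd S T (A : set T) : open A -> open [set z : S * T | A z.2].
Proof. by move=> Ao; apply: (@open_comp _ _ snd A) => // z _; exact: cvg_snd. Qed.

Lemma open_prod S T (A : set S) (B : set T) : open A -> open B -> open (A `*` B).
Proof. by move=> /(@open_fst S T) Ao /(@open_snd S T); exact: openI. Qed.

Lemma within_local S T (W : set S) (f : S -> T) :
  (forall z, W z -> exists D, [/\ open D, D z & {within W `&` D, continuous f}]) ->
  {within W, continuous f}.
Proof.
move=> H; apply/withinN => z Wz A fzA; have [D [Do Dz /withinN fc]] := H z Wz.
have /(_ A fzA) H' := fc z (conj Wz Dz).
have : nbhs z D by exact: open_nbhs_nbhs.
by apply: filterS2 H' => y H' Dy Wy; apply: H'.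
Qed.

End within_continuity.

Section lin_pair.
Context {R : realType}.

Definition lin_pair (E E' : Type) (l : E -> E') : (E * E)%type -> (E' * E')%type :=
  fun z => (l z.1, l z.2).

Lemma lin_pair_lin (E E' : lmodType R) (l : E -> E') : lin l -> lin (lin_pair l).
Proof. by move=> ll a [u1 u2] [v1 v2]; rewrite /lin_pair /= !ll. Qed.

Lemma lin_pair_continuous (S T : topologicalType) (l : S -> T) :
  continuous l -> continuous (lin_pair l).
Proof.
move=> lc [u v]; apply: cvg_pair => /=.
- by apply: (@continuous_comp _ _ _ fst l (u, v)); [exact: cvg_fst|exact: lc].
- by apply: (@continuous_comp _ _ _ snd l (u, v)); [exact: cvg_snd|exact: lc].
Qed.

End lin_pair.

Section parametric.
Context {R : realType}.
Implicit Types (P : topologicalType) (E F G : tvsType R).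

(** A family of maps that is of class C^n, together with continuous dependence of
    its iterated differentials on the parameter. The recursion differentiates the
    family first, so that it runs over all spaces [E]. *)
Fixpoint PC P F n : forall E, set (P * E) -> (P -> E -> F) -> Prop :=
  match n with
  | 0 => fun E W g => {within W, continuous (fun z => g z.1 z.2)}
  | m.+1 => fun E W g =>
     [/\ {within W, continuous (fun z => g z.1 z.2)},
         (forall p u h, W (p, u) -> has_dir (g p) u h) &
         @PC P F m (E * E)%type [set z | W (z.1, z.2.1)] (fun p => diff1 (g p))]
  end.
Arguments PC {P F} n {E} W g.

Definition open_slices P E (W : set (P * E)) := forall p, open [set u | W (p, u)].

Lemma open_slices_tangent P E (W : set (P * E)) : open_slices W ->
  open_slices ([set z | W (z.1, z.2.1)] : set (P * (E * E)%type)).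
Proof. by move=> Wo p; exact: open_fst (Wo p). Qed.

Lemma PC_continuous P F n E (W : set (P * E)) (g : P -> E -> F) :
  PC n W g -> {within W, continuous (fun z => g z.1 z.2)}.
Proof. by case: n => // n []. Qed.

Lemma PC_has_dir P F n E (W : set (P * E)) (g : P -> E -> F) p u h :
  PC n.+1 W g -> W (p, u) -> has_dir (g p) u h.
Proof. by case=> _ + _; exact. Qed.

Lemma PC_pred P F n E (W : set (P * E)) (g : P -> E -> F) : PC n.+1 W g -> PC n W g.
Proof. by elim: n E W g => [|n IH] E W g [] // gc gd /IH. Qed.

Lemma PC_sub P F n E (W W' : set (P * E)) (g : P -> E -> F) :
  W' `<=` W -> PC n W g -> PC n W' g.
Proof.
elim: n E W W' g => [|n IH] E W W' g W'W /=; first exact: continuous_subspaceW.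
case=> gc gd gn; split.
- exact: continuous_subspaceW gc.
- by move=> p u h /W'W; exact: gd.
- by apply: IH gn => z /=; exact: W'W.
Qed.

(** Differentials at [u] are determined by the values near [u], so the slices of [W] have
    to be open. *)
Lemma PC_eq P F n E (W : set (P * E)) (f g : P -> E -> F) : open_slices W ->
  (forall p u, W (p, u) -> f p u = g p u) -> PC n W f -> PC n W g.
Proof.
elim: n E W f g => [|n IH] E W f g Wo fg /=.
  by apply: within_congr => -[p u]; exact: fg.
case=> fc fd fn; split.
- by apply: within_congr fc => -[p u]; exact: fg.
- move=> p u h Wpu; apply: (has_dir_congr_on (Wo p) Wpu _ (fd p u h Wpu)) => v; exact: fg.
- apply: IH fn; first exact: open_slices_tangent.
  by move=> p [u h] /= Wpu; apply: (diff1_congr_on _ (Wo p) Wpu) => v; exact: fg.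
Qed.

Lemma PC_local P F n E (W : set (P * E)) (g : P -> E -> F) :
  (forall p u, W (p, u) ->
     exists D, [/\ open D, D u & PC n (W `&` [set z | D z.2]) g]) -> PC n W g.
Proof.
elim: n E W g => [|n IH] E W g H /=.
  apply: within_local => -[p u] Wpu; have [D [Do Du gc]] := H p u Wpu.
  exists [set z | D z.2]; split => //.
  exact: open_snd.
split.
- apply: within_local => -[p u] Wpu; have [D [Do Du [gc _ _]]] := H p u Wpu.
  exists [set z | D z.2]; split => //.
  exact: open_snd.
- by move=> p u h Wpu; have [D [Do Du [_ gd _]]] := H p u Wpu; apply: gd.
- apply: IH => p [u h] /= Wpu; have [D [Do Du [_ _ gn]]] := H p u Wpu.
  exists [set z | D z.1]; split => //.
  exact: open_fst.
Qed.

Lemma PC_reparam P P' F n E (A : set P') (th : P' -> P) (W : set (P * E))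
    (W' : set (P' * E)) (g : P -> E -> F) :
  {within A, continuous th} -> (forall p u, W' (p, u) -> A p /\ W (th p, u)) ->
  PC n W g -> PC n W' (fun p => g (th p)).
Proof.
move=> thc; elim: n E W W' g => [|n IH] E W W' g W'W /=.
  move=> gc.
  apply: (within_comp (f := fun z => (th z.1, z.2)) _ _ gc).
    by move=> [p u] /W'W[].
  apply: within_pair; last exact: within_snd.
  apply: (within_comp (W' := A) _ _ thc); last exact: within_fst.
  by move=> [p u] /W'W[].
case=> gc gd gn; split.
- apply: (within_comp (f := fun z => (th z.1, z.2)) _ _ gc).
    by move=> [p u] /W'W[].
  apply: within_pair; last exact: within_snd.
  apply: (within_comp (W' := A) _ _ thc); last exact: within_fst.
  by move=> [p u] /W'W[].
- by move=> p u h /W'W[_]; exact: gd.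
- by apply: IH gn => p [u h] /=; exact: W'W.
Qed.

Lemma PC_precomp P F n E E' (l : E' -> E) (W : set (P * E)) (g : P -> E -> F) :
  lin l -> continuous l ->
  PC n W g -> PC n [set z | W (z.1, l z.2)] (fun p u => g p (l u)).
Proof.
move=> ll lc; elim: n E E' l ll lc W g => [|n IH] E E' l ll lc W g /=.
  move=> gc; apply: (within_comp (f := fun z => (z.1, l z.2)) _ _ gc) => //.
  apply: within_pair; first exact: within_fst.
  by apply: (within_comp (W' := setT) _ (@within_snd _ _ _)) => //; exact: within_continuous.
case=> gc gd gn; split.
- apply: (within_comp (f := fun z => (z.1, l z.2)) _ _ gc) => //.
  apply: within_pair; first exact: within_fst.
  by apply: (within_comp (W' := setT) _ (@within_snd _ _ _)) => //; exact: within_continuous.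
- by move=> p u h /= Wpu; apply/(has_dir_precomp (g p) u h ll); exact: gd.
- have := IH _ _ _ (lin_pair_lin ll) (lin_pair_continuous lc) _ _ gn.
  congr (PC n _ _); apply/funext => p; apply/funext => -[u h].
  by rewrite /lin_pair /= -diff1_precomp.
Qed.

Lemma PC_pair P F G n E (W : set (P * E)) (f : P -> E -> F) (g : P -> E -> G) :
  hausdorff_space F -> hausdorff_space G -> open_slices W ->
  PC n W f -> PC n W g -> PC n W (fun p u => (f p u, g p u) : (F * G)%type).
Proof.
move=> hF hG; elim: n E W f g => [|n IH] E W f g Wo /=.
  by move=> fc gc; exact: within_pair.
move=> [fc fd fn] [gc gd gn].
have fgd p u h : W (p, u) -> diffquot (fun u => (f p u, g p u) : (F * G)%type) u h t
    @[t --> 0^'] --> (diff1 (f p) (u, h), diff1 (g p) (u, h)).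
  by move=> Wpu; apply: diffquot_pair; apply: diff1P; [exact: fd|exact: gd].
split; first exact: within_pair.
  by move=> p u h Wpu; eexists; exact: fgd.
apply: PC_eq (IH _ _ _ _ (open_slices_tangent Wo) fn gn).
  exact: open_slices_tangent.
move=> p [u h] /= Wpu; apply/esym/diff1_eq; first exact: hausdorff_pair.
exact: fgd.
Qed.

(** The differential of a linear map is the map itself, in the direction variable. *)
Lemma PC_lin P F n E (A : set P) (W : set (P * E)) (h : P -> E -> F) :
  hausdorff_space F -> (forall p, lin (h p)) ->
  {within [set z | A z.1], continuous (fun z : P * E => h z.1 z.2)} ->
  W `<=` [set z | A z.1] -> PC n W h.
Proof.
move=> hF; elim: n E W h => [|n IH] E W h hl hc WA /=.
  exact: continuous_subspaceW hc.
split; first exact: continuous_subspaceW hc.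
  by move=> p u w _; exists (h p w); exact: diffquot_lin.
have -> : (fun p => diff1 (h p)) = (fun p z => h p z.2).
  apply/funext => p; apply/funext => -[u w] /=.
  by apply: diff1_eq => //; exact: diffquot_lin.
apply: IH.
- by move=> p a u v /=; rewrite hl.
- apply: (within_comp (f := fun z : P * (E * E)%type => (z.1, z.2.2)) _ _ hc) => //.
  apply: within_pair; first exact: within_fst.
  apply: within_continuous => z.
  by apply: (@continuous_comp _ _ _ snd snd z); exact: cvg_snd.
- by move=> z /= /WA.
Qed.

(** The chain rule for families. The differential of [h p o g p] is [diff1 (h p)] composed
    with the tangent map [(u, w) |-> (g p u, diff1 (g p) (u, w))], which is a family of
    one class less, so induction on [n] applies. *)
Lemma PC_comp P E F G n (W : set (P * E)) (Z : set (P * F))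
    (g : P -> E -> F) (h : P -> F -> G) :
  hausdorff_space F -> hausdorff_space G -> open_slices W -> open_slices Z ->
  (forall p u, W (p, u) -> Z (p, g p u)) ->
  PC n W g -> PC n Z h -> PC n W (fun p u => h p (g p u)).
Proof.
move=> hF hG; elim: n E F hF W Z g h => [|n IH] E F hF W Z g h Wo Zo WZ /=.
  move=> gn hn; apply: (within_comp (f := fun z => (z.1, g z.1 z.2)) _ _ hn) => [[p u]|].
    exact: WZ.
  by apply: within_pair => //; exact: within_fst.
move=> gn hn; have gP := PC_pred gn; have hP := PC_pred hn.
case: gn hn => gc gd gn [hc hd hn].
have hdc p y k : Z (p, y) ->
    diff1 (h p) z @[z --> within ([set v | Z (p, v)] `*` setT) (nbhs (y, k))]
      --> diff1 (h p) (y, k).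
  move=> Zpy A nA; have /withinN/(_ (p, (y, k)) Zpy A nA) := PC_continuous hn.
  move=> -[[N1 N2] /= [N1p N2yk] NA].
  apply: filterS N2yk => z N2z [Zz _]; apply: (NA (p, z)) => //.
  by split => //; exact: nbhs_singleton.
have hgd p u w : W (p, u) ->
    diffquot (h p \o g p) u w t @[t --> 0^'] --> diff1 (h p) (g p u, diff1 (g p) (u, w)).
  move=> Wpu; apply: (diffquot_comp (Zo p)); first exact: WZ.
  - by move=> y k; exact: hd.
  - exact: hdc (WZ _ _ Wpu).
  - exact: gd.
split.
- apply: (within_comp (f := fun z => (z.1, g z.1 z.2)) _ _ hc) => [[p u]|].
    exact: WZ.
  by apply: within_pair => //; exact: within_fst.
- by move=> p u w Wpu; eexists; exact: hgd.
have Wt := open_slices_tangent Wo.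
apply: (@PC_eq P G n _ _ (fun p z => diff1 (h p) (g p z.1, diff1 (g p) z))) => //.
  by move=> p [u w] /= Wpu; apply/esym/diff1_eq => //; exact: hgd.
apply: (IH _ _ (hausdorff_pair hF hF) _ [set z | Z (z.1, z.2.1)]
  (fun p z => (g p z.1, diff1 (g p) z)) (fun p => diff1 (h p))) => //.
- exact: open_slices_tangent.
- by move=> p [u w] /=; exact: WZ.
- apply: PC_pair => //.
  by apply: (PC_precomp _ _ gP) => // z; exact: cvg_fst.
Qed.

End parametric.
Arguments PC {R P F} n {E} W g.

(** * Comparison with iterated differentials *)

Section flat.
Context {R : realType}.
Implicit Types (P : topologicalType) (E F G : tvsType R).

(** [pow2 (E x E) m] and [pow2 E m.+1] differ in whether the first or the last
    doubling is performed on [E]. *)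
Fixpoint regroup E m : pow2 (E * E)%type m -> pow2 E m.+1 :=
  match m return pow2 (E * E)%type m -> pow2 E m.+1 with
  | 0 => id
  | i.+1 => lin_pair (@regroup E i)
  end.

Fixpoint ungroup E m : pow2 E m.+1 -> pow2 (E * E)%type m :=
  match m return pow2 E m.+1 -> pow2 (E * E)%type m with
  | 0 => id
  | i.+1 => lin_pair (@ungroup E i)
  end.

Lemma ungroupK E m : cancel (@ungroup E m) (@regroup E m).
Proof. by elim: m => //= m IH [u v]; rewrite /lin_pair /= !IH. Qed.

Lemma regroup_lin E m : lin (@regroup E m).
Proof. by elim: m => //= m; exact: lin_pair_lin. Qed.

Lemma ungroup_lin E m : lin (@ungroup E m).
Proof. by elim: m => //= m; exact: lin_pair_lin. Qed.

Lemma regroup_continuous E m : continuous (@regroup E m).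
Proof.
elim: m => [|m]; last exact: lin_pair_continuous.
by move=> x; exact: cvg_id.
Qed.

Lemma ungroup_continuous E m : continuous (@ungroup E m).
Proof.
elim: m => [|m]; last exact: lin_pair_continuous.
by move=> x; exact: cvg_id.
Qed.

Lemma dom2_regroup E m (D : set E) u :
  dom2 m (D `*` setT : set (E * E)%type) u = dom2 m.+1 D (regroup u).
Proof. by elim: m u => //= m IH u; rewrite /setX /= IH. Qed.

Lemma diffn_regroup E F m (f : E -> F) :
  diffn m (diff1 f) = diffn m.+1 f \o @regroup E m.
Proof.
elim: m => [//|m IH].
apply/funext => -[u h]; rewrite /= IH.
by rewrite diff1_precomp//; exact: regroup_lin.
Qed.

Lemma diffn_ungroup E F m (f : E -> F) :
  diffn m.+1 f = diffn m (diff1 f) \o @ungroup E m.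
Proof. by apply/funext => u; rewrite diffn_regroup [RHS]/= ungroupK. Qed.

(** The description of [PC] by the iterated differentials [diffn j], without recursion on
    [n]. *)
Definition PCflat P E F n (W : set (P * E)) (g : P -> E -> F) : Prop :=
  (forall j, (j <= n)%N ->
     {within [set z : P * pow2 E j | dom2 j [set u | W (z.1, u)] z.2],
        continuous (fun z : P * pow2 E j => diffn j (g z.1) z.2)}) /\
  (forall j, (j < n)%N -> forall p u h, dom2 j [set u | W (p, u)] u ->
     has_dir (diffn j (g p)) u h).

Lemma dom2_0 P E (W : set (P * E)) :
  [set z : P * pow2 E 0 | dom2 0 [set u | W (z.1, u)] z.2] = W.
Proof. by apply/seteqP; split=> -[]. Qed.

(** The two definitions of a family of class C^n agree: differentiating first or last
    amounts to the same up to the linear homeomorphism [regroup]. *)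
Lemma PC_flatP P E F n (W : set (P * E)) (g : P -> E -> F) :
  PC n W g <-> PCflat n W g.
Proof.
elim: n E W g => [|n IH] E W g.
  split=> [gc|[/(_ 0%N isT)]]; last by rewrite dom2_0.
  by split => // -[|//] _; rewrite dom2_0.
have domE (j : nat) p u :
    dom2 j [set u : E * E | W (p, u.1)] u = dom2 j.+1 [set u | W (p, u)] (regroup u).
  rewrite -dom2_regroup; congr (dom2 j _ u); apply/seteqP; split=> z //=.
  by case.
split.
- case=> gc gd /IH[gn gnd]; split=> -[|j] jn.
  + by rewrite dom2_0.
  + have := gn j jn.
    set W' := [set z : P * pow2 E j.+1 | _]; set W'' := [set z | _] => gj.
    apply: (@within_congr _ _ _ (fun z => diffn j (diff1 (g z.1)) (ungroup z.2))).
      by move=> [p u] _; rewrite [in RHS]diffn_ungroup.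
    apply: (within_comp (f := fun z : P * pow2 E j.+1 => (z.1, ungroup z.2)) _ _ gj).
      by move=> [p u]; rewrite /W'' /= domE ungroupK.
    apply: within_pair; first exact: within_fst.
    apply: within_continuous => z; apply: (@continuous_comp _ _ _ snd (@ungroup E j) z).
      exact: cvg_snd.
    exact: ungroup_continuous.
  + by move=> p u h /= Wpu; exact: gd.
  + move=> p u h Wpu; rewrite diffn_ungroup.
    apply/(has_dir_precomp _ _ _ (@ungroup_lin E j)); apply: gnd => //.
    by rewrite /= domE ungroupK.
- move=> [gn gnd]; split.
  + by have := gn 0%N isT; rewrite dom2_0.
  + by move=> p u h Wpu; apply: (gnd 0%N).
  + apply/IH; split=> j jn.
    * have := gn j.+1 jn.
      set W' := [set z : P * pow2 E j.+1 | _]; set W'' := [set z | _] => gj.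
      apply: (@within_congr _ _ _ (fun z => diffn j.+1 (g z.1) (regroup z.2))).
        by move=> [p u] _; rewrite [in RHS]diffn_regroup.
      apply: (within_comp (f := fun z => (z.1, regroup z.2)) _ _ gj).
        by move=> [p u]; rewrite /W' /W'' /= domE.
      apply: within_pair; first exact: within_fst.
      apply: within_continuous => z; apply: (@continuous_comp _ _ _ snd (@regroup E j) z).
        exact: cvg_snd.
      exact: regroup_continuous.
    * move=> p u h Wpu; rewrite diffn_regroup.
      apply/(has_dir_precomp _ _ _ (@regroup_lin E j)); apply: gnd => //.
      by move: Wpu; rewrite /= domE.
Qed.

End flat.

(** * Difference quotients with respect to a real parameter *)

Section parameter_derivative.
Context {R : realType} (e : R).
Implicit Types (E F : tvsType R).

Definition box E (D : set E) : set (R * E) := [set z | `|z.1| < e /\ D z.2].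

Lemma open_box E (D : set E) : open D -> open_slices (box D).
Proof.
move=> Do p; have [pe|pe] := ltP `|p| e.
  have -> : [set u | box D (p, u)] = D by apply/seteqP; split=> u; [case|split].
  exact: Do.
have -> : [set u | box D (p, u)] = set0; last exact: open0.
by apply/seteqP; split=> u //= [] /=; rewrite ltNge pe.
Qed.

Lemma near_norm_lt (a : R) : `|a| < e -> \forall b \near a, `|b| < e.
Proof.
move=> ae; exists (e - `|a|) => /=; first by rewrite subr_gt0.
move=> b /= ab; rewrite -(subrK a b) (le_lt_trans (ler_normD _ _))// distrC.
by rewrite -ltrBrDr.
Qed.

Definition time_derivative E F (D : set E) (G H : R -> E -> F) : Prop :=
  forall a u, `|a| < e -> D u -> t^-1 *: (G (a + t) u - G a u) @[t --> 0^'] --> H a u.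

Definition time_quotient E F (G H : R -> E -> F) (t : R) (u : E) : F :=
  if t == 0 then H 0 u else t^-1 *: (G t u - G 0 u).

(** The derivative in the real parameter commutes with the differential in [u]. The
    mixed second difference quotient [X r] of [G], with steps [s] in the parameter and
    [r] in direction [w], is in each convex open set [C] which contains the nearby
    values of [diff1 (H a)], by two applications of the mean value theorem; letting
    [r] tend to 0 gives the claim up to the closure of [C]. *)
Lemma time_derivative_diff1 E F (D : set E) (G H : R -> E -> F) :
  open D -> PC 1 (box D) G -> PC 1 (box D) H -> time_derivative D G H ->
  time_derivative (D `*` setT : set (E * E)%type) (fun a => diff1 (G a)) (fun a => diff1 (H a)).
Proof.
move=> Do [_ Gd _] [_ Hd Hc] GH a [u w] ae [/= Du _] A.
move=> /convex_open_closure[C [Co Cx Cc CA]].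
have /withinN/(_ (a, (u, w)) (conj ae Du) C) := Hc.
move=> /(_ (open_nbhs_nbhs (conj Co Cx)))[[N1 N2] /= [N1a [[N3 N4] /= [N3u N4w] N34]] NC].
have /convex_open_nbhs[N [No Nu Nc NN]] : nbhs u (N3 `&` D).
  by apply: filterI => //; exact: open_nbhs_nbhs.
have [d d0 dN] : exists2 d, 0 < d & forall b, `|b - a| < d -> N1 b /\ `|b| < e.
  have : nbhs a (N1 `&` [set b | `|b| < e]).
    by apply: filterI => //; exact: near_norm_lt.
  by move=> [d /= d0 dN]; exists d => // b bd; apply: dN => /=; rewrite distrC.
exists d => // s /=; rewrite sub0r normrN => sd s0; apply: CA.
have seg r : 0 <= r <= 1 -> N1 (a + r * s) /\ `|a + r * s| < e.
  move=> /andP[r0 r1]; apply: dN; rewrite addrAC subrr add0r normrM ger0_norm//.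
  by apply: le_lt_trans sd; rewrite ler_piMl.
have [_ ase] : N1 (a + s) /\ `|a + s| < e.
  by have := seg 1; rewrite mul1r ler01 lexx; exact.
pose X r := s^-1 *: (r^-1 *: (G (a + s) (u + r *: w) - G (a + s) u) -
                     r^-1 *: (G a (u + r *: w) - G a u)).
have Xcvg : X r @[r --> 0^'] -->
    s^-1 *: (diff1 (G (a + s)) (u, w) - diff1 (G a) (u, w)).
  apply: tvs_cvgZ; first exact: cvg_cst.
  by apply: tvs_cvgB; apply: diff1P; exact: Gd.
have XC : \forall r \near (0 : R)^', C (X r).
  have := @line_near R E N u w No Nu => Nr.
  have {Nr} Nr := @nbhs_dnbhs R 0 _ Nr.
  near=> r.
  have r0 : r != 0 by near: r; exact: nbhs_dnbhs_neq.
  have Nr1 : N (u + r *: w) by near: r; exact: Nr.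
  have Nseg b : 0 <= b <= 1 -> N (u + (b * r) *: w).
    move=> b01; have := Nc _ _ b b01 Nr1 Nu.
    rewrite scalerDr scalerA addrAC -scalerDl (_ : b + (1 - b) = 1) ?scale1r//.
    by rewrite addrC subrK.
  have Dr b : 0 <= b <= 1 -> D (u + (b * r) *: w) by move=> /Nseg/NN[].
  pose c b := r^-1 *: (G b (u + r *: w) - G b u).
  pose c' b := r^-1 *: (H b (u + r *: w) - H b u).
  have Du1 : D (u + r *: w) by have := Dr 1; rewrite mul1r ler01 lexx; exact.
  apply: (@mean_value_quotient R F c c' C a s s0 Cc) => b b01.
  - have [N1b be] := seg b b01.
    have := @mean_value_quotient R F (fun z => H (a + b * s) (u + z *: w))
      (fun z => diff1 (H (a + b * s)) (u + z *: w, w)) C 0 r r0 Cc.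
    rewrite add0r scale0r addr0 => H0; apply: open_nbhs_nbhs; split=> //; apply: H0 => z z01.
      have [N3z Dz] := NN _ (Nseg z z01).
      apply: open_nbhs_nbhs; split=> //; rewrite add0r.
      apply: (NC (_, (_, _))) => //; split => //=.
      by apply: N34; split => //=; exact: nbhs_singleton.
    have := diff1P (Hd (a + b * s) (u + (z * r) *: w) w (conj be (Dr z z01))).
    rewrite /= add0r; apply: cvg_trans; apply: near_eq_cvg; apply: nearW => k.
    by rewrite /diffquot scalerDl addrA.
  - have [_ be] := seg b b01.
    exact: cvg_quotientB (GH _ _ be Du1) (GH _ _ be Du).
move=> B nB.
have /filter_ex[r [Cr Br]] : \forall r \near (0 : R)^', C (X r) /\ B (X r).
  by apply: filterI => //; exact: Xcvg.
by exists (X r).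
Unshelve. all: by end_near. Qed.

(** The difference quotient in [t], extended by the derivative at [t = 0], is
    again a C^n family. Its differential is the difference quotient of the
    differentials, which is how the induction proceeds. *)
Lemma PC_time_quotient n E F (D : set E) (G H : R -> E -> F) :
  hausdorff_space F -> open D -> 0 < e ->
  PC n (box D) G -> PC n (box D) H -> time_derivative D G H ->
  PC n (box D) (time_quotient G H).
Proof.
move=> hF + e0; elim: n E D G H => [|n IH] E D G H Do.
  move=> Gc Hc GH; apply/withinN => -[t u] [/= te Du] A.
  have [->|t0] := eqVneq t 0.
    (* Near [t = 0], the quotient is in [C] by the mean value theorem. *)
    rewrite /time_quotient eqxx => /convex_open_nbhs[C [Co Cx Cc CA]].
    have z0 : box D (0, u) by split => //=; rewrite normr0.
    have /withinN/(_ (0, u) z0 C (open_nbhs_nbhs (conj Co Cx))) := Hc.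
    move=> [[N1 N2] /= [[d /= d0 dN1] N2u] NC].
    exists ([set b | `|b| < d], N2) => /=.
      split => //; exists d => // b /=; by rewrite sub0r normrN.
    move=> [b v] /= [bd N2v] [/= be Dv]; apply: CA; case: eqP => [_|/eqP b0].
      by apply: (NC (0, v)); split => //=; [apply: dN1; rewrite /= sub0r normrN normr0|rewrite normr0].
    have := @mean_value_quotient R F (G ^~ v) (H ^~ v) C 0 b b0 Cc.
    rewrite add0r; apply => r /andP[r0 r1].
      have rb : `|r * b| <= `|b| by rewrite normrM ger0_norm// ler_piMl.
      rewrite add0r; apply: open_nbhs_nbhs; split=> //; apply: (NC (r * b, v)); split => //=.
      - by apply: dN1; rewrite /= sub0r normrN (le_lt_trans rb).
      - by rewrite (le_lt_trans rb).
    have rb : `|r * b| <= `|b| by rewrite normrM ger0_norm// ler_piMl.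
    by rewrite /= add0r; apply: GH => //; rewrite (le_lt_trans rb).
  rewrite /time_quotient (negbTE t0) => tA.
  have Gtu : G z.1 z.2 @[z --> within (box D) (nbhs (t, u))] --> G t u.
    by have /withinP := Gc; apply; split.
  have G0u : G 0 z.2 @[z --> within (box D) (nbhs (t, u))] --> G 0 u.
    have /withinP/(_ (t, u)) : {within box D, continuous (fun z : R * E => G 0 z.2)}.
      apply: (within_comp (f := fun z => (0, z.2)) _ _ Gc).
        by move=> [b v] [/= _ Dv]; split => //=; rewrite normr0.
      by apply: within_pair; [apply: within_continuous => z; exact: cvg_cst|exact: within_snd].
    by apply; split.
  have : z.1^-1 *: (G z.1 z.2 - G 0 z.2) @[z --> within (box D) (nbhs (t, u))]
      --> t^-1 *: (G t u - G 0 u).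
    apply: tvs_cvgZ; last exact: tvs_cvgB.
    by apply: cvg_within_filter; apply: cvgV => //; exact: cvg_fst.
  move=> /(_ A tA) H'.
  have {}H' : nbhs (t, u) (fun z => box D z -> A (z.1^-1 *: (G z.1 z.2 - G 0 z.2))) := H'.
  have t0' : \forall z \near ((t, u) : R * E), z.1 != 0.
    exists ([set b | b != 0], setT) => /=; last by move=> [b v] [].
    split; last exact: filterT.
    by apply: open_nbhs_nbhs; split => //; exact: open_neq.
  apply: filterS2 H' t0' => -[b v] /= H' b0 Wb; rewrite (negbTE b0); exact: H'.
move=> Gn Hn GH.
have Gp := PC_pred Gn; have Hp := PC_pred Hn.
have G1 : PC 1 (box D) G by elim: (n) Gn => // m IHm /PC_pred.
have H1 : PC 1 (box D) H by elim: (n) Hn => // m IHm /PC_pred.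
have qd p u h : box D (p, u) -> diffquot (time_quotient G H p) u h t @[t --> 0^'] -->
    time_quotient (fun a => diff1 (G a)) (fun a => diff1 (H a)) p (u, h).
  move=> [/= pe Du]; rewrite /time_quotient; case: eqP => [p0|/eqP p0].
    by apply: diff1P; apply: (PC_has_dir h Hn); split=> //=; rewrite normr0.
  have dG a : `|a| < e -> diffquot (G a) u h t @[t --> 0^'] --> diff1 (G a) (u, h).
    by move=> ae; apply: diff1P; apply: (PC_has_dir h Gn).
  by apply: cvg_quotientB; apply: dG => //; rewrite normr0.
split.
- exact: PC_continuous (IH _ _ _ _ Do Gp Hp GH).
- by move=> p u h Wpu; eexists; exact: qd.
- have Dt : open (D `*` setT : set (E * E)%type) by apply: open_prod => //; exact: openT.
  case: Gn Hn => _ _ Gn [_ _ Hn].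
  have boxE : [set z : R * (E * E)%type | box D (z.1, z.2.1)] = box (D `*` setT).
    by apply/seteqP; split=> z; rewrite /box /=; [case=> ? ?|case=> ? []].
  rewrite !boxE in Gn Hn *.
  apply: PC_eq (IH _ _ _ _ Dt Gn Hn (time_derivative_diff1 Do G1 H1 GH)).
    exact: open_box.
  by move=> p [u h] [/= pe [Du _]]; apply/esym/diff1_eq => //; exact: qd.
Qed.

End parameter_derivative.

(** * Maps of class C^n *)

Section class_C.
Context {R : realType}.
Implicit Types (E F G : tvsType R).

(** A single map is a constant family; any inhabited parameter space would do. *)
Definition Cn E F n (D : set E) (f : E -> F) : Prop :=
  PC n ([set z | D z.2] : set (bool * E)) (fun=> f).

Lemma open_slices_snd (P : topologicalType) E (D : set E) :
  open D -> open_slices ([set z | D z.2] : set (P * E)).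
Proof. by move=> Do p. Qed.

Lemma PC_slice (P : topologicalType) E F n (W : set (P * E)) (g : P -> E -> F) p :
  PC n W g -> Cn n [set u | W (p, u)] (g p).
Proof.
move=> gn; apply: (@PC_reparam R P bool F n E setT (fun=> p) _ _ _ _ _ gn) => //.
by apply: within_continuous => x; exact: cvg_cst.
Qed.

Lemma PC_const (P : topologicalType) E F n (D : set E) (f : E -> F) :
  Cn n D f -> PC n ([set z | D z.2] : set (P * E)) (fun=> f).
Proof.
move=> fn; apply: (@PC_reparam R bool P F n E setT (fun=> true) _ _ _ _ _ fn) => //.
by apply: within_continuous => x; exact: cvg_cst.
Qed.

Lemma Cn_pred E F n (D : set E) (f : E -> F) : Cn n.+1 D f -> Cn n D f.
Proof. exact: PC_pred. Qed.

Lemma Cn_le E F n m (D : set E) (f : E -> F) : (m <= n)%N -> Cn n D f -> Cn m D f.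
Proof.
elim: n => [|n IH]; first by rewrite leqn0 => /eqP ->.
by rewrite leq_eqVlt => /orP[/eqP ->//|/IH mn /Cn_pred]; exact: mn.
Qed.

Lemma Cn_sub E F n (D D' : set E) (f : E -> F) : D' `<=` D -> Cn n D f -> Cn n D' f.
Proof. by move=> DD; apply: PC_sub => z; exact: DD. Qed.

Lemma Cn_eq E F n (D : set E) (f g : E -> F) : open D ->
  (forall u, D u -> f u = g u) -> Cn n D f -> Cn n D g.
Proof. by move=> Do fg; apply: PC_eq => // p u; exact: fg. Qed.

Lemma Cn_local E F n (D : set E) (f : E -> F) :
  (forall u, D u -> exists N, [/\ open N, N u & Cn n (D `&` N) f]) -> Cn n D f.
Proof. by move=> H; apply: PC_local => p u /H. Qed.

Lemma Cn_comp E F G n (D : set E) (D' : set F) (g : E -> F) (h : F -> G) :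
  hausdorff_space F -> hausdorff_space G -> open D -> open D' ->
  (forall u, D u -> D' (g u)) -> Cn n D g -> Cn n D' h -> Cn n D (h \o g).
Proof.
move=> hF hG Do Do' DD gn hn.
by apply: (@PC_comp R bool E F G n [set z | D z.2] [set z | D' z.2] (fun=> g) (fun=> h)).
Qed.

Lemma Cn_pair E F G n (D : set E) (f : E -> F) (g : E -> G) :
  hausdorff_space F -> hausdorff_space G -> open D ->
  Cn n D f -> Cn n D g -> Cn n D (fun u => (f u, g u) : (F * G)%type).
Proof. by move=> hF hG Do; exact: PC_pair. Qed.

Lemma Cn_lin E F n (D : set E) (l : E -> F) :
  hausdorff_space F -> lin l -> continuous l -> Cn n D l.
Proof.
move=> hF ll lc; apply: (@PC_lin R bool F n E setT _ (fun=> l)) => //.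
apply: within_continuous => z; apply: (@continuous_comp _ _ _ snd l z).
  exact: cvg_snd.
exact: lc.
Qed.

Lemma Cn_continuous E F n (D : set E) (f : E -> F) : Cn n D f -> {within D, continuous f}.
Proof.
move=> /PC_continuous fc.
apply: (within_comp (f := fun u => (true, u)) _ _ fc) => //.
by apply: within_pair; apply: within_continuous => z; [exact: cvg_cst|exact: cvg_id].
Qed.

Lemma Cn_has_dir E F n (D : set E) (f : E -> F) u h : Cn n.+1 D f -> D u -> has_dir f u h.
Proof. by move=> fn Du; apply: (PC_has_dir (p := true) h fn). Qed.

Lemma Cn_diff1 E F n (D : set E) (f : E -> F) :
  Cn n.+1 D f -> Cn n (D `*` setT : set (E * E)%type) (diff1 f).
Proof. by case=> _ _; apply: PC_sub => -[p [u h]] []. Qed.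

Lemma Cn_chain E F G (D : set F) (g : E -> F) (h : F -> G) x w : hausdorff_space G ->
  open D -> D (g x) -> Cn 1 D h -> has_dir g x w ->
  diff1 (h \o g) (x, w) = diff1 h (g x, diff1 g (x, w)).
Proof.
move=> hG Do Dgx h1 gd; apply: diff1_eq => //.
apply: (diffquot_comp Do Dgx _ _ gd); first by move=> y k; exact: Cn_has_dir h1.
have /Cn_continuous/withinP := Cn_diff1 h1; apply; split=> //.
Qed.

Lemma Cn_onP E F n (D : set E) (f : E -> F) : Cn_on n D f <-> Cn n D f.
Proof.
have flat : Cn_on n D f <->
    (forall j, (j <= n)%N -> {within dom2 j D, continuous (diffn j f)}) /\
    (forall j, (j < n)%N -> forall u h, dom2 j D u -> has_dir (diffn j f) u h).
  elim: n => [|n IH]; first by split=> [fc|[/(_ 0%N isT)]//]; split=> // -[].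
  split=> [[/IH[fc fd] [_ fd' fc']]|[fc fd]].
    split=> j.
      by rewrite leq_eqVlt => /orP[/eqP ->//|]; exact: fc.
    by rewrite ltnS leq_eqVlt => /orP[/eqP ->|]; [exact: fd'|exact: fd].
  split; first by apply/IH; split=> j jn; [apply: fc; exact: ltnW|apply: fd; exact: ltnW].
  by split; [exact: fc|exact: fd|exact: (fc n.+1)].
rewrite flat /Cn PC_flatP; split=> -[fc fd]; split.
- move=> j jn; have := fc j jn.
  by apply: (within_comp (f := snd)) => //; exact: within_snd.
- by move=> j jn p; exact: fd.
- move=> j jn; apply: (within_comp (f := fun u => (true, u)) _ _ (fc j jn)) => //.
  by apply: within_pair; apply: within_continuous => z; [exact: cvg_cst|exact: cvg_id].
- by move=> j jn; exact: fd jn true.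
Qed.

Lemma C_onP E F r (D : set E) (f : E -> F) :
  C_on r D f <-> forall n, le_order n r -> Cn n D f.
Proof. by split=> H n /H /Cn_onP. Qed.

End class_C.

(** * Topologies that are generated by an atlas *)

Section chart_space_topology.
Context (M : Type) (E : topologicalType) (A : set (chart M E)).
Local Notation X := (chart_space A).

Lemma chart_space_open c (W : set E) : A c -> open W ->
  open (cdom c `&` cmap c @^-1` W : set X).
Proof.
move=> Ac Wo; set B := _ `&` _.
exists [set B]; last by rewrite bigcup_set1.
by move=> _ ->; apply: (@finI_from1 _ _ _ id); exists c, W.
Qed.

Lemma chart_space_cvg (F : set_system X) (t : X) : Filter F ->
  (forall c (W : set E), A c -> open W -> cdom c t -> W (cmap c t) ->
     F (cdom c `&` cmap c @^-1` W)) -> F --> t.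
Proof.
move=> FF H B; rewrite nbhsE => -[_ [[C sC <-] [D CD Dt] sCB]].
apply: filterS sCB _; apply: (@filterS _ _ _ D); first by move=> ? ?; exists D.
have /sC [D' sD IDeD] := CD; rewrite -IDeD; apply: filter_bigI => Z DZ.
have /sD := DZ; rewrite inE => -[c [W [Ac Wo ZE]]].
by move: Dt; rewrite -IDeD => /(_ _ DZ); rewrite ZE => -[? ?]; exact: H.
Qed.

Hypothesis cK : forall c y, A c -> cdom c y -> cinv c (cmap c y) = y.
Hypothesis tr_open : forall c c', A c -> A c' -> open (cmap c @` (cdom c `&` cdom c')).
Hypothesis tr_cont : forall c c', A c -> A c' ->
  {within cmap c @` (cdom c `&` cdom c'), continuous (cmap c' \o cinv c)}.

(** Charts with open transition domains and continuous transitions are homeomorphisms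
    for the topology that their atlas generates. *)
Lemma chart_space_chart c : A c ->
  [/\ open (cdom c : set X), {within (cdom c : set X), continuous (cmap c)}
    & {within cimg c, continuous (cinv c : E -> X)}].
Proof.
move=> Ac; split.
- by have := chart_space_open Ac (@openT E); rewrite preimage_setT setIT.
- apply/withinN => y cy B; rewrite nbhsE => -[W [Wo Wy] WB].
  exists (cdom c `&` cmap c @^-1` W); split=> //; first exact: chart_space_open.
  by move=> z [_ Wz] _; exact: WB.
- apply/withinN => u cu B nB.
  suff : cinv c @ within (cimg c) (nbhs u) --> (cinv c u : X) by move=> /(_ B nB).
  apply: chart_space_cvg => c' W Ac' Wo c'u Wu.
  have /withinN := tr_cont Ac Ac'.
  case: cu => y cy yu; rewrite -yu (cK Ac cy) in c'u Wu *.
  have Dy : (cmap c @` (cdom c `&` cdom c')) (cmap c y) by exists y.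
  move=> /(_ _ Dy W) /=; rewrite (cK Ac cy) => /(_ (open_nbhs_nbhs (conj Wo Wu))).
  have := open_nbhs_nbhs (conj (tr_open Ac Ac') Dy); rewrite /= /within /=.
  by apply: filterS2 => _ [z [cz c'z] <-] H _; split=> /=; [rewrite (cK Ac cz)|apply: H; exists z].
Qed.

End chart_space_topology.

(** * Manifolds and their iterated tangent bundles *)

Section manifolds.
Context {R : realType}.
Implicit Types (M : charted R) (F : tvsType R).

Definition chart_ok M (c : chart M (cmodel M)) : Prop :=
  [/\ open (cdom c), open (cimg c),
      (forall y, cdom c y -> cinv c (cmap c y) = y),
      {within cdom c, continuous (cmap c)} &
      {within cimg c, continuous (cinv c)}].

(** The coordinate domain of [A] in the chart [c]. *)
Definition img M (c : chart M (cmodel M)) (A : set M) : set (cmodel M) :=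
  cmap c @` (cdom c `&` A).

(** The local part of the definition of a manifold, for a finite class [m]; it is this part
    that is handed on to tangent bundles and to sums of vector bundles. *)
Definition mfd m M : Prop :=
  [/\ hausdorff_space (cmodel M),
      (forall y : M, exists2 c, atlas c & cdom c y),
      (forall c : chart M (cmodel M), atlas c -> chart_ok c) &
      (forall c c' : chart M (cmodel M), atlas c -> atlas c' ->
         Cn m (img c (cdom c')) (cmap c' \o cinv c))].

Lemma mfd_le m n M : (m <= n)%N -> mfd n M -> mfd m M.
Proof. by move=> mn [? ? ? tr]; split => // c c' ac ac'; apply: Cn_le mn _; exact: tr. Qed.

Section one_chart.
Context M (c : chart M (cmodel M)) (cok : chart_ok c).

Lemma chart_cK y : cdom c y -> cinv c (cmap c y) = y.
Proof. by case: cok => _ _ + _ _; apply. Qed.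

Lemma chart_Kc u : cimg c u -> cmap c (cinv c u) = u.
Proof. by move=> [y cy <-]; rewrite chart_cK. Qed.

Lemma img_in A y : cdom c y -> A y -> img c A (cmap c y).
Proof. by move=> cy Ay; exists y. Qed.

Lemma img_cinv A u : img c A u -> [/\ cdom c (cinv c u), A (cinv c u), cimg c u & cmap c (cinv c u) = u].
Proof. by move=> [y [cy Ay] <-]; rewrite chart_cK//; split=> //; exists y. Qed.

Lemma imgE A : img c A = cimg c `&` cinv c @^-1` A.
Proof.
apply/seteqP; split=> u; first by move/img_cinv => [].
by move=> [[y cy <-]]; rewrite /= chart_cK// => Ay; exists y.
Qed.

Lemma img_sub A B : A `<=` B -> img c A `<=` img c B.
Proof. by move=> AB _ [y [cy Ay] <-]; exists y => //; split=> //; exact: AB. Qed.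

Lemma chart_cmap_near y W : cdom c y -> nbhs (cmap c y) W ->
  nbhs y [set z | cdom c z /\ W (cmap c z)].
Proof.
case: (cok) => co _ _ /withinN cc _ cy /(cc _ cy).
have : nbhs y (cdom c) by exact: open_nbhs_nbhs.
by apply: filterS2 => z cz; split=> //; auto.
Qed.

Lemma chart_cinv_near u W : cimg c u -> nbhs (cinv c u) W ->
  nbhs u [set v | cimg c v /\ W (cinv c v)].
Proof.
case: (cok) => _ co _ _ /withinN cc cu /(cc _ cu).
have : nbhs u (cimg c) by exact: open_nbhs_nbhs.
by apply: filterS2 => z cz; split=> //; auto.
Qed.

Lemma img_open A : open A -> open (img c A).
Proof.
move=> Ao; rewrite imgE openE => u [cu Au].
exact: chart_cinv_near cu (open_nbhs_nbhs (conj Ao Au)).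
Qed.

End one_chart.

Definition PCfun M F (P : topologicalType) n (Q : set P) (A : set M) (G : P -> M -> F) : Prop :=
  forall c : chart M (cmodel M), atlas c ->
    PC n ([set z | Q z.1 /\ img c A z.2] : set (P * cmodel M)) (fun p u => G p (cinv c u)).

Lemma open_slices_img M (P : topologicalType) (Q : set P) (c : chart M (cmodel M)) A :
  chart_ok c -> open A -> open_slices ([set z | Q z.1 /\ img c A z.2] : set (P * cmodel M)).
Proof.
move=> cok Ao p; have [Qp|Qp] := pselect (Q p).
  have -> : [set u | [set z : P * cmodel M | Q z.1 /\ img c A z.2] (p, u)] = img c A.
    by apply/seteqP; split=> u /=; [case|split].
  exact: img_open.
have -> : [set u | [set z : P * cmodel M | Q z.1 /\ img c A z.2] (p, u)] = set0.
  by apply/seteqP; split=> u //= [].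
exact: open0.
Qed.

Lemma PCfun_slice M F (P : topologicalType) n (Q : set P) (A : set M) (G : P -> M -> F) p
    (c : chart M (cmodel M)) :
  PCfun n Q A G -> Q p -> atlas c -> Cn n (img c A) (G p \o cinv c).
Proof.
move=> Gn Qp ac; have := PC_slice p (Gn c ac).
by apply: Cn_sub => u iu; split.
Qed.

Section tangent.
Context M (m : nat) (Mok : mfd m.+1 M).

Let haus : hausdorff_space (cmodel M). Proof. by case: Mok. Qed.
Let cok (c : chart M (cmodel M)) : atlas c -> chart_ok c. Proof. by case: Mok => _ _ + _; exact. Qed.
Let tr (c c' : chart M (cmodel M)) : atlas c -> atlas c' -> Cn m.+1 (img c (cdom c')) (cmap c' \o cinv c).
Proof. by case: Mok => _ _ _; exact. Qed.
Let tr1 (c c' : chart M (cmodel M)) : atlas c -> atlas c' -> Cn 1 (img c (cdom c')) (cmap c' \o cinv c).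
Proof. by move=> ac ac'; apply: Cn_le (tr ac ac'). Qed.
Let dom_open (c : chart M (cmodel M)) : atlas c -> open (cdom c). Proof. by move=> /cok[]. Qed.

Lemma chart_atP (y : M) : atlas (chart_at y) /\ cdom (chart_at y) y.
Proof.
have [c ac cy] : exists2 c : chart M (cmodel M), atlas c & cdom c y by case: Mok => _ + _ _; exact.
exact: (@xgetI _ _ [set c | atlas c /\ cdom c y] c (conj ac cy)).
Qed.

(** Tangent vectors are stored by their coordinates in one chart at each point. This
    lemma passes to the coordinates in any other chart. *)
Lemma transition_chain (c1 c2 : chart M (cmodel M)) F (g : M -> F) (A : set M) y w :
  hausdorff_space F -> atlas c1 -> atlas c2 -> cdom c1 y -> cdom c2 y ->
  open A -> A y -> Cn 1 (img c2 A) (g \o cinv c2) ->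
  diff1 (g \o cinv c2) (cmap c2 y, diff1 (cmap c2 \o cinv c1) (cmap c1 y, w)) =
  diff1 (g \o cinv c1) (cmap c1 y, w).
Proof.
move=> hF a1 a2 d1 d2 Ao Ay g1.
have := @Cn_chain R _ _ _ (img c2 A) (cmap c2 \o cinv c1) (g \o cinv c2) (cmap c1 y) w.
rewrite /= (chart_cK (cok a1) d1) => <- //.
- apply: (@diff1_congr_on R _ _ (img c1 (cdom c2))).
  + exact (img_open (cok a1) (dom_open a2)).
  + exact: img_in.
  + by move=> u /(img_cinv (cok a1))[? c2u ? ?] /=; rewrite (chart_cK (cok a2)).
- exact (img_open (cok a2) Ao).
- exact: img_in.
- by apply: Cn_has_dir (tr1 a1 a2) _; exact: img_in.
Qed.

Lemma transition_tangent (c1 c2 c3 : chart M (cmodel M)) y w :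
  atlas c1 -> atlas c2 -> atlas c3 -> cdom c1 y -> cdom c2 y -> cdom c3 y ->
  diff1 (cmap c3 \o cinv c2) (cmap c2 y, diff1 (cmap c2 \o cinv c1) (cmap c1 y, w)) =
  diff1 (cmap c3 \o cinv c1) (cmap c1 y, w).
Proof.
move=> a1 a2 a3 d1 d2 d3.
by apply: (transition_chain (A := cdom c3)) => //; [exact: dom_open|exact: tr1].
Qed.

Lemma transition_id (c : chart M (cmodel M)) y w : atlas c -> cdom c y ->
  diff1 (cmap c \o cinv c) (cmap c y, w) = w.
Proof.
move=> ac cy; have [_ co _ _ _] := cok ac.
rewrite (@diff1_congr_on R _ _ (cimg c) _ id) //; last 2 first.
- by exists y.
- by move=> u cu /=; rewrite (chart_Kc (cok ac)).
by apply: diff1_eq => //; apply: diffquot_lin.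
Qed.

Lemma tangent_chart_cK (c : chart M (cmodel M)) (p : M * cmodel M) : atlas c ->
  cdom (tangent_chart c) p -> cinv (tangent_chart c) (cmap (tangent_chart c) p) = p.
Proof.
case: p => y w ac [/= cy _]; have [aa da] := chart_atP y.
rewrite (chart_cK (cok ac) cy); congr pair.
by rewrite transition_tangent// transition_id.
Qed.

Lemma tangent_chart_cinv (c : chart M (cmodel M)) y w : cdom c y -> atlas c ->
  cinv (tangent_chart c) (cmap c y, w) =
  (y, diff1 (cmap (chart_at y) \o cinv c) (cmap c y, w)).
Proof. by move=> cy ac; rewrite /= (chart_cK (cok ac) cy). Qed.

Lemma tangent_chart_Kc (c c' : chart M (cmodel M)) y w : atlas c -> atlas c' ->
  cdom c y -> cdom c' y ->
  cmap (tangent_chart c') (cinv (tangent_chart c) (cmap c y, w)) =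
  (cmap c' y, diff1 (cmap c' \o cinv c) (cmap c y, w)).
Proof.
move=> ac ac' cy c'y; rewrite tangent_chart_cinv//=; have [aa da] := chart_atP y.
by congr pair; exact: transition_tangent.
Qed.

Lemma tangent_img (c : chart M (cmodel M)) (A : set M) : atlas c ->
  cmap (tangent_chart c) @` (cdom (tangent_chart c) `&` [set p | A p.1]) = img c A `*` setT.
Proof.
move=> ac; apply/seteqP; split=> -[u w].
  by move=> [[y v] [[/= cy _] Ay] [<- _]]; split=> //; exact: img_in.
move=> [[y [cy Ay] /= <-] _]; exists (cinv (tangent_chart c) (cmap c y, w)).
  by rewrite tangent_chart_cinv//; split=> //; split.
by have := tangent_chart_Kc w ac ac cy cy; rewrite transition_id.
Qed.

Lemma mfd_tangent : mfd m (tangent M).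
Proof.
have trT (c c' : chart M (cmodel M)) : atlas c -> atlas c' ->
    Cn m (cmap (tangent_chart c) @` (cdom (tangent_chart c) `&` cdom (tangent_chart c')))
      (cmap (tangent_chart c') \o cinv (tangent_chart c)).
  move=> ac ac'.
  have -> : cdom (tangent_chart c') = [set p | cdom c' p.1].
    by apply/seteqP; split=> p //= [].
  rewrite tangent_img//.
  have io : open (img c (cdom c')) by exact (img_open (cok ac) (dom_open ac')).
  have ioT : open (img c (cdom c') `*` setT : set (cmodel M * cmodel M)%type).
    by apply: open_prod => //; exact: openT.
  apply: (@Cn_eq R _ _ m _ (fun z => (cmap c' (cinv c z.1), diff1 (cmap c' \o cinv c) z))) => //.
    move=> [u w] [/= [y [cy c'y] <-] _].
    rewrite -[RHS]/(cmap (tangent_chart c') (cinv (tangent_chart c) (cmap c y, w))).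
    by rewrite tangent_chart_Kc//= chart_cK//; exact: cok.
  apply: Cn_pair => //; last by apply: Cn_diff1; exact: tr.
  apply: (@Cn_comp R _ _ _ m _ (img c (cdom c')) fst (cmap c' \o cinv c)) => //.
  - by move=> z [].
  - by apply: Cn_lin => // z; exact: cvg_fst.
  - by apply: Cn_pred; exact: tr.
have imgT (c c' : chart M (cmodel M)) : atlas c -> atlas c' ->
    open (cmap (tangent_chart c) @` (cdom (tangent_chart c) `&` cdom (tangent_chart c'))).
  move=> ac ac'; have -> : cdom (tangent_chart c') = [set p | cdom c' p.1].
    by apply/seteqP; split=> p //= [].
  rewrite tangent_img//; apply: open_prod; last exact: openT.
  exact (img_open (cok ac) (dom_open ac')).
split.
- exact: hausdorff_pair.
- move=> p; have [aa da] := chart_atP p.1.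
  by exists (tangent_chart (chart_at p.1)); [exists (chart_at p.1)|split].
- move=> _ [c ac <-].
  set A := [set tangent_chart c | c in @atlas R M].
  have [||| opn mc ic] := @chart_space_chart _ _ A _ _ _ (tangent_chart c) (ex_intro2 _ _ c ac erefl).
  + by move=> _ y [c0 a0 <-]; exact: tangent_chart_cK.
  + by move=> _ _ [c0 a0 <-] [c1 a1 <-]; exact: imgT.
  + by move=> _ _ [c0 a0 <-] [c1 a1 <-]; apply: Cn_continuous; exact: trT.
  split=> //.
    have := imgT c c ac ac; rewrite setIid; exact.
  by move=> y; exact: tangent_chart_cK.
- by move=> _ _ [c ac <-] [c' ac' <-]; exact: trT.
Qed.

(** In a chart, [mdiff1] is [diff1]. *)
Lemma mdiff1_chart F (A : set M) (g : M -> F) (c : chart M (cmodel M)) y w :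
  hausdorff_space F -> open A -> A y -> atlas c -> cdom c y ->
  Cn 1 (img (chart_at y) A) (g \o cinv (chart_at y)) ->
  mdiff1 g (cinv (tangent_chart c) (cmap c y, w)) = diff1 (g \o cinv c) (cmap c y, w).
Proof.
move=> hF Ao Ay ac cy g1; rewrite tangent_chart_cinv// /mdiff1 /=.
have [aa da] := chart_atP y.
exact: (transition_chain (A := A)).
Qed.

Lemma PCfun_mdiff1 F (P : topologicalType) n (Q : set P) (A : set M) (G : P -> M -> F) :
  hausdorff_space F -> open A ->
  PCfun n.+1 Q A G -> PCfun n Q (tangent_dom 1 A) (fun p => mdiff1 (G p) : tangent M -> F).
Proof.
move=> hF Ao Gn _ [c ac <-]; rewrite /img tangent_img//.
have [_ _ gn] := Gn c ac.
apply: PC_eq (PC_sub _ gn).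
- have Wo := open_slices_tangent (open_slices_img Q (cok ac) Ao).
  move=> p; have := Wo p; rewrite (_ : [set _ | _] = [set u |
    [set z : P * (cmodel M * cmodel M)%type | Q z.1 /\ (img c A `*` setT) z.2] (p, u)])//.
  by apply/seteqP; split=> z /= [] // ? [].
- move=> p [u w] [/= Qp [[y [cy Ay] /= <-] _]].
  rewrite (mdiff1_chart (A := A))//.
  have [aa da] := chart_atP y.
  by apply: Cn_le (PCfun_slice Gn Qp aa).
- by move=> [p z] [/= Qp []].
Qed.

End tangent.

Lemma mfd_iter_tangent M n m : mfd (n + m) M -> mfd m (iter n tangent M).
Proof.
elim: n m => [//|n IH] m; rewrite addSnnS => /IH; exact: mfd_tangent.
Qed.

Lemma tangent_dom_open M n (A : set M) : mfd n M -> open A -> open (tangent_dom n A).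
Proof.
elim: n => [//|n IH] Mok Ao /=.
have Mn : mfd 1 (iter n tangent M) by apply: mfd_iter_tangent; rewrite addn1.
have An := IH (mfd_le (leqnSn n) Mok) Ao.
rewrite openE => p Ap.
have [aa da] := chart_atP Mn p.1.
have [_ _ + _] := mfd_tangent Mn.
move=> /(_ (tangent_chart (chart_at p.1)) (ex_intro2 _ _ _ aa erefl)) tok.
have pd : cdom (tangent_chart (chart_at p.1)) p by split.
have := chart_cmap_near tok pd; set c := chart_at p.1 in aa da tok pd *.
have [_ _ + _] := Mn => /(_ c aa) cok.
move=> /(_ (img c (tangent_dom n A) `*` setT)) H.
have : nbhs p [set z | cdom (tangent_chart c) z /\
    (img c (tangent_dom n A) `*` setT) (cmap (tangent_chart c) z)].
  apply: H; apply: open_nbhs_nbhs; split.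
    by apply: open_prod; [exact: img_open|exact: openT].
  by split=> //; exact: img_in.
apply: filterS => -[y w] [[/= cy _] [/(img_cinv cok)[_ + _ _] _]].
by rewrite /= (chart_cK cok).
Qed.

(** Each differential costs one order of differentiability and doubles the manifold. *)
Lemma PCfun_mdiff F M (P : topologicalType) n m (Q : set P) (A : set M) (G : P -> M -> F) :
  hausdorff_space F -> open A -> mfd (n + m) M ->
  PCfun (n + m) Q A G -> PCfun m Q (tangent_dom n A) (fun p => mdiff n (G p)).
Proof.
move=> hF Ao; elim: n m => [//|n IH] m; rewrite addSnnS => Mok Gn.
have Mn := mfd_iter_tangent Mok.
apply: (PCfun_mdiff1 Mn hF _ (IH _ Mok Gn)).
apply: tangent_dom_open Ao; apply: mfd_le Mok; exact: leq_addr.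
Qed.

Lemma PCfun_continuous F M (P : topologicalType) n (Q : set P) (A : set M) (G : P -> M -> F) :
  mfd n M -> open A -> PCfun 0 Q A G ->
  {within Q `*` A, continuous (fun z : P * M => G z.1 z.2)}.
Proof.
move=> [_ cov cok _] Ao G0; apply/withinN => -[p y] [/= Qp Ay] B nB.
have [c ac cy] := cov y; have cy' := chart_cK (cok c ac) cy.
have /withinN/(_ (p, cmap c y)) := G0 c ac.
move=> /(_ (conj Qp (img_in cy Ay)) B); rewrite /= cy' => /(_ nB).
move=> [[N1 N2] /= [N1p N2y] NB].
exists (N1, [set z | cdom c z /\ N2 (cmap c z)]) => /=.
  by split=> //; apply: chart_cmap_near => //; exact: cok.
move=> [q z] [/= N1q [cz N2z]] [/= Qq Az].
have := NB (q, cmap c z) (conj N1q N2z); rewrite /= (chart_cK (cok c ac) cz); apply.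
by split=> //; exact: img_in.
Qed.

End manifolds.

(** * The topology of the space of sections *)

Section initial.

Lemma initial_cvgP (S : choiceType) (T : topologicalType) (f : S -> T)
    (G : set_system S) (s : S) : Filter G ->
  G --> (s : initial_topology f) <-> f x @[x --> G] --> f s.
Proof.
move=> FG; split=> H.
  exact: cvg_trans (cvg_app f H) (@initial_continuous S T f s).
move=> U [_ /= [[W Wo <-]] /= Ws WU]; apply: (filterS WU).
by apply: H; exact: open_nbhs_nbhs.
Qed.

End initial.

Section CK_topology.
Context {R : realType} {X : charted R} {cplx : bool}.
Context {F : tvsType (scalars R cplx)} (r : option nat) (K : set X).
Context (E : bundle X F).

(** The local representative of a section. *)
Definition loc (psi : trivialization E) (s : section E) : X -> real_lcs F :=
  fun x => tmap psi (s x).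

(** Unfolds the three nested initial topologies on the space of sections. *)
Lemma CK_cvgP (G : set_system (CK_space r K E)) (s : CK_space r K E) : Filter G ->
  G --> s <->
  forall psi : trivialization E, is_trivialization r psi ->
  forall n, le_order n r ->
  forall (L : set (tangent_dom n (tdom psi))) (O : set (real_lcs F)),
    compact L -> open O ->
    (forall p, L p -> O (mdiff n (loc psi s) (set_val p))) ->
    G [set t | forall p, L p -> O (mdiff n (loc psi (CK_val t)) (set_val p))].
Proof.
move=> FG.
have E1 : G --> s <-> (CK_val t : section_top r E) @[t --> G] --> (CK_val s : section_top r E).
  exact: (@initial_cvgP (CK_space r K E) (section_top r E) (@CK_val _ _ _ _ _ _ _)).
rewrite E1.
rewrite (@cvg_sup (section E) _ (fun psi : {psi : trivialization E | is_trivialization r psi} =>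
     Topological.class (initial_topology
       (fun s : section E => (fun x => tmap (projT1 psi) (s x))
          : C_fun (real_lcs F) r (tdom (projT1 psi)))))).
have E2 (psi : {psi : trivialization E | is_trivialization r psi}) :
    ((CK_val t @[t --> G] : set_system (section E)) --> (CK_val s : initial_topology
       (fun s : section E => (fun x => tmap (projT1 psi) (s x))
          : C_fun (real_lcs F) r (tdom (projT1 psi))))) <->
   forall n, le_order n r -> forall (L : set (tangent_dom n (tdom (projT1 psi)))) (O : set (real_lcs F)),
    compact L -> open O ->
    (forall p, L p -> O (mdiff n (loc (projT1 psi) s) (set_val p))) ->
    G [set t | forall p, L p -> O (mdiff n (loc (projT1 psi) (CK_val t)) (set_val p))].
  rewrite initial_cvgP.
  rewrite (@cvg_sup _ _ (fun n : {n | le_order n r} =>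
       Topological.class (initial_topology
         (fun g : X -> real_lcs F => (mdiff (projT1 n) g \o set_val
            : {compact-open, tangent_dom (projT1 n) (tdom (projT1 psi)) -> real_lcs F}))))).
  split=> H.
    move=> n nr L O Lc Oo LO.
    have := H (exist _ n nr); rewrite initial_cvgP => /compact_open_cvgP/(_ L O Lc Oo).
    have LO' : [set (mdiff n (loc (projT1 psi) s) \o set_val) p | p in L] `<=` O.
      by move=> _ [p Lp <-]; exact: LO.
    move=> /(_ LO') H'.
    by apply: (@filterS _ G _ _ _ _ H') => t H0 p Lp; apply: H0; exists p.
  move=> [n nr]; rewrite initial_cvgP; apply/compact_open_cvgP => L O Lc Oo LO.
  have LO' p : L p -> O (mdiff n (loc (projT1 psi) s) (set_val p)).
    by move=> Lp; apply: LO; exists p.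
  have H' := H n nr L O Lc Oo LO'.
  by apply: (@filterS _ G _ _ _ _ H') => t H0 _ [p Lp <-]; exact: H0.
split=> [H psi psir|H psi]; first exact: (E2 (exist _ psi psir)).1 (H (exist _ psi psir)).
by apply/E2; exact: H (projT2 psi).
Qed.

Hypothesis hF : hausdorff_space (real_lcs F).
Hypothesis Xok : forall n, le_order n r -> mfd n X.

(** The half of the exponential law which holds for all manifolds: on a compact set [L],
    joint continuity makes the differentials converge uniformly. *)
Lemma CK_lift (P : topologicalType) (A : set P) (Phi : P -> CK_space r K E) :
  (forall psi : trivialization E, is_trivialization r psi ->
   forall n, le_order n r ->
     PCfun n A (tdom psi) (fun p => loc psi (CK_val (Phi p)))) ->
  {within A, continuous Phi}.
Proof.
move=> H; apply/withinP => p0 Ap0; apply/CK_cvgP => psi psir n nr L O Lc Oo LO.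
have psio : open (tdom psi) by case: psir.
have Xn : mfd (n + 0) X by rewrite addn0; exact: Xok.
have Hn : PCfun (n + 0) A (tdom psi) (fun p => loc psi (CK_val (Phi p))).
  by rewrite addn0; exact: H.
have /withinN G := PCfun_continuous (mfd_iter_tangent Xn) (tangent_dom_open (Xok nr) psio)
  (PCfun_mdiff hF psio Xn Hn).
have /compact_near_coveringP/(_ P (nbhs p0)
  (fun q p => A q -> O (mdiff n (loc psi (CK_val (Phi q))) (set_val p))) _) := Lc.
rewrite near_simpl => LA; suff : \forall q \near p0, forall p, L p -> A q ->
    O (mdiff n (loc psi (CK_val (Phi q))) (set_val p)).
  by apply: filterS => q Hq Aq p Lp; exact: Hq.
apply: LA => p Lp; have Ap : tangent_dom n (tdom psi) (set_val p) by exact: set_valP.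
have := G (p0, set_val p) (conj Ap0 Ap) O.
move=> /(_ (open_nbhs_nbhs (conj Oo (LO p Lp))))[[N1 N2] /= [N1p N2p] NO].
exists (set_val @^-1` N2, N1) => /=.
  by split=> //; exact: initial_continuous.
move=> [q p1] [/= N2q N1p1] Ap1; apply: (NO (p1, set_val q)) => //.
by split=> //; exact: set_valP.
Qed.

End CK_topology.

(** * Evaluation of sections *)

Section local_compactness.
Context {R : realType}.

Definition locally_cpt (T : topologicalType) : Prop :=
  forall (u : T) (O : set T), nbhs u O -> exists N, [/\ compact N, nbhs u N & N `<=` O].

Lemma locally_cpt_prod (S T : topologicalType) :
  locally_cpt S -> locally_cpt T -> locally_cpt (S * T)%type.
Proof.
move=> lS lT [u v] O [[A B] /= [Au Bv] ABO].
have [M [Mc Mu MA]] := lS u A Au; have [N [Nc Nv NB]] := lT v B Bv.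
exists (M `*` N); split; first exact: compact_setX.
- by exists (M, N).
- by move=> z [Mz Nz]; apply: ABO; split; [exact: MA|exact: NB].
Qed.

Lemma locally_cpt_pow2 (E : tvsType R) n : locally_cpt E -> locally_cpt (pow2 E n).
Proof. by move=> lE; elim: n => //= n IH; exact: locally_cpt_prod. Qed.

(** The image of the unit sphere is compact and misses 0, so a convex neighbourhood
    of 0 that misses this image lies in the image of the unit ball. *)
Lemma findim_compact_nbhs0 (V : tvsType R) d (e : {linear 'rV[R]_d -> V}) :
  hausdorff_space V -> bijective e -> exists2 C : set V, compact C & nbhs 0 C.
Proof.
move=> hV [g eK gK].
have ec : continuous e.
  have -> : (e : _ -> V) = fun v => \sum_(j < d) v 0 j *: e (delta_mx 0 j).
    apply/funext => v; rewrite {1}(row_sum_delta v) linear_sum.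
    by apply: eq_bigr => j _; rewrite linearZ.
  pose su (s : seq 'I_d) (w : 'rV[R]_d) : V := \sum_(j <- s) w 0 j *: e (delta_mx 0 j).
  suff suc s : continuous (su s) by exact: (suc (index_enum 'I_d)).
  elim: s => [|j s IH] v; have vF : Filter (nbhs v) by exact: (@nbhs_filter 'rV[R]_d v).
    have -> : su [::] = fun=> 0 by apply/funext => w; rewrite /su big_nil.
    by apply: cvg_cst; exact: vF.
  have -> : su (j :: s) = fun w => w 0 j *: e (delta_mx 0 j) + su s w.
    by apply/funext => w; rewrite /su big_cons.
  apply: (@tvs_cvgD _ _ _ _ vF); last exact: IH.
  by apply: (@tvs_cvgZ _ _ _ _ vF); [exact: coord_continuous|apply: cvg_cst; exact: vF].
pose S := [set v : 'rV[R]_d | `|v| = 1].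
pose B := [set v : 'rV[R]_d | `|v| <= 1].
have nc : continuous (fun v : 'rV[R]_d => `|v|) by exact: norm_continuous.
have Bb : bounded_set B.
  by exists 1; split; [exact: num_real|move=> x x1 v /= v1; rewrite (le_trans v1)// ltW].
have Sb : bounded_set S.
  by exists 1; split; [exact: num_real|move=> x x1 v /= ->; rewrite ltW].
have Sc : compact S.
  apply: bounded_closed_compact => //.
  exact: ((continuous_closedP (fun v : 'rV[R]_d => `|v|)).1 nc _ (@closed_eq R 1)).
have Bc : compact B.
  apply: bounded_closed_compact => //.
  exact: ((continuous_closedP (fun v : 'rV[R]_d => `|v|)).1 nc _ (@closed_le R 1)).
have eSc : closed (e @` S).
  apply: compact_closed => //; apply: continuous_compact => //.
  exact: continuous_subspaceT.
have nS : nbhs (0 : V) (~` (e @` S)).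
  apply: open_nbhs_nbhs; split; first exact: closed_openC.
  move=> [v vS] v0; move: vS; rewrite /S /=.
  have -> : v = 0 by rewrite -[v]eK v0 -(linear0 e) eK.
  by rewrite normr0 => /esym/eqP; rewrite oner_eq0.
have [W [Wo W0 Wc WS]] := convex_open_nbhs nS.
exists (e @` B).
  by apply: continuous_compact => //; exact: continuous_subspaceT.
apply: (@filterS _ _ _ W); last exact: open_nbhs_nbhs.
move=> w Ww; exists (g w); last exact: gK.
rewrite /B /= leNgt; apply/negP => gw1.
have gw0 : 0 < `|g w| by rewrite (lt_trans _ gw1).
have := Wc w 0 `|g w|^-1; rewrite scaler0 addr0 => /(_ _ Ww W0).
have -> : 0 <= `|g w|^-1 <= 1 by rewrite invr_ge0 (ltW gw0)/= invf_le1// ltW.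
move=> /(_ isT)/WS; apply; exists (`|g w|^-1 *: g w).
  by rewrite /S /= normrZ ger0_norm ?invr_ge0// mulVf// gt_eqF.
by rewrite linearZ gK.
Qed.

Lemma findim_locally_cpt (V : tvsType R) d (e : {linear 'rV[R]_d -> V}) :
  hausdorff_space V -> bijective e -> locally_cpt V.
Proof.
move=> hV be u O nO; have [C Cc C0] := findim_compact_nbhs0 hV be.
have [B uB BO] := uniform_regular nO.
have addc : continuous (fun v : V => u + v).
  by move=> v; apply: (@tvs_cvgD _ _ _ _ (nbhs_filter v)); [exact: cvg_cst|exact: cvg_id].
have subc : continuous (fun v : V => v - u).
  by move=> v; apply: (@tvs_cvgB _ _ _ _ (nbhs_filter v)); [exact: cvg_id|exact: cvg_cst].
exists ((fun v => u + v) @` C `&` closure B); split.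
- apply: compact_closedI; last exact: closed_closure.
  by apply: continuous_compact => //; exact: continuous_subspaceT.
- apply: filterI; last by apply: filterS uB; exact: subset_closure.
  have Cu : nbhs u (fun v => C (v - u)) by have := subc u C; rewrite /= subrr => /(_ C0).
  by apply: filterS Cu => v Cv; exists (v - u) => //; rewrite subrKC.
- by move=> v [_ /BO].
Qed.

Lemma dom2_open (E : tvsType R) n (D : set E) : open D -> open (dom2 n D).
Proof. by move=> Do; elim: n => //= n IH; apply: open_prod => //; exact: openT. Qed.

End local_compactness.

Section iterated_charts.
Context {R : realType}.
Implicit Types (M : charted R) (F : tvsType R).

(** The model space of the [n]-th tangent bundle is the [2^n]-th power of the model
    space only up to the linear map [l]. In the iterated tangent chart of [c], the iterated differential [mdiff n g] is
    the iterated differential [diffn n] of the coordinate expression of [g]. *)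
Lemma mdiff_chart M n (c : chart M (cmodel M)) : mfd n M -> atlas c ->
  exists (c' : chart (iter n tangent M) (cmodel (iter n tangent M)))
         (l : pow2 (cmodel M) n -> cmodel (iter n tangent M)),
  [/\ atlas c', lin l, continuous l &
    forall (A : set M), open A ->
    (forall u, dom2 n (img c A) u -> img c' (tangent_dom n A) (l u)) /\
    forall F (g : M -> F), hausdorff_space F ->
      PCfun n ([set: bool]) A (fun=> g) ->
      forall u, dom2 n (img c A) u ->
      mdiff n g (cinv c' (l u)) = diffn n (g \o cinv c) u].
Proof.
elim: n => [|n IH] Mok ac.
  exists c, id; split; [exact: ac|by []|by move=> x; exact: cvg_id|by split].
have [c' [l [ac' ll lc H]]] := IH (mfd_le (leqnSn n) Mok) ac.
have Mn : mfd 1 (iter n tangent M) by apply: mfd_iter_tangent; rewrite addn1.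
have [_ _ cok _] := Mok; have [_ _ cok' _] := Mn.
exists (tangent_chart c'), (lin_pair l); split.
- by exists c'.
- exact: lin_pair_lin.
- exact: lin_pair_continuous.
move=> A Ao; have [H1 H2] := H A Ao; split.
  move=> [u w] [/= /H1 u1 _]; rewrite /img (tangent_img Mn)//.
move=> F g hF gn [u w] [/= Du _].
have gn' : PCfun n [set: bool] A (fun=> g) by move=> c0 a0; exact: PC_pred (gn c0 a0).
have [y [cy Ay] yu] := H1 u Du.
have Tn : open (tangent_dom n A) by apply: tangent_dom_open => //; exact: mfd_le Mok.
have gn1 : PCfun 1 [set: bool] (tangent_dom n A) (fun=> mdiff n g).
  by apply: (@PCfun_mdiff R F M bool n 1); rewrite ?addn1.
rewrite /lin_pair /= -[X in mdiff1 _ X]/(cinv (tangent_chart c') (l u, l w)) -yu.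
rewrite (mdiff1_chart Mn (A := tangent_dom n A))//.
  rewrite yu -(diff1_precomp (mdiff n g \o cinv c') u w ll).
  apply: (@diff1_congr _ _ _ _ (diffn n (g \o cinv c))).
  have Dlin : \forall t \near (0 : R), dom2 n (img c A) (u + t *: w).
    have := img_open (cok c ac) Ao.
    clear -Du; elim: n u w Du => [|n IH] u w Du Do; first exact: line_near.
    have := IH u.1 w.1 Du.1 Do; apply: filterS => t H; split=> //.
  by apply: filterS Dlin => t /H2; exact.
have [aa da] := chart_atP Mn y.
exact: (PCfun_slice (p := true) gn1).
Qed.

End iterated_charts.

Section CK_evaluation.
Context {R : realType} {X : charted R} {cplx : bool}.
Context {F : tvsType (scalars R cplx)} (r : option nat) (K : set X).
Context (E : bundle X F).
Hypothesis hF : hausdorff_space (real_lcs F).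
Hypothesis Xok : forall n, le_order n r -> mfd n X.
Hypothesis Xlc : locally_cpt (cmodel X).
Hypothesis Esm : forall (s : CK_space r K E) (psi : trivialization E),
  is_trivialization r psi -> forall n, le_order n r ->
  PCfun n [set: bool] (tdom psi) (fun=> loc psi (CK_val s)).

(** The half of the exponential law which needs local compactness: a point [u] has a
    compact neighbourhood [N] which the differential of [s] maps into a given open set,
    and the sections near [s] do the same on [N]. *)
Lemma CK_evaluation (psi : trivialization E) n : is_trivialization r psi -> le_order n r ->
  PCfun n [set: CK_space r K E] (tdom psi) (fun s => loc psi (CK_val s)).
Proof.
move=> psir nr c ac; apply/PC_flatP.
have psio : open (tdom psi) by case: psir.
have slice (s : CK_space r K E) : PCflat n ([set z | [set: bool] z.1 /\ img c (tdom psi) z.2])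
    (fun=> loc psi (CK_val s) \o cinv c).
  by apply/PC_flatP; exact (Esm s psir nr ac).
have sliceE : [set u | True /\ img c (tdom psi) u] = img c (tdom psi).
  by apply/seteqP; split=> u //= [].
split; last first.
  by move=> j jn s u h; rewrite /= sliceE => ju; apply: ((slice s).2 j jn true); rewrite /= sliceE.
move=> j jn.
have jr : le_order j r by case: (r) nr => //= k; exact: leq_trans.
have [_ _ cok _] := Xok jr; have io := img_open (cok c ac) psio.
have [c' [l [ac' ll lc H]]] := mdiff_chart (Xok jr) ac; have [H1 H2] := H _ psio.
have Tmf : mfd 0 (iter j tangent X) by apply: mfd_iter_tangent; rewrite addn0; exact: Xok.
have cok' : chart_ok c' by case: Tmf => _ _ + _; apply.
apply/withinN => -[s u]; rewrite /= sliceE => Du V' nV'.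
have [V [Oo Ou VV']] : exists V, [/\ open V, V (diffn j (loc psi (CK_val s) \o cinv c) u) & V `<=` V'].
  by move: nV'; rewrite nbhsE => -[V [Oo Ou] VV']; exists V.
have [N [Nc Nu NO]] : exists N, [/\ compact N, nbhs u N &
    N `<=` [set v | dom2 j (img c (tdom psi)) v /\ V (diffn j (loc psi (CK_val s) \o cinv c) v)]].
  apply (@locally_cpt_pow2 R (cmodel X) j Xlc u).
  have /withinN/(_ (true, u)) := (slice s).1 j jn; rewrite /= sliceE => /(_ Du V).
  move=> /(_ (open_nbhs_nbhs (conj Oo Ou)))[[N1 N2] /= [/nbhs_singleton N1t N2u] NO].
  have : nbhs u (dom2 j (img c (tdom psi))).
    by apply: open_nbhs_nbhs; split=> //; exact: dom2_open.
  apply: filterS2 N2u => v N2v Dv; split=> //.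
  by apply: (NO (true, v)) => //=; rewrite sliceE.
have thA v : N v -> tangent_dom j (tdom psi) (cinv c' (l v)).
  by move=> /NO[/H1/(img_cinv cok')[]].
pose p0 : tangent_dom j (tdom psi) := SigSub (mem_set (thA u (nbhs_singleton Nu))).
pose th v : tangent_dom j (tdom psi) := insubd p0 (cinv c' (l v)).
have thE v : N v -> set_val (th v) = cinv c' (l v).
  by move=> /thA/mem_set Av; rewrite set_valE /th insubdK.
have thc : {within N, continuous th}.
  apply/withinP => v Nv; apply/initial_cvgP; rewrite (thE v Nv).
  have : {within N, continuous (fun v => cinv c' (l v))}.
    case: (cok') => _ _ _ _; apply: (within_comp (f := l)); last exact: within_continuous.
    by move=> w /NO[/H1/(img_cinv cok')[]].
  move=> /withinN/(_ v Nv) thc B nB.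
  suff : nbhs v (fun w => N w -> B (set_val (th w))) by [].
  by apply: filterS (thc B nB) => w Bw Nw; rewrite thE//; exact: Bw.
have Lc : compact (th @` N) by exact: continuous_compact.
have Dth (t : CK_space r K E) v : N v -> mdiff j (loc psi (CK_val t)) (cinv c' (l v)) =
    diffn j (loc psi (CK_val t) \o cinv c) v.
  by move=> /NO[Dv _]; apply: H2 => //; exact: Esm.
have /CK_cvgP : nbhs s --> s by exact: cvg_id.
move=> /(_ psi psir j jr (th @` N) V Lc Oo).
have LO p : (th @` N) p -> V (mdiff j (loc psi (CK_val s)) (set_val p)).
  by move=> [v Nv <-]; rewrite thE// Dth//; case: (NO v Nv).
move=> /(_ LO) nT.
exists ([set t | forall p, (th @` N) p -> V (mdiff j (loc psi (CK_val t)) (set_val p))], N) => //=.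
move=> [t v] [/= tO Nv] _; apply: VV'.
by have := tO (th v) (ex_intro2 _ _ v Nv erefl); rewrite thE// Dth.
Qed.

End CK_evaluation.

(** * Maps of class C^r between manifolds and bundles *)

Section manifold_maps.
Context {R : realType}.
Implicit Types (M N L : charted R) (r : option nat).

Lemma le_order_trans n m r : (n <= m)%N -> le_order m r -> le_order n r.
Proof. by case: r => //= k; exact: leq_trans. Qed.

Definition mfdr r M : Prop := forall n, le_order n r -> mfd n M.

Lemma le_order0 r : le_order 0 r. Proof. by case: r. Qed.

Lemma is_manifold_mfdr r M : is_manifold r M -> mfdr r M.
Proof.
move=> [_ hM cov cok tr] n nr; split=> // c c' ac ac'.
by have /C_onP := tr c c' ac ac'; apply.
Qed.

Lemma within_open (S T : topologicalType) (A : set S) (f : S -> T) (B : set T) :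
  open A -> {within A, continuous f} -> open B -> open (A `&` f @^-1` B).
Proof.
move=> Ao /withinN fc Bo; rewrite openE => z [Az Bz].
have := fc z Az B (open_nbhs_nbhs (conj Bo Bz)).
have : nbhs z A by exact: open_nbhs_nbhs.
by apply: filterS2 => y Ay H; split=> //; exact: H.
Qed.

Lemma mfd_lcs (F : tvsType R) m : hausdorff_space F -> mfd m (lcs_charted F).
Proof.
move=> hF; split.
- exact: hF.
- by move=> y; exists (Chart setT id id : chart F F); [exact: erefl|exact: I].
- move=> c ->; split=> //=.
  + exact: openT.
  + have -> : cimg (Chart setT id id : chart F F) = setT.
      by apply/seteqP; split=> // y _; exists y.
    exact: openT.
  + by apply: within_continuous => x; exact: cvg_id.
  + by apply: within_continuous => x; exact: cvg_id.
- by move=> c c' -> ->; apply: Cn_lin => // x; exact: cvg_id.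
Qed.

Definition prod_chart M N (a : chart M (cmodel M)) (b : chart N (cmodel N)) :
    chart (M * N) (cmodel M * cmodel N) :=
  Chart (cdom a `*` cdom b) (fun y => (cmap a y.1, cmap b y.2))
    (fun u => (cinv a u.1, cinv b u.2)).

Lemma prod_chart_img M N (a : chart M (cmodel M)) (b : chart N (cmodel N)) A B :
  @img R (prod_charted M N) (prod_chart a b) (A `*` B) = img a A `*` img b B.
Proof.
apply/seteqP; split=> -[u v].
  by move=> [[y z] [[/= ay bz] [/= Ay Bz]] [<- <-]]; split; exact: img_in.
by move=> [/= [y [ay Ay] <-] [z [bz Bz] <-]]; exists (y, z).
Qed.

Lemma imgT M (c : chart M (cmodel M)) : img c setT = cimg c.
Proof. by rewrite /img setIT. Qed.

Lemma mfd_prod M N m : mfd m M -> mfd m N -> mfd m (prod_charted M N).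
Proof.
move=> [hM covM cokM trM] [hN covN cokN trN]; split.
- exact: hausdorff_pair.
- move=> [y z]; have [a aa ya] := covM y; have [b ab zb] := covN z.
  by exists (prod_chart a b) => //; exists a, b.
- move=> _ [a [b [aa ab ->]]]; have aok := cokM a aa; have bok := cokN b ab.
  have imgE : cimg (prod_chart a b) = cimg a `*` cimg b.
    by have := prod_chart_img a b setT setT; rewrite setXTT !imgT.
  case: (aok) => ao aio aK ac aic; case: (bok) => bo bio bK bc bic.
  split.
  + exact: open_prod.
  + by rewrite -/(prod_chart a b) imgE; exact: open_prod.
  + by move=> [y z] [/= ya zb]; rewrite aK// bK.
  + apply: within_pair.
      by apply: (within_comp (f := fst) _ _ ac); [move=> z []|exact: within_fst].
    by apply: (within_comp (f := snd) _ _ bc); [move=> z []|exact: within_snd].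
  + rewrite -/(prod_chart a b) imgE; apply: within_pair.
      by apply: (within_comp (f := fst) _ _ aic); [move=> z []|exact: within_fst].
    by apply: (within_comp (f := snd) _ _ bic); [move=> z []|exact: within_snd].
- move=> _ _ [a [b [aa ab ->]]] [a' [b' [aa' ab' ->]]].
  rewrite -/(prod_chart a b) -/(prod_chart a' b').
  rewrite (_ : cdom (prod_chart a' b') = cdom a' `*` cdom b')// prod_chart_img.
  have aok := cokM a aa; have bok := cokN b ab.
  have ao : open (img a (cdom a')) by apply: (img_open aok); case: (cokM a' aa').
  have bo : open (img b (cdom b')) by apply: (img_open bok); case: (cokN b' ab').
  have abo := open_prod ao bo.
  apply: Cn_pair => //.
  + apply: (Cn_comp _ _ abo ao (g := fst) (h := cmap a' \o cinv a)) => //.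
    * by move=> z [].
    * by apply: Cn_lin => // z; exact: cvg_fst.
    * exact: trM.
  + apply: (Cn_comp _ _ abo bo (g := snd) (h := cmap b' \o cinv b)) => //.
    * by move=> z [].
    * by apply: Cn_lin => // z; exact: cvg_snd.
    * exact: trN.
Qed.

Lemma C_map_Cn M N r (A : set M) (f : M -> N) n c c' : C_map_on r A f ->
  le_order n r -> atlas c -> atlas c' ->
  Cn n (img c (A `&` f @^-1` cdom c')) (cmap c' \o f \o cinv c).
Proof. by move=> [_ H] nr ac ac'; have /C_onP/(_ n nr) := H c c' ac ac'; rewrite -setIA. Qed.

Lemma C_map_comp M N L r (A : set M) (B : set N) (g : M -> N) (h : N -> L) :
  mfdr r M -> mfdr r N -> mfdr r L -> open A -> open B ->
  C_map_on r A g -> C_map_on r B h -> C_map_on r (A `&` g @^-1` B) (h \o g).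
Proof.
move=> Mok Nok Lok Ao Bo gs hs; have [gc _] := gs; have [hc _] := hs; split.
  apply: (within_comp _ _ hc) => [z []//|].
  by apply: continuous_subspaceW gc => z [].
move=> c c'' ac ac''; apply/C_onP => n nr; rewrite -setIA -/(img _ _).
have [_ _ cokM _] := Mok n nr; have [hN covN cokN _] := Nok n nr; have [hL _ cokL _] := Lok n nr.
have cok := cokM c ac.
apply: Cn_local => _ [y [cy [[Ay By] hy]] <-].
have [c' ac' c'y] := covN (g y); have cok' := cokN c' ac'.
have o'' : open (cdom c'') by case: (cokL c'' ac'').
have o' : open (cdom c') by case: cok'.
pose B' := B `&` h @^-1` cdom c''; have Bo' : open B' by exact: within_open.
pose A' := A `&` g @^-1` (B' `&` cdom c').
have Ao' : open A' by apply: within_open => //; exact: openI.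
have iA := img_open cok Ao'.
exists (img c A'); split=> //; first exact: img_in.
apply: (@Cn_sub _ _ _ _ (img c A')); first by move=> u [].
have gC : Cn n (img c A') (cmap c' \o g \o cinv c).
  apply: Cn_sub (C_map_Cn gs nr ac ac').
  by apply: img_sub => z [? []].
have hC := C_map_Cn hs nr ac' ac''.
apply: (@Cn_eq _ _ _ _ _ ((cmap c'' \o h \o cinv c') \o (cmap c' \o g \o cinv c))) => //.
  move=> u /(img_cinv cok)[cu [Au [Bu c'u]] _ _] /=.
  by rewrite (chart_cK cok').
apply: (Cn_comp hN hL iA (img_open cok' Bo') _ gC hC).
by move=> u /(img_cinv cok)[cu [Au [Bu c'u]] _ _] /=; exact: img_in.
Qed.

End manifold_maps.

Section bundles.
Context {R : realType} {X : charted R} (r : option nat).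
Hypothesis Xok : mfdr r X.

Section one_bundle.
Context {cplx : bool} {F : tvsType (scalars R cplx)}.
Implicit Types (E : bundle X F).

(** The local part of the definition of a vector bundle, which is handed on to sums and
    powers. *)
Definition good_bundle E : Prop :=
  [/\ hausdorff_space (real_lcs F), mfdr r (total_space E),
      continuous (@projT1 _ _ : total_space E -> X) &
      forall x, exists2 psi : trivialization E, is_trivialization r psi & tdom psi x].

Lemma good_vector_bundle E : is_vector_bundle r E -> good_bundle E.
Proof.
move=> [hF Ek [pc _] triv]; split=> //; first exact: is_manifold_mfdr.
exact/continuous_subspace_setT.
Qed.

Lemma triv_linear E (psi : trivialization E) x : is_trivialization r psi -> tdom psi x ->
  forall (a : R) (v w : fib E x),
  tmap psi (v + of_real cplx a *: w) = (tmap psi v : real_lcs F) + a *: (tmap psi w : real_lcs F).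
Proof.
move=> [_ H _ _] px a v w; have [pl _ _] := H x px.
by rewrite addrC pl addrC real_scaleE.
Qed.

Lemma triv_K E (psi : trivialization E) x (v : fib E x) : is_trivialization r psi -> tdom psi x ->
  tinv psi x (tmap psi v) = v.
Proof. by move=> [_ H _ _] px; have [_ + _] := H x px; apply. Qed.

Lemma triv_Kinv E (psi : trivialization E) x (v : F) : is_trivialization r psi -> tdom psi x ->
  tmap psi (tinv psi x v) = v.
Proof. by move=> [_ H _ _] px; have [_ _ +] := H x px; apply. Qed.

Lemma triv_inj E (psi : trivialization E) x (v w : fib E x) :
  is_trivialization r psi -> tdom psi x -> tmap psi v = tmap psi w -> v = w.
Proof. by move=> pr px vw; rewrite -(triv_K v pr px) vw triv_K. Qed.

Lemma triv0 E (psi : trivialization E) x : is_trivialization r psi -> tdom psi x ->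
  tmap psi (0 : fib E x) = 0.
Proof.
move=> pr px; have := triv_linear pr px (-1) 0 0.
by rewrite scaler0 addr0 scaleN1r subrr.
Qed.

Lemma mfdr_XF : hausdorff_space (real_lcs F) ->
  mfdr r (prod_charted X (lcs_charted (real_lcs F))).
Proof. by move=> hF n nr; apply: mfd_prod; [exact: Xok|exact: mfd_lcs]. Qed.

Definition XF_chart (c : chart X (cmodel X)) : chart (X * real_lcs F) (cmodel X * real_lcs F) :=
  @prod_chart R X (lcs_charted (real_lcs F)) c (Chart setT id id).

Lemma XF_chart_atlas c : atlas c ->
  @atlas R (prod_charted X (lcs_charted (real_lcs F))) (XF_chart c).
Proof. by move=> ac; exists c, (Chart setT id id). Qed.

(** The existential form is easy to verify, as the trivialization near each point can be
    chosen; [local_familyP] turns it into a claim about all trivializations. *)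
Definition local_family E (P : topologicalType) (A : set P) (Phi : P -> section E) : Prop :=
  forall (c : chart X (cmodel X)) x, atlas c -> cdom c x ->
  exists (psi : trivialization E) (D : set X),
    [/\ is_trivialization r psi, open D, D x, D `<=` tdom psi &
     forall n, le_order n r ->
       PC n ([set z | A z.1 /\ img c D z.2] : set (P * cmodel X))
         (fun p u => loc psi (Phi p) (cinv c u))].

Lemma local_family_PCfun E (P : topologicalType) (A : set P) (Phi : P -> section E) :
  good_bundle E ->
  (forall psi : trivialization E, is_trivialization r psi ->
   forall n, le_order n r -> PCfun n A (tdom psi) (fun p => loc psi (Phi p))) ->
  local_family A Phi.
Proof.
move=> [_ _ _ triv] H c x ac cx; have [psi pr px] := triv x.
exists psi, (tdom psi); split=> //; first by case: pr.
by move=> n nr; exact: (H psi pr n nr c ac).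
Qed.

Lemma section_smooth E (s : section E) (psi : trivialization E) n : good_bundle E ->
  is_trivialization r psi -> le_order n r -> C_section r E s ->
  PCfun n [set: bool] (tdom psi) (fun=> loc psi s).
Proof.
move=> [hF Eok pc triv] pr nr sC c ac.
have [po plin ps _] := pr.
have Po : open ([set p | tdom psi (projT1 p)] : set (total_space E)).
  by apply: (@open_comp _ _ (@projT1 _ _ : total_space E -> X)) => // z _; exact: pc.
have := C_map_comp Xok Eok (mfdr_XF hF) openT Po sC ps.
rewrite setTI => /C_map_Cn/(_ nr ac (XF_chart_atlas ac)) H.
have [_ _ cokX _] := Xok nr; have cok := cokX c ac.
have HC : Cn n (img c (tdom psi)) (loc psi s \o cinv c).
  apply: (Cn_comp (h := snd) (D' := setT) _ _ _ openT _ (Cn_sub _ H)) => //.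
  - apply: hausdorff_pair => //; by case: (Xok nr).
  - exact: (img_open cok po).
  - by move=> u /(img_cinv cok)[cu pu _ <-]; apply: img_in.
  - by apply: Cn_lin => // z; exact: cvg_snd.
by apply: PC_sub HC => z [].
Qed.

End one_bundle.

Section bundle_map.
Context {c1 c2 : bool} {F1 : tvsType (scalars R c1)} {F2 : tvsType (scalars R c2)}.
Context (E1 : bundle X F1) (E2 : bundle X F2).
Hypothesis E1ok : good_bundle E1.
Hypothesis E2ok : good_bundle E2.

Definition rep_dom (U : set (total_space E1)) (phi : trivialization E2)
    (psi : trivialization E1) : set (X * real_lcs F1) :=
  [set q | [/\ tdom psi q.1, tdom phi q.1 & U (total_pt (tinv psi q.1 q.2))]].

Lemma rep_dom_open U phi psi : open U -> is_trivialization r phi -> is_trivialization r psi ->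
  open (rep_dom U phi psi).
Proof.
move=> Uo [fo _ _ _] [so _ _ [sc _]].
have -> : rep_dom U phi psi = [set q | tdom phi q.1] `&`
    ((tdom psi `*` setT) `&` (fun q => total_pt (tinv psi q.1 q.2)) @^-1` U).
  by apply/seteqP; split=> q; [case|move=> [? [[]]]].
apply: openI; first exact: open_fst.
by apply: within_open => //; apply: open_prod => //; exact: openT.
Qed.

Lemma rep_smooth (U : set (total_space E1)) (f : bundle_map E1 E2)
    (phi : trivialization E2) (psi : trivialization E1) (c : chart X (cmodel X)) n :
  open U -> C_map_on r U (total_map f) ->
  is_trivialization r phi -> is_trivialization r psi -> atlas c -> le_order n r ->
  Cn n (@img R (prod_charted X (lcs_charted (real_lcs F1))) (XF_chart c) (rep_dom U phi psi))
    (fun z : cmodel X * real_lcs F1 => local_rep f phi psi (cinv c z.1) z.2 : real_lcs F2).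
Proof.
move=> Uo fC fr sr ac nr.
have [hF1 E1m _ _] := E1ok; have [hF2 E2m pc2 _] := E2ok.
have [fo flin fs _] := fr; have [so slin _ ss] := sr.
have Po : open ([set p | tdom phi (projT1 p)] : set (total_space E2)).
  by apply: (@open_comp _ _ (@projT1 _ _ : total_space E2 -> X)) => // z _; exact: pc2.
have To : open (tdom psi `*` setT : set (X * real_lcs F1)).
  by apply: open_prod => //; exact: openT.
have Uo' : open (U `&` total_map f @^-1` [set p | tdom phi (projT1 p)]).
  by apply: within_open => //; case: fC.
have H := C_map_comp (mfdr_XF hF1) E1m (mfdr_XF hF2) To Uo' ss
  (C_map_comp E1m E2m (mfdr_XF hF2) Uo Po fC fs).
have := C_map_Cn H nr (XF_chart_atlas ac) (XF_chart_atlas ac).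
have XFok : mfd n (prod_charted X (lcs_charted (real_lcs F1))) by exact: mfdr_XF.
have [_ _ cokX _] := XFok; have [hX _ cokc _] := Xok nr.
have cok := cokX _ (XF_chart_atlas ac).
move=> {}H.
have Do := img_open cok (rep_dom_open Uo fr sr).
apply: (Cn_comp (h := snd) (D' := setT) _ _ Do openT _ (Cn_sub _ H)) => //.
- exact: hausdorff_pair.
- move=> _ [[x v] [[/= cx _] [/= sx fx Ux]] <-].
  by exists (x, v) => //; split.
- by apply: Cn_lin => // z; exact: cvg_snd.
Qed.

(** The local representative of [f o s] in coordinates is the composition of the
    local representatives of [f] and [s]. *)
Lemma bundle_map_family (P : topologicalType) (A : set P) (Phi : P -> section E1)
    (U : set (total_space E1)) (f : bundle_map E1 E2) :
  open U -> C_map_on r U (total_map f) -> local_family A Phi ->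
  (forall p x, A p -> U (total_pt (Phi p x))) ->
  forall phi : trivialization E2, is_trivialization r phi ->
  forall n, le_order n r ->
    PCfun n A (tdom phi) (fun p => loc phi (fun x => f x (Phi p x))).
Proof.
move=> Uo fC HP PU phi fr n nr c ac.
have [hF1 _ _ _] := E1ok; have [hF2 _ _ _] := E2ok; have [fo _ _ _] := fr.
have [hX _ cokX _] := Xok nr; have cok := cokX c ac.
apply: PC_local => p _ [/= Ap [x [cx fx] <-]].
have [psi [D [sr Do Dx Ds sPC]]] := HP c x ac cx.
exists (img c (D `&` tdom phi)); split.
- by apply: (img_open cok); exact: openI.
- exact: img_in.
pose W := [set z | A z.1 /\ img c (D `&` tdom phi) z.2] : set (P * cmodel X).
have Wo : open_slices W by apply: open_slices_img => //; exact: openI.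
apply: (@PC_sub _ _ _ _ _ W); first by move=> [q u] [[/= Aq _] iu].
have XFok : mfd n (prod_charted X (lcs_charted (real_lcs F1))) by exact: mfdr_XF.
have [_ _ cokXF _] := XFok; have okXF := cokXF _ (XF_chart_atlas ac).
have Dz := img_open okXF (rep_dom_open Uo fr sr).
have fPC := @PC_const R P _ _ n _ _ (rep_smooth Uo fC fr sr ac nr).
apply: (@PC_eq _ _ _ _ _ _ (fun q u => local_rep f phi psi (cinv c u) (loc psi (Phi q) (cinv c u)))) => //.
  move=> q u [/= Aq /(img_cinv cok)[cu [Du fu] _ _]].
  by rewrite /local_rep /loc triv_K//; exact: Ds.
apply: (PC_comp (h := fun=> fun z : cmodel X * real_lcs F1 =>
  local_rep f phi psi (cinv c z.1) z.2 : real_lcs F2)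
  (g := fun q u => (u, loc psi (Phi q) (cinv c u))) _ hF2 Wo _ _ _ fPC).
- exact: hausdorff_pair.
- exact: open_slices_snd.
- move=> q u [/= Aq /(img_cinv cok)[cu [Du fu] _ uE]].
  exists (cinv c u, loc psi (Phi q) (cinv c u)); last by rewrite /= uE.
  split=> //; split=> //=; first exact: Ds.
  by rewrite /loc triv_K//; [exact: PU|exact: Ds].
- apply: PC_pair => //.
    apply: (@PC_sub _ _ _ _ _ [set z | [set: cmodel X] z.2]) => //.
    by apply: PC_const; apply: Cn_lin => // z; exact: cvg_id.
  apply: PC_sub (sPC n nr) => -[q u] [/= Aq iu]; split=> //.
  by apply: img_sub iu => z [].
Qed.

End bundle_map.

Section one_bundle2.
Context {cplx : bool} {F : tvsType (scalars R cplx)}.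
Context (E : bundle X F) (Eok : good_bundle E).

Lemma id_map_C : @C_map_on R (total_space E) (total_space E) r setT (total_map (fun x v => v)).
Proof.
have -> : total_map (fun x (v : fib E x) => v) = id by apply/funext => -[].
split; first by apply: within_continuous => z; exact: cvg_id.
move=> c c' ac ac'; apply/C_onP => n nr; have [_ Em _ _] := Eok.
have [_ _ _ tr] := Em n nr; apply: Cn_sub (tr c c' ac ac').
by move=> _ [y [[cy _] c'y] <-]; exists y.
Qed.

(** One trivialization near each point is enough, by [bundle_map_family] for the
    identity. *)
Lemma local_familyP (P : topologicalType) (A : set P) (Phi : P -> section E) :
  local_family A Phi ->
  forall psi : trivialization E, is_trivialization r psi ->
  forall n, le_order n r -> PCfun n A (tdom psi) (fun p => loc psi (Phi p)).
Proof.
move=> HP psi pr n nr.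
exact: (bundle_map_family Eok Eok openT id_map_C HP).
Qed.

(** A section is of class C^r if its local representatives are: compose
    [u |-> (u, s u)] with the inverse of a trivialization. *)
Lemma local_section (s : section E) : local_family [set: bool] (fun=> s) -> C_section r E s.
Proof.
move=> sP; have [hF Em pc triv] := Eok.
have sl (c : chart X (cmodel X)) x : atlas c -> cdom c x ->
  exists2 psi : trivialization E, is_trivialization r psi & tdom psi x /\
    forall n, le_order n r -> Cn n (img c (tdom psi)) (loc psi s \o cinv c).
  move=> ac cx; have [psi pr px] := triv x; exists psi => //; split=> // n nr.
  have := local_familyP sP pr nr ac.
  by apply: PC_sub => -[b u] /= iu; split.
have [_ cov cokX _] := Xok (le_order0 r).
have hc : {within setT, continuous (fun x => total_pt (s x))}.
  apply: within_local => x _; have [c ac cx] := cov x; have cok := cokX c ac.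
  have [psi pr [px sC]] := sl c x ac cx; have [po _ _ [ic _]] := pr.
  have co : open (cdom c) by case: cok.
  exists (cdom c `&` tdom psi); split=> //; first exact: openI.
  rewrite setTI.
  apply: (@within_congr _ _ _ (fun y => total_pt (tinv psi y (loc psi s y)))).
    by move=> y [_ py]; rewrite /loc triv_K.
  apply: (within_comp (f := fun y => (y, loc psi s y)) _ _ ic).
    by move=> y [].
  apply: within_pair; first by apply: within_continuous => z; exact: cvg_id.
  apply: (@within_congr _ _ _ ((loc psi s \o cinv c) \o cmap c)).
    by move=> y [cy py] /=; rewrite (chart_cK cok).
  apply: (within_comp _ _ (Cn_continuous (sC 0%N (le_order0 r)))).
    by move=> y [cy py]; exact: img_in.
  by case: cok => _ _ _ + _; apply: continuous_subspaceW => y [].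
split=> // c c' ac ac'; apply/C_onP => n nr.
have [hX _ cokX' _] := Xok nr; have cok := cokX' c ac.
have [hE _ cokE _] := Em n nr; have cok' := cokE c' ac'.
apply: Cn_local => _ [x [[cx _] c'x] <-].
have [psi pr [px sC]] := sl c x ac cx.
have [po _ _ ti] := pr.
have XFok : mfd n (prod_charted X (lcs_charted (real_lcs F))) by exact: mfdr_XF.
have [_ _ cokXF _] := XFok; have okXF := cokXF _ (XF_chart_atlas ac).
have [ic _] := ti.
have o' : open (cdom c') by case: cok'.
have To : open (tdom psi `*` setT : set (X * real_lcs F)).
  by apply: open_prod => //; exact: openT.
have B'o := within_open To ic o'.
set B' := _ `&` _ in B'o.
have tC := C_map_Cn ti nr (XF_chart_atlas ac) ac'.
pose h x := total_pt (s x).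
have so : open (tdom psi `&` h @^-1` cdom c').
  by apply: within_open => //; exact: continuous_subspaceW hc.
exists (img c (tdom psi `&` h @^-1` cdom c')); split.
- exact: (img_open cok so).
- exact: img_in.
apply: (@Cn_sub _ _ _ _ (img c (tdom psi `&` h @^-1` cdom c'))); first by move=> u [].
apply: (@Cn_eq _ _ _ _ _ ((cmap c' \o (fun q => total_pt (tinv psi q.1 q.2)) \o
   cinv (XF_chart c)) \o (fun u => (u, loc psi s (cinv c u))))).
- exact: (img_open cok so).
- by move=> u /(img_cinv cok)[cu [pu _] _ _]; rewrite /= /loc triv_K.
apply: (Cn_comp _ hE (img_open cok so) (img_open okXF B'o) _ _ tC).
- exact: hausdorff_pair.
- move=> u /(img_cinv cok)[cu [pu hu] _ uE].
  exists (cinv c u, loc psi s (cinv c u)); last by rewrite /= uE.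
  by split=> //; split=> //=; rewrite /loc triv_K.
- apply: Cn_pair => //; first exact: (img_open cok so).
    by apply: Cn_lin => // z; exact: cvg_id.
  by apply: Cn_sub (sC n nr); apply: img_sub => z [].
Qed.

End one_bundle2.

End bundles.

(** * Sums of vector bundles *)

Section sums.
Context {R : realType} {X : charted R} (r : option nat).
Hypothesis Xok : mfdr r X.
Context {cplx : bool} {F1 F2 : tvsType (scalars R cplx)}.

Lemma real_lcs_fst_continuous : continuous (fst : real_lcs (F1 * F2)%type -> real_lcs F1).
Proof. by move=> z; exact: (@cvg_fst F1 F2 (nbhs z.1) (nbhs z.2) _). Qed.

Lemma real_lcs_snd_continuous : continuous (snd : real_lcs (F1 * F2)%type -> real_lcs F2).
Proof. by move=> z; exact: (@cvg_snd F1 F2 (nbhs z.1) (nbhs z.2) _). Qed.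

(** The identity: taking the underlying real space commutes with products up to
    conversion. *)
Definition real_lcs_pair : (real_lcs F1 * real_lcs F2)%type -> real_lcs (F1 * F2)%type := id.

Lemma real_lcs_pair_continuous : continuous real_lcs_pair.
Proof. by move=> z; exact: (@cvg_id (F1 * F2)%type). Qed.

Lemma real_lcs_pair_hausdorff : hausdorff_space (real_lcs F1) -> hausdorff_space (real_lcs F2) ->
  hausdorff_space (real_lcs (F1 * F2)%type).
Proof. by move=> h1 h2; exact: (hausdorff_pair h1 h2). Qed.

Lemma PC_real_lcs_pair (P : topologicalType) (V : tvsType R) n (W : set (P * V))
    (f : P -> V -> real_lcs F1) (g : P -> V -> real_lcs F2) :
  hausdorff_space (real_lcs F1) -> hausdorff_space (real_lcs F2) -> open_slices W ->
  PC n W f -> PC n W g -> PC n W (fun p u => (f p u, g p u) : real_lcs (F1 * F2)%type).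
Proof.
move=> h1 h2 Wo fn gn; have fgn := PC_pair h1 h2 Wo fn gn.
have h := hausdorff_pair h1 h2; have h' := real_lcs_pair_hausdorff h1 h2.
apply: (PC_comp (h := fun=> real_lcs_pair) (Z := [set z | setT z.2]) h h' Wo _ _ fgn) => //.
  by apply: open_slices_snd; exact: openT.
apply: PC_const; apply: Cn_lin => //; exact: real_lcs_pair_continuous.
Qed.

Lemma PC_real_lcs_fst (P : topologicalType) (V : tvsType R) n (W : set (P * V))
    (f : P -> V -> real_lcs (F1 * F2)%type) :
  hausdorff_space (real_lcs F1) -> hausdorff_space (real_lcs F2) -> open_slices W ->
  PC n W f -> PC n W (fun p u => (f p u).1 : real_lcs F1).
Proof.
move=> h1 h2 Wo fn; have h' := real_lcs_pair_hausdorff h1 h2.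
apply: (PC_comp (h := fun=> (fst : real_lcs (F1 * F2)%type -> real_lcs F1))
  (Z := [set z | setT z.2]) h' h1 Wo _ _ fn) => //.
  by apply: open_slices_snd; exact: openT.
apply: PC_const; apply: Cn_lin => //; exact: real_lcs_fst_continuous.
Qed.

Lemma PC_real_lcs_snd (P : topologicalType) (V : tvsType R) n (W : set (P * V))
    (f : P -> V -> real_lcs (F1 * F2)%type) :
  hausdorff_space (real_lcs F1) -> hausdorff_space (real_lcs F2) -> open_slices W ->
  PC n W f -> PC n W (fun p u => (f p u).2 : real_lcs F2).
Proof.
move=> h1 h2 Wo fn; have h' := real_lcs_pair_hausdorff h1 h2.
apply: (PC_comp (h := fun=> (snd : real_lcs (F1 * F2)%type -> real_lcs F2))
  (Z := [set z | setT z.2]) h' h2 Wo _ _ fn) => //.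
  by apply: open_slices_snd; exact: openT.
apply: PC_const; apply: Cn_lin => //; exact: real_lcs_snd_continuous.
Qed.

Context (E1 : bundle X F1) (E2 : bundle X F2).
Hypothesis E1ok : good_bundle r E1.
Hypothesis E2ok : good_bundle r E2.

Local Notation S := (sum_bundle r E1 E2).
Let h1 : hausdorff_space (real_lcs F1). Proof. by case: E1ok. Qed.
Let h2 : hausdorff_space (real_lcs F2). Proof. by case: E2ok. Qed.

Definition sum_triv (psi1 : trivialization E1) (psi2 : trivialization E2) : trivialization S :=
  @Trivialization R X cplx (F1 * F2)%type S (tdom psi1 `&` tdom psi2)
    (fun x (v : fib S x) => (tmap psi1 v.1, tmap psi2 v.2))
    (fun x w => (tinv psi1 x w.1, tinv psi2 x w.2)).

(** This is [rep_smooth] for the identity. *)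
Lemma change_triv_smooth (F : tvsType (scalars R cplx)) (E : bundle X F)
    (psi psi' : trivialization E) (c : chart X (cmodel X)) n :
  good_bundle r E -> is_trivialization r psi -> is_trivialization r psi' ->
  atlas c -> le_order n r ->
  Cn n (img c (tdom psi `&` tdom psi') `*` setT)
    (fun z : cmodel X * real_lcs F => tmap psi' (tinv psi (cinv c z.1) z.2) : real_lcs F).
Proof.
move=> Eok pr pr' ac nr.
have := rep_smooth Xok Eok Eok openT (id_map_C Eok) pr' pr ac nr.
apply: Cn_sub => -[u v] [/= [x [cx [px px']] <-] _].
by exists (x, v).
Qed.

Section charts.
Context (c : chart X (cmodel X)) (psi1 : trivialization E1) (psi2 : trivialization E2).
Hypothesis ac : atlas c.
Hypothesis pr1 : is_trivialization r psi1.
Hypothesis pr2 : is_trivialization r psi2.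
Let cok : chart_ok c. Proof. by have [_ _ + _] := Xok (le_order0 r); apply. Qed.
Local Notation e := (sum_chart c psi1 psi2 : chart (total_space S) (cmodel (total_space S))).

Lemma sum_chart_cK p : cdom e p -> cinv e (cmap e p) = p.
Proof.
case: p => x [v w] [/= cx px1 px2]; rewrite (chart_cK cok cx).
by rewrite (triv_K _ pr1)// (triv_K _ pr2).
Qed.

Lemma sum_chart_img (A : set X) :
  img e [set p | A (projT1 p)] = img c (A `&` tdom psi1 `&` tdom psi2) `*` setT.
Proof.
apply/seteqP; split=> -[u w].
  by move=> [[x [v1 v2]] [[/= cx px1 px2] Ax] [<- _]]; split=> //; exact: img_in.
move=> [/= [x [cx [[Ax px1] px2]] <-] _].
exists (total_pt ((tinv psi1 x w.1, tinv psi2 x w.2) : fib S x)) => //=.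
by rewrite (triv_Kinv _ pr1)// (triv_Kinv _ pr2)//; case: w.
Qed.

End charts.

(** The formula covers the transitions between charts of the sum, and also the
    trivializations of the sum and their inverses in such charts. *)
Lemma sum_transition (c c' : chart X (cmodel X)) (psi1 psi1' : trivialization E1)
    (psi2 psi2' : trivialization E2) n :
  atlas c -> atlas c' -> is_trivialization r psi1 -> is_trivialization r psi1' ->
  is_trivialization r psi2 -> is_trivialization r psi2' -> le_order n r ->
  Cn n (img c ((cdom c' `&` tdom psi1' `&` tdom psi2') `&` tdom psi1 `&` tdom psi2) `*` setT)
    (fun u : cmodel X * real_lcs (F1 * F2)%type =>
       (cmap c' (cinv c u.1),
        (tmap psi1' (tinv psi1 (cinv c u.1) u.2.1), tmap psi2' (tinv psi2 (cinv c u.1) u.2.2)))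
       : (cmodel X * real_lcs (F1 * F2)%type)%type).
Proof.
move=> ac ac' p1 p1' p2 p2' nr.
have [hX _ cokX tr] := Xok nr; have cok := cokX c ac.
have o1 : open (tdom psi1) by case: p1. have o1' : open (tdom psi1') by case: p1'.
have o2 : open (tdom psi2) by case: p2. have o2' : open (tdom psi2') by case: p2'.
have oc' : open (cdom c') by case: (cokX c' ac').
set D := _ `&` _ `&` _ `&` tdom psi1 `&` tdom psi2.
have Do : open D by repeat apply: openI.
have iDo : open (img c D `*` setT : set (cmodel X * real_lcs (F1 * F2)%type)).
  by apply: open_prod; [exact: (img_open cok)|exact: openT].
have hS := real_lcs_pair_hausdorff h1 h2.
apply: Cn_pair => //.
  apply: (Cn_comp (g := fst) (h := cmap c' \o cinv c) hX hX iDo _ _ _ (tr c c' ac ac')).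
  - exact: (img_open cok).
  - by move=> z [+ _]; apply: img_sub => x [[[[]]]].
  - by apply: Cn_lin => // z; exact: cvg_fst.
have aux (G : tvsType (scalars R cplx)) (E : bundle X G) (psi psi' : trivialization E)
    (l : real_lcs (F1 * F2)%type -> real_lcs G) :
    good_bundle r E -> is_trivialization r psi -> is_trivialization r psi' ->
    lin l -> continuous l -> D `<=` tdom psi `&` tdom psi' ->
    Cn n (img c D `*` setT) (fun u : cmodel X * real_lcs (F1 * F2)%type =>
       tmap psi' (tinv psi (cinv c u.1) (l u.2)) : real_lcs G).
  move=> Eok p p' ll lc DD; have [hG _ _ _] := Eok.
  apply: (Cn_comp (g := fun u => (u.1, l u.2)) _ hG iDo _ _ _ (change_triv_smooth Eok p p' ac nr)).
  - exact: hausdorff_pair.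
  - apply: open_prod; [apply: (img_open cok)|exact: openT].
    by apply: openI; [case: p|case: p'].
  - by move=> z [+ _]; split=> //; apply: img_sub DD _ _.
  - apply: Cn_pair => //; first by apply: Cn_lin => // z; exact: cvg_fst.
    apply: Cn_lin => //; first by move=> a u v /=; rewrite ll.
    move=> z; apply: (@continuous_comp _ _ _ snd l z); [exact: cvg_snd|exact: lc].
apply: PC_real_lcs_pair => //.
- apply: (aux _ E1 psi1 psi1' fst) => //; first exact: real_lcs_fst_continuous.
  by move=> x [[[[]]]].
- apply: (aux _ E2 psi2 psi2' snd) => //; first exact: real_lcs_snd_continuous.
  by move=> x [[[[]]]].
Qed.

Lemma sum_atlasP (e : chart (total_space S) (cmodel (total_space S))) : atlas e ->
  exists c psi1 psi2, [/\ atlas c, is_trivialization r psi1, is_trivialization r psi2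
       & e = sum_chart c psi1 psi2].
Proof. by []. Qed.

Lemma sum_chart_dom (c : chart X (cmodel X)) (psi1 : trivialization E1) (psi2 : trivialization E2) :
  cdom (sum_chart c psi1 psi2) =
  [set p | (cdom c `&` tdom psi1 `&` tdom psi2) (projT1 p)].
Proof. by apply/seteqP; split=> p /= => [[? ? ?]|[[? ?] ?]]. Qed.

Lemma sum_tr_Cn (e e' : chart (total_space S) (cmodel (total_space S))) n :
  atlas e -> atlas e' -> le_order n r -> Cn n (img e (cdom e')) (cmap e' \o cinv e).
Proof.
move=> /sum_atlasP[c [psi1 [psi2 [ac p1 p2 ->]]]] /sum_atlasP[c' [psi1' [psi2' [ac' p1' p2' ->]]]] nr.
rewrite sum_chart_dom sum_chart_img//.
exact: (sum_transition ac ac').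
Qed.

Lemma sum_img_open (e e' : chart (total_space S) (cmodel (total_space S))) :
  atlas e -> atlas e' -> open (img e (cdom e')).
Proof.
move=> /sum_atlasP[c [psi1 [psi2 [ac p1 p2 ->]]]] /sum_atlasP[c' [psi1' [psi2' [ac' p1' p2' ->]]]].
rewrite sum_chart_dom sum_chart_img//.
have [hX _ cokX tr] := Xok (le_order0 r).
apply: open_prod; last exact: openT; apply: (img_open (cokX c ac)).
have oc' : open (cdom c') by case: (cokX c' ac').
have [q1 _ _ _] := p1; have [q1' _ _ _] := p1'; have [q2 _ _ _] := p2; have [q2' _ _ _] := p2'.
by repeat apply: openI.
Qed.

Lemma sum_chart_cKe (e : chart (total_space S) (cmodel (total_space S))) p : atlas e ->
  cdom e p -> cinv e (cmap e p) = p.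
Proof. by move=> /sum_atlasP[c [psi1 [psi2 [ac p1 p2 ->]]]]; exact: sum_chart_cK. Qed.

Lemma sum_chart_ok (e : chart (total_space S) (cmodel (total_space S))) : atlas e -> chart_ok e.
Proof.
move=> ae.
have [||| opn mc ic] := @chart_space_chart _ _ (@sum_atlas R X cplx r F1 F2 E1 E2) _ _ _ e ae.
- by move=> e0 p; exact: sum_chart_cKe.
- by move=> e0 e1; exact: sum_img_open.
- by move=> e0 e1 a0 a1; exact: (Cn_continuous (sum_tr_Cn a0 a1 (le_order0 r))).
split=> //; last by move=> p; exact: sum_chart_cKe.
by have := sum_img_open ae ae; rewrite /img setIid.
Qed.

Lemma sum_cover (p : total_space S) : exists c psi1 psi2,
  [/\ atlas c, is_trivialization r psi1, is_trivialization r psi2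
    & cdom (sum_chart c psi1 psi2) p].
Proof.
have [_ cov _ _] := Xok (le_order0 r); have [c ac cx] := cov (projT1 p).
have [_ _ _ t1] := E1ok; have [psi1 p1 px1] := t1 (projT1 p).
have [_ _ _ t2] := E2ok; have [psi2 p2 px2] := t2 (projT1 p).
by exists c, psi1, psi2.
Qed.

Lemma mfdr_sum : mfdr r (total_space S).
Proof.
move=> n nr; split.
- by apply: hausdorff_pair; [case: (Xok nr)|exact: real_lcs_pair_hausdorff].
- move=> p; have [c [psi1 [psi2 [ac p1 p2 ep]]]] := sum_cover p.
  by exists (sum_chart c psi1 psi2) => //; exists c, psi1, psi2.
- exact: sum_chart_ok.
- by move=> e e' ae ae'; exact: sum_tr_Cn.
Qed.

Lemma sum_continuous (T : topologicalType) (A : set (total_space S)) (g : total_space S -> T) :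
  (forall (c : chart X (cmodel X)) (psi1 : trivialization E1) (psi2 : trivialization E2),
     atlas c -> is_trivialization r psi1 -> is_trivialization r psi2 ->
     let e := sum_chart c psi1 psi2 : chart (total_space S) (cmodel (total_space S)) in
     {within img e A, continuous (g \o cinv e)}) ->
  {within A, continuous g}.
Proof.
move=> H; apply: within_local => p Ap; have [c [psi1 [psi2 [ac p1 p2 ep]]]] := sum_cover p.
pose e := sum_chart c psi1 psi2 : chart (total_space S) (cmodel (total_space S)).
have ae : atlas e by exists c, psi1, psi2.
have [eo _ eK ec _] := sum_chart_ok ae.
exists (cdom e); split=> //.
apply: (@within_congr _ _ _ ((g \o cinv e) \o cmap e)).
  by move=> q [_ qe]; exact: (congr1 g (eK q qe)).
apply: (within_comp _ _ (H c psi1 psi2 ac p1 p2)).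
  by move=> q [Aq eq]; exact: img_in.
by apply: continuous_subspaceW ec => q [].
Qed.

Lemma sum_fst_continuous : continuous (fun p : total_space S => total_pt (projT2 p).1 : total_space E1).
Proof.
apply/continuous_subspace_setT; apply: sum_continuous => c psi1 psi2 ac p1 p2 e; rewrite {}/e.
have [_ _ cokX _] := Xok (le_order0 r); have cok := cokX c ac.
have [_ _ _ [ic _]] := p1.
apply: (within_comp (f := fun u => (cinv c u.1, u.2.1)) _ _ ic).
  by move=> u; rewrite (sum_chart_img c p1 p2 setT) => -[/(img_cinv cok)[? [[_ px1] _] _ _] _].
apply: within_pair.
  case: (cok) => _ _ _ _; apply: (within_comp (f := fst)); last exact: within_fst.
  by move=> u; rewrite (sum_chart_img c p1 p2 setT) => -[/(img_cinv cok)[]].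
apply: within_continuous => u.
apply: (@continuous_comp _ _ _ snd (fst : real_lcs (F1 * F2)%type -> real_lcs F1) u); first exact: cvg_snd.
exact: real_lcs_fst_continuous.
Qed.

Lemma sum_proj_continuous : continuous (@projT1 _ _ : total_space S -> X).
Proof.
apply/continuous_subspace_setT; apply: sum_continuous => c psi1 psi2 ac p1 p2 e; rewrite {}/e.
have [_ _ cokX _] := Xok (le_order0 r); have cok := cokX c ac.
case: (cok) => _ _ _ _; apply: (within_comp (f := fst)); last exact: within_fst.
by move=> u; rewrite (sum_chart_img c p1 p2 setT) => -[/(img_cinv cok)[]].
Qed.

Lemma sum_triv_ok (psi1 : trivialization E1) (psi2 : trivialization E2) :
  is_trivialization r psi1 -> is_trivialization r psi2 ->
  is_trivialization r (sum_triv psi1 psi2).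
Proof.
move=> p1 p2; have [q1 l1 _ _] := p1; have [q2 l2 _ _] := p2.
have [_ covX cokX _] := Xok (le_order0 r).
have Do : open (tdom psi1 `&` tdom psi2) by exact: openI.
split=> //.
- move=> x [px1 px2]; have [l1' _ _] := l1 x px1; have [l2' _ _] := l2 x px2.
  split.
  + by move=> a [u1 u2] [v1 v2] /=; rewrite l1' l2'.
  + by move=> [u1 u2] /=; rewrite (triv_K _ p1)// (triv_K _ p2).
  + by move=> [u1 u2] /=; rewrite (triv_Kinv _ p1)// (triv_Kinv _ p2).
- split.
    apply: sum_continuous => c psi1' psi2' ac p1' p2' e; rewrite {}/e; have cok := cokX c ac.
    rewrite (sum_chart_img c p1' p2' (tdom psi1 `&` tdom psi2)).
    apply: within_pair.
      case: (cok) => _ _ _ _; apply: (within_comp (f := fst)); last exact: within_fst.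
      by move=> u [/(img_cinv cok)[]].
    have tc := Cn_continuous (sum_transition ac ac p1' p1 p2' p2 (le_order0 r)).
    apply: (within_comp (W' := setT) (g := snd) _ (continuous_subspaceW _ tc)) => //; last exact: within_snd.
    move=> [u w] [/= [x [cx [[[px1 px2] px1'] px2']] <-] _]; split=> //=.
    exact: img_in.
  move=> _ _ /sum_atlasP[c [psi1' [psi2' [ac p1' p2' ->]]]] [a [_ [aa -> ->]]].
  apply/C_onP => n nr; apply: Cn_sub (sum_transition ac aa p1' p1 p2' p2 nr).
  move=> _ [[x v] [[[/= cx px1' px2'] [px1 px2]] [/= ax _]] <-]; split=> //=.
  exact: img_in.
- split.
    apply: within_local => -[x w] [/= px _]; have [c ac cx] := covX x; have cok := cokX c ac.
    pose e := sum_chart c psi1 psi2 : chart (total_space S) (cmodel (total_space S)).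
    have ae : atlas e by exists c, psi1, psi2.
    have co : open (cdom c) by case: cok.
    exists [set q | cdom c q.1]; split=> //; first exact: open_fst.
    apply: (@within_congr _ _ _ (fun q => cinv e (cmap c q.1, q.2))).
      by move=> [y v] [_ /= cy]; rewrite /e /= (chart_cK cok cy).
    have [_ _ _ _ ic] := sum_chart_ok ae.
    apply: (within_comp (f := fun q => (cmap c q.1, q.2)) _ _ ic).
      move=> [y v] [[/= [py1 py2] _] cy].
      exists (total_pt ((tinv psi1 y v.1, tinv psi2 y v.2) : fib S y)) => //.
      by rewrite /e /= (triv_Kinv _ p1)// (triv_Kinv _ p2)//; case: v.
    apply: within_pair; last exact: within_snd.
    case: (cok) => _ _ _ + _; apply: (within_comp (f := fst)); last exact: within_fst.
    by move=> q [].
  move=> _ _ [a [_ [aa -> ->]]] /sum_atlasP[c [psi1' [psi2' [ac p1' p2' ->]]]].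
  apply/C_onP => n nr; apply: Cn_sub (sum_transition aa ac p1 p1' p2 p2' nr).
  move=> _ [[x v] [[[/= ax _] [[px1 px2] _]] [/= cx px1' px2']] <-]; split=> //=.
  exact: img_in.
Qed.

Lemma good_sum_bundle : good_bundle r S.
Proof.
split.
- exact: real_lcs_pair_hausdorff.
- exact: mfdr_sum.
- exact: sum_proj_continuous.
- move=> x; have [_ _ _ t1] := E1ok; have [psi1 p1 px1] := t1 x.
  have [_ _ _ t2] := E2ok; have [psi2 p2 px2] := t2 x.
  by exists (sum_triv psi1 psi2) => //; exact: sum_triv_ok.
Qed.

End sums.

(** * Smooth families of sections *)

Section families.
Context {R : realType} {X : charted R} (r : option nat).
Hypothesis Xok : mfdr r X.

Lemma open_slices_XA (P : topologicalType) (A : set P) (c : chart X (cmodel X)) D :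
  atlas c -> open D -> open_slices ([set z | A z.1 /\ img c D z.2] : set (P * cmodel X)).
Proof.
move=> ac; apply: open_slices_img; have [_ _ + _] := Xok (le_order0 r); exact.
Qed.

Definition smooth_family {cplx : bool} {F : tvsType (scalars R cplx)} (E : bundle X F)
    (P : topologicalType) (A : set P) (Phi : P -> section E) : Prop :=
  forall psi : trivialization E, is_trivialization r psi ->
  forall n, le_order n r -> PCfun n A (tdom psi) (fun p => loc psi (Phi p)).

Section one.
Context {cplx : bool} {F : tvsType (scalars R cplx)}.
Context (E : bundle X F) (Eok : good_bundle r E).

Lemma smooth_family_eq (P : topologicalType) (A : set P) (Phi Psi : P -> section E) :
  (forall p x, A p -> Phi p x = Psi p x) -> smooth_family A Phi -> smooth_family A Psi.
Proof.
move=> e H psi pr n nr c ac; apply: PC_eq (H psi pr n nr c ac).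
  by apply: open_slices_XA => //; case: pr.
by move=> p u [/= Ap _]; rewrite /loc e.
Qed.

Lemma smooth_family_reparam (P P' : topologicalType) (A : set P) (A' : set P') (th : P' -> P)
    (Phi : P -> section E) :
  {within A', continuous th} -> (forall p, A' p -> A (th p)) ->
  smooth_family A Phi -> smooth_family A' (Phi \o th).
Proof.
move=> thc AA H psi pr n nr c ac; apply: (PC_reparam thc _ (H psi pr n nr c ac)).
by move=> p u [/= Ap iu]; split=> //; split=> //; exact: AA.
Qed.

Lemma smooth_family_const (P : topologicalType) (A : set P) (s : section E) :
  C_section r E s -> smooth_family A (fun=> s).
Proof.
move=> sC psi pr n nr c ac.
have := section_smooth Xok Eok pr nr sC ac.
apply: (@PC_reparam _ _ _ _ _ _ setT (fun=> true)) => //.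
  by apply: within_continuous => z; exact: cvg_cst.
by move=> p u [_ iu].
Qed.

Lemma smooth_family_section (P : topologicalType) (A : set P) (Phi : P -> section E) p :
  smooth_family A Phi -> A p -> C_section r E (Phi p).
Proof.
move=> H Ap; apply: (local_section Xok Eok); apply: (local_family_PCfun Eok).
apply: (smooth_family_reparam (A' := [set: bool]) (th := fun=> p) _ _ H) => //.
by apply: within_continuous => z; exact: cvg_cst.
Qed.

Lemma loc_lincomb (psi : trivialization E) (s t : section E) (a : R) x :
  is_trivialization r psi -> tdom psi x ->
  loc psi (s + a *: t) x = loc psi s x + a *: loc psi t x.
Proof. by move=> pr px; rewrite /loc (triv_linear pr px). Qed.

(** The map [(v, w) |-> v + a p w] is linear with continuous dependence on [p]. *)
Lemma smooth_family_lincomb (P : topologicalType) (A : set P) (Phi Psi : P -> section E) (a : P -> R) :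
  {within A, continuous a} -> smooth_family A Phi -> smooth_family A Psi ->
  smooth_family A (fun p => Phi p + a p *: Psi p).
Proof.
move=> ca HP HQ psi pr n nr c ac; have [hF _ _ _] := Eok.
have po : open (tdom psi) by case: pr.
have Wo := open_slices_XA A ac po; have hFF := hausdorff_pair hF hF.
have fg := PC_pair hF hF Wo (HP psi pr n nr c ac) (HQ psi pr n nr c ac).
have [_ _ cokX _] := Xok nr; have cok := cokX c ac.
apply: (@PC_eq _ _ _ _ _ _ (fun p u => loc psi (Phi p) (cinv c u) + a p *: loc psi (Psi p) (cinv c u))) => //.
  by move=> p u [/= Ap /(img_cinv cok)[_ pu _ _]]; rewrite (loc_lincomb _ _ _ pr).
apply: (PC_comp (h := fun p (z : real_lcs F * real_lcs F) => z.1 + a p *: z.2)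
  (Z := [set z | A z.1]) hFF hF Wo _ _ fg).
- move=> p; have [Ap|Ap] := pselect (A p).
    have -> : [set u | [set z : P * (real_lcs F * real_lcs F) | A z.1] (p, u)] = setT.
      by apply/seteqP; split.
    exact: openT.
  have -> : [set u | [set z : P * (real_lcs F * real_lcs F) | A z.1] (p, u)] = set0.
    by apply/seteqP; split.
  exact: open0.
- by move=> p u [].
- apply: (@PC_lin _ _ _ _ _ A) => //.
    move=> p b [u1 u2] [v1 v2] /=; rewrite !scalerDr !scalerA addrACA.
    by rewrite [b * _]mulrC.
  apply/withinP => -[p [u v]] /= Ap; apply: tvs_cvgD.
    apply: cvg_within_filter; apply: (@cvg_comp _ _ _ snd fst _ (nbhs (u, v))).
      exact: cvg_snd.
    exact: cvg_fst.
  apply: tvs_cvgZ.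
    have : {within [set z : P * (real_lcs F * real_lcs F) | A z.1], continuous (fun z => a z.1)}.
      by apply: (within_comp (f := fst) _ _ ca) => //; exact: within_fst.
    by move=> /withinP/(_ (p, (u, v))); exact.
  apply: cvg_within_filter; apply: (@cvg_comp _ _ _ snd snd _ (nbhs (u, v))).
    exact: cvg_snd.
  exact: cvg_snd.
Qed.

End one.

Section pair.
Context {cplx : bool} {F1 F2 : tvsType (scalars R cplx)}.
Context (E1 : bundle X F1) (E2 : bundle X F2).
Hypothesis E1ok : good_bundle r E1.
Hypothesis E2ok : good_bundle r E2.
Local Notation S := (sum_bundle r E1 E2).
Let h1 : hausdorff_space (real_lcs F1). Proof. by case: E1ok. Qed.
Let h2 : hausdorff_space (real_lcs F2). Proof. by case: E2ok. Qed.
Let Sok := good_sum_bundle Xok E1ok E2ok.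

Lemma smooth_family_pair (P : topologicalType) (A : set P) (Phi : P -> section E1)
    (Psi : P -> section E2) :
  smooth_family A Phi -> smooth_family A Psi ->
  smooth_family A (fun p => (fun x => (Phi p x, Psi p x)) : section S).
Proof.
move=> HP HQ; apply: (local_familyP Xok Sok) => c x ac cx.
have [_ _ _ t1] := E1ok; have [psi1 p1 px1] := t1 x.
have [_ _ _ t2] := E2ok; have [psi2 p2 px2] := t2 x.
have q1 : open (tdom psi1) by case: p1. have q2 : open (tdom psi2) by case: p2.
exists (sum_triv r psi1 psi2), (tdom psi1 `&` tdom psi2); split => //.
- exact: sum_triv_ok.
- exact: openI.
- move=> n nr; apply: PC_real_lcs_pair => //.
  + by apply: open_slices_XA => //; exact: openI.
  + apply: PC_sub (HP psi1 p1 n nr c ac) => -[p u] [/= Ap iu]; split=> //.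
    by apply: img_sub iu => z [].
  + apply: PC_sub (HQ psi2 p2 n nr c ac) => -[p u] [/= Ap iu]; split=> //.
    by apply: img_sub iu => z [].
Qed.

Lemma smooth_family_fst (P : topologicalType) (A : set P) (Phi : P -> section S) :
  smooth_family A Phi -> smooth_family A (fun p => (fun x => (Phi p x).1) : section E1).
Proof.
move=> HP; apply: (local_familyP Xok E1ok) => c x ac cx.
have [_ _ _ t1] := E1ok; have [psi1 p1 px1] := t1 x.
have [_ _ _ t2] := E2ok; have [psi2 p2 px2] := t2 x.
have q1 : open (tdom psi1) by case: p1. have q2 : open (tdom psi2) by case: p2.
exists psi1, (tdom psi1 `&` tdom psi2); split => //; first exact: openI.
move=> n nr; have H := HP _ (sum_triv_ok Xok E1ok E2ok p1 p2) n nr c ac.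
by apply: (PC_real_lcs_fst h1 h2 _ H); apply: open_slices_XA => //; exact: openI.
Qed.

Lemma smooth_family_snd (P : topologicalType) (A : set P) (Phi : P -> section S) :
  smooth_family A Phi -> smooth_family A (fun p => (fun x => (Phi p x).2) : section E2).
Proof.
move=> HP; apply: (local_familyP Xok E2ok) => c x ac cx.
have [_ _ _ t1] := E1ok; have [psi1 p1 px1] := t1 x.
have [_ _ _ t2] := E2ok; have [psi2 p2 px2] := t2 x.
have q1 : open (tdom psi1) by case: p1. have q2 : open (tdom psi2) by case: p2.
exists psi2, (tdom psi1 `&` tdom psi2); split => //; first exact: openI.
move=> n nr; have H := HP _ (sum_triv_ok Xok E1ok E2ok p1 p2) n nr c ac.
by apply: (PC_real_lcs_snd h1 h2 _ H); apply: open_slices_XA => //; exact: openI.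
Qed.

End pair.
End families.

Section CK_sections.
Context {R : realType} {X : charted R} (r : option nat).
Hypothesis Xok : mfdr r X.
Hypothesis Xlc : locally_cpt (cmodel X).
Context (K : set X).

Section one.
Context {cplx : bool} {F : tvsType (scalars R cplx)}.
Context (E : bundle X F) (Eok : good_bundle r E).

Lemma closure_subU (T : topologicalType) (A B C D : set T) :
  closure A `<=` D -> closure B `<=` D -> C `<=` A `|` B -> closure C `<=` D.
Proof.
move=> AD BD CAB x /(closure_subset CAB); rewrite closureU => -[/AD|/BD] //.
Qed.

Lemma CK_section_submod (a : R) (s t : section E) :
  CK_section r K E s -> CK_section r K E t -> CK_section r K E (a *: s + t).
Proof.
move=> [sC sK] [tC tK]; split.
  have H := smooth_family_lincomb Xok Eok (A := [set: bool]) (a := fun=> a)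
    _ (smooth_family_const Xok Eok _ tC) (smooth_family_const Xok Eok _ sC).
  rewrite addrC; apply: (smooth_family_section Xok Eok (p := true) (H _)) => //.
  by apply: within_continuous => z; exact: cvg_cst.
apply: (closure_subU sK tK) => x /= st.
have [s0|] := eqVneq (s x) 0; last by left.
right; apply: contra_neq st => t0.
by rewrite -[LHS]/(of_real cplx a *: s x + t x) s0 t0 scaler0 addr0.
Qed.

Lemma CK_section0 : CK_section r K E 0.
Proof.
split; last first.
  rewrite (_ : [set x | (0 : section E) x != 0] = set0) ?closure0//.
  by apply/seteqP; split=> x // /eqP[].
apply: (local_section Xok Eok); apply: (local_family_PCfun Eok) => psi pr n nr c ac.
have po : open (tdom psi) by case: pr.
have [hF _ _ _] := Eok; have [_ _ cokX _] := Xok nr; have cok := cokX c ac.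
apply: (@PC_eq _ _ _ _ _ _ (fun _ _ => 0)); first exact: (open_slices_XA Xok).
  move=> p u [_ /(img_cinv cok)[_ pu _ _]].
  by rewrite /loc -[RHS]/(tmap psi (0 : fib E (cinv c u))) (triv0 pr pu).
apply: (@PC_lin _ _ _ _ _ setT) => //.
  by move=> p b u v; rewrite scaler0 addr0.
by apply: within_continuous => z; exact: cvg_cst.
Qed.

(** C^r-sections with support in [K] already form a vector space, so nothing is added
    by the linear span. *)
Lemma CK_spanP (s : section E) : (s \in linear_span (CK_section r K E)) <-> CK_section r K E s.
Proof.
split; last by move=> sK; apply/asboolP => L _; exact.
move=> /asboolP/(_ (fun s => `[< CK_section r K E s >])) H; apply/asboolP; apply: H.
  split; first by apply/asboolP; exact: CK_section0.
  by move=> a u v /asboolP uK /asboolP vK; apply/asboolP; exact: CK_section_submod.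
by move=> w wK; apply/asboolP.
Qed.

Lemma CK_spaceP (s : CK_space r K E) : CK_section r K E s.
Proof. by apply/CK_spanP; case: s. Qed.

Lemma CK_insubd (s : section E) (t : CK_space r K E) :
  CK_section r K E s -> CK_val (insubd t s) = s.
Proof. by move=> /CK_spanP sK; exact: (insubdK t sK). Qed.

Lemma CK_valD_scale (s t : CK_space r K E) (a : R) x :
  CK_val (s + a *: t) x = CK_val s x + of_real cplx a *: CK_val t x.
Proof. by []. Qed.

Lemma CK_eval_smooth : smooth_family r [set: CK_space r K E] (@CK_val R X cplx F r K E).
Proof.
move=> psi pr n nr; have [hF _ _ _] := Eok.
apply: CK_evaluation => // s psi' pr' m mr.
exact: (section_smooth Xok Eok pr' mr (CK_spaceP s).1).
Qed.

Lemma CK_continuous (P : topologicalType) (A : set P) (Phi : P -> CK_space r K E) :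
  smooth_family r A (fun p => CK_val (Phi p)) -> {within A, continuous Phi}.
Proof. by move=> H; apply: CK_lift => //; case: Eok. Qed.

(** Point evaluations are continuous and separate sections. *)
Lemma CK_hausdorff : hausdorff_space (CK_space r K E).
Proof.
move=> s t st; apply/val_inj/functional_extensionality_dep => x.
have [hF _ _ triv] := Eok; have [psi pr px] := triv x.
have [_ cov cokX _] := Xok (le_order0 r); have [c ac cx] := cov x; have cok := cokX c ac.
apply: (triv_inj pr px); apply: hF => A B sA tB.
have evc (w : CK_space r K E) (C : set (real_lcs F)) :
    nbhs (loc psi (CK_val w) x) C -> nbhs w [set w' : CK_space r K E | C (loc psi (CK_val w') x)].
  have /withinN/(_ (w, cmap c x)) := CK_eval_smooth pr (le_order0 r) ac.
  rewrite /= (chart_cK cok cx) => /(_ (conj I (img_in cx px)) C) H /H.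
  move=> [[N1 N2] /= [N1w /nbhs_singleton N2x] N12]; apply: filterS N1w => w' N1w'.
  have := N12 (w', cmap c x) (conj N1w' N2x); rewrite /= (chart_cK cok cx).
  by apply; split=> //; exact: img_in.
have [w [Aw Bw]] := st _ _ (evc s A sA) (evc t B tB).
by exists (loc psi (CK_val w) x).
Qed.

(** Only the compact set [K] matters, as sections vanish outside it and [U] contains the
    zero section. *)
Lemma CK_line (U : set (total_space E)) (s h : CK_space r K E) : compact K -> open U ->
  (forall x, U (total_pt (0 : fib E x))) -> CK_space_in r K U s ->
  \forall t \near (0 : R), CK_space_in r K U (s + t *: h).
Proof.
move=> Kc Uo U0 [sK sU].
suff : \forall t \near (0 : R), forall x, K x ->
    U (total_pt (CK_val s x + of_real cplx t *: CK_val h x)).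
  apply: filterS => t tK; split; first exact: CK_spaceP.
  move=> x; rewrite CK_valD_scale.
  have [Kx|Kx] := pselect (K x); first exact: tK.
  have z0 (w : CK_space r K E) : CK_val w x = 0.
    apply/eqP; apply: contra_notT Kx => wx.
    by apply: (CK_spaceP w).2; exact: subset_closure.
  by rewrite !z0 scaler0 addr0; exact: U0.
have /compact_near_coveringP/(_ R (nbhs (0 : R))
  (fun t x => U (total_pt (CK_val s x + of_real cplx t *: CK_val h x))) _) := Kc.
rewrite near_simpl; apply => x Kx.
have [hF _ _ triv] := Eok; have [psi pr px] := triv x.
have [_ cov cokX _] := Xok (le_order0 r); have [c ac cx] := cov x; have cok := cokX c ac.
have [po _ _ [ic _]] := pr.
have idc : {within [set: R], continuous (id : R -> R)}.
  by apply: within_continuous => z; exact: cvg_id.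
have fam := smooth_family_lincomb Xok Eok (A := [set: R]) (a := id) idc
  (smooth_family_const Xok Eok _ (CK_spaceP s).1) (smooth_family_const Xok Eok _ (CK_spaceP h).1).
have fc := PCfun_continuous (Xok (le_order0 r)) po (fam psi pr 0%N (le_order0 r)).
have : {within [set: R] `*` tdom psi, continuous (fun z : R * X =>
    total_pt (tinv psi z.2 (loc psi (CK_val s + z.1 *: CK_val h) z.2)))}.
  apply: (within_comp (f := fun z : R * X => (z.2, loc psi (CK_val s + z.1 *: CK_val h) z.2)) _ _ ic).
    by move=> z [].
  by apply: within_pair => //; exact: within_snd.
move=> /withinN/(_ (0, x) (conj I px) U).
rewrite /= /loc (triv_K _ pr px) scale0r addr0 => /(_ (open_nbhs_nbhs (conj Uo (sU x)))).
move=> [[N1 N2] /= [N10 N2x] N12].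
exists (N2 `&` tdom psi, N1) => /=.
  by split=> //; apply: filterI => //; exact: open_nbhs_nbhs.
move=> [y t] [/= [N2y py] N1t]; have := N12 (t, y) (conj N1t N2y) (conj I py).
by rewrite /= /loc (triv_K _ pr py).
Qed.

End one.

Section map.
Context {c1 c2 : bool} {F1 : tvsType (scalars R c1)} {F2 : tvsType (scalars R c2)}.
Context (E1 : bundle X F1) (E2 : bundle X F2).
Hypothesis E1ok : good_bundle r E1.
Hypothesis E2ok : good_bundle r E2.
Context (U : set (total_space E1)) (f : bundle_map E1 E2).
Hypothesis Uo : open U.
Hypothesis fC : C_map_on r U (total_map f).
Hypothesis f0 : forall x, @f x 0 = 0.

Lemma smooth_family_map (P : topologicalType) (A : set P) (Phi : P -> section E1) :
  smooth_family r A Phi -> (forall p x, A p -> U (total_pt (Phi p x))) ->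
  smooth_family r A (fun p => (fun x => @f x (Phi p x)) : section E2).
Proof.
move=> H PU phi fr n nr.
by apply: (bundle_map_family Xok E1ok E2ok Uo fC _ PU) => //; exact: (local_family_PCfun E1ok).
Qed.

Lemma CK_section_map (s : section E1) : CK_section_in r K U s ->
  CK_section r K E2 (fun x => @f x (s x)).
Proof.
move=> [[sC sK] sU]; split.
  apply: (smooth_family_section Xok E2ok (A := [set: bool]) (p := true)
    (Phi := fun=> (fun x => @f x (s x) : fib E2 x))) => //.
  by apply: (smooth_family_map (smooth_family_const Xok E1ok _ sC)) => p x _; exact: sU.
apply: subset_trans sK; apply: closure_subset => x /=; apply: contra_neq => ->; exact: f0.
Qed.

Lemma CK_mapE (s : CK_space r K E1) : CK_space_in r K U s ->
  CK_val (CK_map r K f s) = (fun x => @f x (CK_val s x)).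
Proof. by move=> sU; apply: (CK_insubd E2ok); exact: CK_section_map. Qed.

Lemma CK_map_continuous : {within CK_space_in r K U, continuous (CK_map r K f)}.
Proof.
apply: (CK_continuous E2ok).
apply: (@smooth_family_eq _ _ _ Xok _ _ E2 _ _
  (fun s : CK_space r K E1 => fun x => @f x (CK_val s x))).
  by move=> s x sU; rewrite CK_mapE.
apply: smooth_family_map; last by move=> s x [].
apply: (smooth_family_reparam (A := setT) (th := id) _ _ (CK_eval_smooth E1ok)) => //.
by apply: within_continuous => z; exact: cvg_id.
Qed.

End map.

End CK_sections.

(** * The derivative of the map between spaces of sections *)

Lemma of_real0 (R : realType) (cplx : bool) : @of_real R cplx 0 = 0.
Proof. by apply: (@addrI _ (of_real cplx 0)); rewrite -of_realD !addr0. Qed.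

Lemma of_realN1 (R : realType) (cplx : bool) : @of_real R cplx (-1) = -1.
Proof.
by apply: (@addrI _ (of_real cplx 1)); rewrite -of_realD subrr of_real0 of_real1 subrr.
Qed.

Section CK_derivative.
Context {R : realType} {X : charted R} (r : option nat).
Hypothesis Xok : mfdr r X.
Hypothesis Xlc : locally_cpt (cmodel X).
Context (K : set X).
Hypothesis Kc : compact K.
Context {c1 c2 : bool} {F1 : tvsType (scalars R c1)} {F2 : tvsType (scalars R c2)}.
Context (E1 : bundle X F1) (E2 : bundle X F2).
Hypothesis E1ok : good_bundle r E1.
Hypothesis E2ok : good_bundle r E2.
Local Notation S := (sum_bundle r E1 E1).
Let Sok : good_bundle r S. Proof. exact: good_sum_bundle. Qed.

Lemma triv_scaleB (cplx : bool) (F : tvsType (scalars R cplx)) (E : bundle X F)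
    (psi : trivialization E) x (a : R) (v w : fib E x) :
  is_trivialization r psi -> tdom psi x ->
  tmap psi (of_real cplx a *: (v - w)) =
  a *: ((tmap psi v : real_lcs F) - (tmap psi w : real_lcs F)) :> real_lcs F.
Proof.
move=> pr px; have l := triv_linear pr px; have l0 := triv0 pr px.
have lZ b (u : fib E x) : tmap psi (of_real cplx b *: u) = b *: (tmap psi u : real_lcs F) :> real_lcs F.
  by have := l b 0 u; rewrite !add0r => ->; rewrite [X in X + _ = _]l0 add0r.
rewrite lZ; congr (_ *: _).
have := l (-1) v w; rewrite scaleN1r => <-.
by rewrite of_realN1 scaleN1r.
Qed.

Definition first_dom (U : set (total_space E1)) : set (total_space S) :=
  [set p | U (total_pt (projT2 p).1)].

(** One trivialization of [E1] at each point is as good as all of them, because changes of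
    trivialization are linear in the fibres. *)
Definition fibre_differentiable (U : set (total_space E1)) (f : bundle_map E1 E2) : Prop :=
  forall x, exists2 psi : trivialization E1, is_trivialization r psi & tdom psi x /\
    forall phi : trivialization E2, is_trivialization r phi -> tdom phi x ->
    forall v w : fib E1 x, U (total_pt v) ->
      has_dir (local_rep f phi psi x) (tmap psi v : real_lcs F1) (tmap psi w : real_lcs F1).

Context (U : set (total_space E1)) (f : bundle_map E1 E2) (g : bundle_map S E2).
Hypothesis Uo : open U.
Hypothesis U0 : forall x, U (total_pt (0 : fib E1 x)).
Hypothesis f0 : forall x, @f x 0 = 0.
Hypothesis g0 : forall x, @g x 0 = 0.
Hypothesis fC : C_map_on r U (total_map f).
Hypothesis gC : C_map_on r (first_dom U) (total_map g).
Hypothesis fg : is_delta U f g.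
Hypothesis fd : fibre_differentiable U f.

Lemma first_dom_open : open (first_dom U).
Proof.
apply: (@open_comp _ _ (fun p : total_space S => total_pt (projT2 p).1 : total_space E1) U) => // p _.
exact: sum_fst_continuous.
Qed.

(** [Q] is the difference quotient, with the expected limit as its value at 0. It is a
    smooth family by [PC_time_quotient], and hence continuous at 0. *)
Lemma CK_difference_quotient (s h : CK_space r K E1) (sh : CK_space r K S) :
  CK_space_in r K U s -> CK_val sh = (fun x => (CK_val s x, CK_val h x)) ->
  diffquot (CK_map r K f) s h t @[t --> 0^'] --> CK_map r K g sh.
Proof.
move=> sU shE; have [e /= e0 eU] := CK_line Xok E1ok h Kc Uo U0 sU.
have {}eU t : `|t| < e -> CK_space_in r K U (s + t *: h).
  by move=> te; apply: eU; rewrite /= sub0r normrN.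
pose J := [set t : R | `|t| < e].
pose Q t := if t == 0 then CK_map r K g sh else diffquot (CK_map r K f) s h t.
have shU : CK_space_in r K (first_dom U) sh.
  by split; [exact: (CK_spaceP Xok Sok)|move=> x; rewrite /first_dom /= shE; case: sU].
have idc : {within J, continuous (id : R -> R)}.
  by apply: within_continuous => z; exact: cvg_id.
have sC := (CK_spaceP Xok E1ok s).1; have hC := (CK_spaceP Xok E1ok h).1.
have fam := smooth_family_lincomb Xok E1ok idc (smooth_family_const Xok E1ok J sC)
  (smooth_family_const Xok E1ok J hC).
have Gfam := smooth_family_map Xok E1ok E2ok Uo fC fam.
have Hfam := smooth_family_map Xok Sok E2ok first_dom_open gC
  (smooth_family_pair Xok E1ok E1ok fam (smooth_family_const Xok E1ok J hC)).
have {}Gfam := Gfam (fun t x (Jt : J t) => (eU t Jt).2 x).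
have {}Hfam := Hfam (fun t x (Jt : J t) => (eU t Jt).2 x).
have Qfam : smooth_family r J (fun t => CK_val (Q t)).
  move=> phi fr n nr c ac; have [hF2 _ _ _] := E2ok; have [fo _ _ _] := fr.
  have [_ _ cokX _] := Xok nr; have cok := cokX c ac.
  have Do : open (img c (tdom phi)) by exact: (img_open cok).
  have Gn := Gfam phi fr n nr c ac; have Hn := Hfam phi fr n nr c ac.
  have GH := PC_time_quotient hF2 Do e0 Gn Hn.
  apply: (PC_eq _ _ (GH _)).
  - exact: open_box.
  - move=> t u [/= te /(img_cinv cok)[_ fu _ _]].
    rewrite /time_quotient /Q; case: eqP => [t0|/eqP t0].
      rewrite /loc (CK_mapE Xok Sok E2ok first_dom_open gC g0 shU) shE /=.
      congr (tmap phi (g (_, _))).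
      rewrite -[LHS]/(CK_val s (cinv c u) + of_real c1 0 *: CK_val h (cinv c u)).
      by rewrite of_real0 scale0r addr0.
    rewrite /loc -[RHS]/(tmap phi (of_real c2 t^-1 *:
      (CK_val (CK_map r K f (s + t *: h)) (cinv c u) - CK_val (CK_map r K f s) (cinv c u)))).
    rewrite (triv_scaleB _ _ _ fr fu).
    rewrite (CK_mapE Xok E1ok E2ok Uo fC f0 sU) (CK_mapE Xok E1ok E2ok Uo fC f0 (eU t te)).
    congr (_ *: (_ - tmap phi (f _))).
    rewrite -[LHS]/(CK_val s (cinv c u) + of_real c1 0 *: CK_val h (cinv c u)).
    by rewrite of_real0 scale0r addr0.
  - move=> a u ae /(img_cinv cok)[_ fu _ _]; set x := cinv c u in fu *.
    have [psi pr [px pd]] := fd x.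
    pose v := (CK_val s + a *: CK_val h) x.
    have Uv : U (total_pt v) by exact: (eU a ae).2.
    have := diff1P (pd phi fr fu v (CK_val h x) Uv).
    rewrite -(fg pr fr (CK_val h x) px fu Uv).
    apply: cvg_trans; apply: near_eq_cvg; apply: nearW => t.
    rewrite /diffquot /local_rep -(triv_linear pr px) !(triv_K _ pr px).
    congr (_ *: (tmap phi (f _) - _)).
    rewrite /v -[LHS]/(CK_val s x + of_real c1 a *: CK_val h x + of_real c1 t *: CK_val h x).
    rewrite -[RHS]/(CK_val s x + of_real c1 (a + t) *: CK_val h x).
    by rewrite of_realD scalerDl addrA.
have /withinN/(_ 0) := CK_continuous Xok E2ok Qfam.
rewrite {1}/J /= normr0 => /(_ e0) Qc A nA.
have := Qc A; rewrite {1}/Q eqxx => /(_ nA) QA.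
have {}QA := @nbhs_dnbhs R 0 _ QA.
change (\forall t \near (0 : R)^', A (diffquot (CK_map r K f) s h t)).
near=> t.
have t0 : t != 0 by near: t; exact: nbhs_dnbhs_neq.
have te : J t by near: t; exact: dnbhs0_lt.
have : J t -> A (Q t) by near: t; exact: QA.
by rewrite /Q (negbTE t0); exact.
Unshelve. all: by end_near. Qed.

End CK_derivative.

(** * Powers of a bundle and iterated fibre differentials *)

Section powers.
Context {R : realType} {X : charted R} (r : option nat).
Hypothesis Xok : mfdr r X.

Section one.
Context {cplx : bool} {F : tvsType (scalars R cplx)}.
Context (E : bundle X F) (Eok : good_bundle r E).

Lemma good_pow n : good_bundle r (pow_bundle r E n).
Proof. by elim: n => //= n IH; exact: good_sum_bundle. Qed.

Fixpoint pow_triv (psi : trivialization E) n : trivialization (pow_bundle r E n) :=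
  match n return trivialization (pow_bundle r E n) with
  | 0 => psi
  | m.+1 => sum_triv r (pow_triv psi m) (pow_triv psi m)
  end.

Lemma pow_triv_ok psi n : is_trivialization r psi -> is_trivialization r (pow_triv psi n).
Proof.
move=> pr; elim: n => //= n IH; have Eo := good_pow n.
exact: (sum_triv_ok Xok Eo Eo).
Qed.

Lemma pow_triv_dom psi n x : tdom psi x -> tdom (pow_triv psi n) x.
Proof. by move=> px; elim: n. Qed.

(** In effect the identity, from the real space that underlies a power of [F] to the power
    of the real space that underlies [F]. *)
Fixpoint pow_coord n : real_lcs (pow_fibre F n) -> pow2 (real_lcs F) n :=
  match n return real_lcs (pow_fibre F n) -> pow2 (real_lcs F) n with
  | 0 => id
  | m.+1 => fun z => (@pow_coord m z.1, @pow_coord m z.2)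
  end.

Lemma pow_coord_lin n : lin (@pow_coord n).
Proof.
elim: n => [//|n IH] a u v /=.
by rewrite -[RHS]/(pow_coord u.1 + a *: pow_coord v.1, pow_coord u.2 + a *: pow_coord v.2) -!IH.
Qed.

Section dom.
Context (U : set (total_space E)) (Uo : open U).

Lemma pow_dom_open n : open (pow_dom r n U).
Proof.
elim: n => //= n IH; have Eo := good_pow n.
exact: (first_dom_open Xok Eo IH).
Qed.

Lemma pow_dom0 n x : U (total_pt (0 : fib E x)) ->
  pow_dom r n U (total_pt (0 : fib (pow_bundle r E n) x)).
Proof. by move=> Ux; elim: n. Qed.

Lemma pow_dom_line n x (v w : fib (pow_bundle r E n) x) : pow_dom r n U (total_pt v) ->
  \forall t \near (0 : R), pow_dom r n U (total_pt (v + of_real cplx t *: w)).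
Proof.
elim: n v w => [|n IH] v w /=; last exact: IH.
move=> Uv; have [_ _ _ triv] := Eok; have [psi pr px] := triv x.
have [_ _ _ [ic _]] := pr.
have /withinN/(_ (x, tmap psi v)) := ic.
rewrite /= (triv_K _ pr px) => /(_ (conj px I) U (open_nbhs_nbhs (conj Uo Uv))).
move=> [[N1 N2] /= [N1x N2v] N12].
have := @line_cvg R (real_lcs F) (tmap psi v) (tmap psi w) N2 N2v.
move=> H; have {}H : \forall t \near (0 : R), N2 ((tmap psi v : real_lcs F) + t *: (tmap psi w : real_lcs F)) := H.
apply: filterS H => t N2t.
have := N12 (x, _) (conj (nbhs_singleton N1x) N2t) (conj px I).
by rewrite /= -(triv_linear pr px) (triv_K _ pr px).
Qed.

End dom.
End one.

Section delta_exists.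
Context {c1 c2 : bool} {F1 : tvsType (scalars R c1)} {F2 : tvsType (scalars R c2)}.
Context (E2 : bundle X F2).
Hypothesis E2ok : good_bundle r E2.

Lemma change_triv_continuous (phi phi' : trivialization E2) x : is_trivialization r phi ->
  is_trivialization r phi' -> tdom phi x -> tdom phi' x ->
  continuous (fun y : real_lcs F2 => tmap phi' (tinv phi x y) : real_lcs F2).
Proof.
move=> pr pr' px px'; have [_ cov cokX _] := Xok (le_order0 r); have [c ac cx] := cov x.
have cok := cokX c ac.
have ch := Cn_continuous (change_triv_smooth Xok E2ok pr pr' ac (le_order0 r)).
apply/continuous_subspace_setT.
apply: (@within_congr _ _ _ (fun y : real_lcs F2 =>
    tmap phi' (tinv phi (cinv c (cmap c x)) y) : real_lcs F2)).
  by move=> y _; rewrite (chart_cK cok cx).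
apply: (within_comp (f := fun y : real_lcs F2 => (cmap c x, y)) _ _ ch).
  by move=> y _; split=> //; exact: img_in.
by apply: within_pair; apply: within_continuous => y; [exact: cvg_cst|exact: cvg_id].
Qed.

(** At each point, [g] is defined with one choice of trivializations. For any other choice
    the local representative of [f] changes by continuous linear maps on both sides, and
    so does its differential. *)
Lemma is_delta_exists (E1 : bundle X F1) (U : set (total_space E1)) (f : bundle_map E1 E2) :
  fibre_differentiable r U f -> exists g : bundle_map (sum_bundle r E1 E1) E2, is_delta U f g.
Proof.
move=> fd; have [hF2 _ _ triv2] := E2ok.
pose psi_ x := projT1 (cid2 (fd x)); pose phi_ x := projT1 (cid2 (triv2 x)).
have psiP x : is_trivialization r (psi_ x) /\ (tdom (psi_ x) x /\
    forall phi : trivialization E2, is_trivialization r phi -> tdom phi x ->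
    forall v w : fib E1 x, U (total_pt v) ->
      has_dir (local_rep f phi (psi_ x) x) (tmap (psi_ x) v : real_lcs F1) (tmap (psi_ x) w : real_lcs F1)).
  by rewrite /psi_; case: cid2.
have phiP x : is_trivialization r (phi_ x) /\ tdom (phi_ x) x.
  by rewrite /phi_; case: cid2.
exists (fun x vw => tinv (phi_ x) x (diff1 (local_rep f (phi_ x) (psi_ x) x)
  (tmap (psi_ x) vw.1 : real_lcs F1, tmap (psi_ x) vw.2 : real_lcs F1))).
move=> psi phi sr fr x v w sx fx Uv.
have [sr0 [sx0 sd]] := psiP x; have [fr0 fx0] := phiP x.
have /diff1P H := sd _ fr0 fx0 v w Uv.
apply/esym/diff1_eq => //=.
set z := diff1 _ _ in H *.
have := change_triv_continuous fr0 fr fx0 fx.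
move=> /(_ z) Lc; have := cvg_comp _ _ H Lc.
apply: cvg_trans; apply: near_eq_cvg; apply: nearW => t /=.
rewrite /diffquot /local_rep -!(triv_linear sr0 sx0) -!(triv_linear sr sx).
rewrite !(triv_K _ sr0 sx0) !(triv_K _ sr sx).
by rewrite -(triv_scaleB _ _ _ fr0 fx0) -(triv_scaleB _ _ _ fr fx) (triv_K _ fr0 fx0).
Qed.

End delta_exists.

Section delta.
Context {c1 c2 : bool} {F1 : tvsType (scalars R c1)} {F2 : tvsType (scalars R c2)}.
Context (E2 : bundle X F2).
Hypothesis E2ok : good_bundle r E2.
Context (E1 : bundle X F1) (E1ok : good_bundle r E1).
Context (U : set (total_space E1)) (f : bundle_map E1 E2).
Hypothesis Uo : open U.
Hypothesis U0 : forall x, U (total_pt (0 : fib E1 x)).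
Hypothesis f0 : forall x, @f x 0 = 0.
Context (k : option nat).
Hypothesis fk : partially_C_map r k U f.

Let dl j := delta r U f j.

Definition delta_is_diffn j : Prop :=
  forall (psi : trivialization E1) (phi : trivialization E2) x,
  is_trivialization r psi -> is_trivialization r phi -> tdom psi x -> tdom phi x ->
  forall v : fib (pow_bundle r E1 j) x, pow_dom r j U (total_pt v) ->
  tmap phi (@dl j x v) =
  diffn j (local_rep f phi psi x) (pow_coord (tmap (pow_triv psi j) v)) :> real_lcs F2.

Lemma dom2_pow_coord (psi : trivialization E1) (phi : trivialization E2) x j
    (v : fib (pow_bundle r E1 j) x) :
  is_trivialization r psi -> tdom psi x -> tdom phi x -> pow_dom r j U (total_pt v) ->
  dom2 j [set w | local_dom U phi psi (x, w)] (pow_coord (tmap (pow_triv psi j) v)).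
Proof.
move=> pr px fx; elim: j v => [|j IH] v /= Uv; last by split=> //; exact: IH.
by exists (total_pt v).
Qed.

Lemma delta_rep_near (psi : trivialization E1) (phi : trivialization E2) x j
    (v w : fib (pow_bundle r E1 j) x) :
  delta_is_diffn j -> is_trivialization r psi -> is_trivialization r phi ->
  tdom psi x -> tdom phi x -> pow_dom r j U (total_pt v) ->
  \forall t \near (0 : R),
    local_rep (@dl j) phi (pow_triv psi j) x
      ((tmap (pow_triv psi j) v : real_lcs (pow_fibre F1 j)) + t *: (tmap (pow_triv psi j) w : real_lcs (pow_fibre F1 j))) =
    (diffn j (local_rep f phi psi x) \o @pow_coord c1 F1 j)
      ((tmap (pow_triv psi j) v : real_lcs (pow_fibre F1 j)) + t *: (tmap (pow_triv psi j) w : real_lcs (pow_fibre F1 j))).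
Proof.
move=> dj pr fr px fx Uv.
have prj := pow_triv_ok E1ok j pr; have pxj := pow_triv_dom j px.
apply: filterS (pow_dom_line E1ok Uo w Uv) => t Ut.
by rewrite -(triv_linear prj pxj) [LHS]/local_rep (triv_K _ prj pxj); exact: dj.
Qed.

Lemma delta_fibre_differentiable j : le_order j.+1 k -> delta_is_diffn j ->
  fibre_differentiable r (pow_dom r j U) (@dl j).
Proof.
move=> jk dj x; have [_ _ _ triv] := E1ok; have [psi pr px] := triv x.
exists (pow_triv psi j); first exact: pow_triv_ok.
split; first exact: pow_triv_dom.
move=> phi fr fx v w Uv.
have H : \forall t \near (0 : R),
    (diffn j (local_rep f phi psi x) \o @pow_coord c1 F1 j)
      ((tmap (pow_triv psi j) v : real_lcs (pow_fibre F1 j)) + t *: (tmap (pow_triv psi j) w : real_lcs (pow_fibre F1 j))) =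
    local_rep (@dl j) phi (pow_triv psi j) x
      ((tmap (pow_triv psi j) v : real_lcs (pow_fibre F1 j)) + t *: (tmap (pow_triv psi j) w : real_lcs (pow_fibre F1 j))).
  by apply: filterS (delta_rep_near w dj pr fr px fx Uv) => t ->.
apply: (has_dir_congr H).
apply/(has_dir_precomp _ _ _ (@pow_coord_lin c1 F1 j)).
have [/(_ x j.+1 jk)[_ [_ lim _]] _] := fk pr fr.
by apply: lim; exact: dom2_pow_coord.
Qed.

(** Differentiability of [delta^j f] in the fibres is what makes [delta^(j+1) f] exist, and
    it holds as [delta^j f] represents [diffn j]; this ties the two facts together in one
    induction on [j]. *)
Lemma delta_step j : le_order j.+1 k -> delta_is_diffn j ->
  is_delta (pow_dom r j U) (@dl j) (@dl j.+1 : bundle_map (sum_bundle r (pow_bundle r E1 j) (pow_bundle r E1 j)) E2).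
Proof.
move=> jk dj; apply: (@xgetPex _ _ [set g | is_delta (pow_dom r j U) (@dl j) g]).
by apply: (is_delta_exists E2ok); exact: delta_fibre_differentiable.
Qed.

Lemma delta_diffn j : le_order j k -> delta_is_diffn j.
Proof.
elim: j => [|j IH] jk.
  by move=> psi phi x pr fr px fx v Uv; rewrite /local_rep /= (triv_K _ pr px).
have dj := IH (le_order_trans (leqnSn j) jk).
move=> psi phi x pr fr px fx [v w] Uv.
have := delta_step jk dj; move=> /(_ (pow_triv psi j) phi (pow_triv_ok E1ok j pr) fr x v w).
move=> /(_ (pow_triv_dom j px) fx Uv) ->.
rewrite (diff1_congr (delta_rep_near w dj pr fr px fx Uv)).
by rewrite diff1_precomp//; exact: pow_coord_lin.
Qed.

Lemma is_delta_delta j : le_order j.+1 k ->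
  is_delta (pow_dom r j U) (@dl j) (@dl j.+1 : bundle_map (sum_bundle r (pow_bundle r E1 j) (pow_bundle r E1 j)) E2).
Proof.
by move=> jk; apply: delta_step => //; apply: delta_diffn; exact: le_order_trans jk.
Qed.

Lemma delta0 j x : le_order j k -> @dl j x 0 = 0.
Proof.
case: j => [|j] jk; first exact: f0.
have [hF2 _ _ triv2] := E2ok; have [phi fr fx] := triv2 x.
have [_ _ _ triv] := good_pow E1ok j; have [psi pr px] := triv x.
apply: (triv_inj fr fx); rewrite (triv0 fr fx).
have U0j := pow_dom0 j (U0 x).
have := is_delta_delta jk pr fr (0 : fib (pow_bundle r E1 j) x) px fx U0j.
move=> ->; rewrite (triv0 pr px).
exact: (@diff1_dir0 R (real_lcs (pow_fibre F1 j)) (real_lcs F2) _ 0 hF2).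
Qed.

End delta.
End powers.

(** * Sections of powers and the main theorem *)

Section pairs.
Context {R : realType} {X : charted R} (r : option nat).
Hypothesis Xok : mfdr r X.
Hypothesis Xlc : locally_cpt (cmodel X).
Context (K : set X).
Context {cplx : bool} {F : tvsType (scalars R cplx)}.
Context (E : bundle X F) (Eok : good_bundle r E).
Local Notation CK := (CK_space r K E).
Local Notation pairs := (@pair_sections R X cplx r F K E).

Lemma CK_section_pair j (s : pow2 CK j) : CK_section r K (pow_bundle r E j) (pairs s).
Proof.
elim: j s => [|j IH] s; first exact: (CK_spaceP Xok Eok).
have Eo := good_pow Xok Eok j; have So := good_pow Xok Eok j.+1.
have [C1 K1] := IH s.1; have [C2 K2] := IH s.2; split.
  have H := smooth_family_pair Xok Eo Eo (smooth_family_const Xok Eo [set: bool] C1)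
    (smooth_family_const Xok Eo [set: bool] C2).
  exact: (smooth_family_section Xok So (p := true) H).
apply: (closure_subU K1 K2) => x /= stx.
have [s0|] := eqVneq (pairs s.1 x) 0; last by left.
right; apply: contra_neq stx => s0'.
by rewrite s0 s0'.
Qed.

Lemma CK_pairE j (s : pow2 CK j) : CK_val (CK_pair r K j s) = pairs s.
Proof. by apply: (CK_insubd Xok (good_pow Xok Eok j)); exact: CK_section_pair. Qed.

Lemma CK_pair_smooth j :
  smooth_family r [set: pow2 CK j] (fun s => CK_val (CK_pair r K j s)).
Proof.
elim: j => [|j IH].
  have e (s : pow2 CK 0) : CK_val s = CK_val (CK_pair r K 0 s) by rewrite CK_pairE.
  have H := CK_eval_smooth Xok Xlc K Eok.
  refine (@smooth_family_eq _ _ _ Xok _ F E (pow2 CK 0) setT (fun s => CK_val (s : CK))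
     (fun s => CK_val (CK_pair r K 0 s)) _ H).
  by move=> s x _; rewrite -e.
have Eo := good_pow Xok Eok j.
have H1 := smooth_family_reparam (A' := [set: pow2 CK j.+1]) (th := fst) (@within_fst _ _ _) _ IH.
have H2 := smooth_family_reparam (A' := [set: pow2 CK j.+1]) (th := snd) (@within_snd _ _ _) _ IH.
apply: (smooth_family_eq Xok _ (smooth_family_pair Xok Eo Eo (H1 _) (H2 _))) => // s x _.
by rewrite /= !CK_pairE.
Qed.

Lemma CK_pair_continuous j : continuous (CK_pair r K j : pow2 CK j -> _).
Proof.
apply/continuous_subspace_setT.
exact: (CK_continuous Xok (good_pow Xok Eok j) (@CK_pair_smooth j)).
Qed.

Lemma CK_pair_lin j : lin (CK_pair r K j : pow2 CK j -> _).
Proof.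
move=> a s t; apply: val_inj; apply: functional_extensionality_dep => x.
rewrite -[LHS]/(CK_val (CK_pair r K j (s + a *: t)) x).
rewrite -[RHS]/(CK_val (CK_pair r K j s) x + of_real cplx a *: CK_val (CK_pair r K j t) x).
rewrite !CK_pairE.
elim: j s t => [//|j IH] s t /=.
by rewrite -[RHS]/(pairs s.1 x + of_real cplx a *: pairs t.1 x,
  pairs s.2 x + of_real cplx a *: pairs t.2 x) -!IH.
Qed.

Lemma pairs_inj j : injective (@pair_sections R X cplx r F K E j).
Proof.
elim: j => [|j IH] s t st; first exact: val_inj.
case: s t st => [s1 s2] [t1 t2] st; congr pair; apply: IH.
  by apply: functional_extensionality_dep => x; have := congr1 (fun u => u x) st => -[].
by apply: functional_extensionality_dep => x; have := congr1 (fun u => u x) st => -[].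
Qed.

Lemma pairs_surj j (t : section (pow_bundle r E j)) : CK_section r K (pow_bundle r E j) t ->
  exists s : pow2 CK j, pairs s = t.
Proof.
elim: j t => [|j IH] t [tC tK].
  have /(CK_spanP Xok K Eok) tS : CK_section r K E t by split.
  by exists (CKSpace tS).
have Eo := good_pow Xok Eok j; have So := good_pow Xok Eok j.+1.
have H := smooth_family_const Xok So [set: bool] tC.
have [|s1 E1] := IH (fun x => (t x).1).
  split; first exact: (smooth_family_section Xok Eo (p := true) (smooth_family_fst Xok Eo Eo H)).
  by apply: subset_trans tK; apply: closure_subset => x /=; apply: contra_neq => ->.
have [|s2 E2] := IH (fun x => (t x).2).
  split; first exact: (smooth_family_section Xok Eo (p := true) (smooth_family_snd Xok Eo Eo H)).
  by apply: subset_trans tK; apply: closure_subset => x /=; apply: contra_neq => ->.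
exists (s1, s2); apply: functional_extensionality_dep => x /=.
by rewrite E1 E2; case: (t x).
Qed.

Section dom.
Context (U : set (total_space E)).

Lemma dom2_pairs j (s : pow2 CK j) :
  dom2 j (CK_space_in r K U) s <-> forall x, pow_dom r j U (total_pt (pairs s x)).
Proof.
elim: j s => [|j IH] s /=.
  by split=> [[]//|sU]; split=> //; exact: (CK_spaceP Xok Eok).
by split=> [[/IH]//|sU]; split=> //; exact/IH.
Qed.

Lemma dom2_CK_pair j (s : pow2 CK j) : dom2 j (CK_space_in r K U) s ->
  CK_space_in r K (pow_dom r j U) (CK_pair r K j s).
Proof.
move=> /dom2_pairs sU; split; first exact: (CK_spaceP Xok (good_pow Xok Eok j)).
by move=> x; rewrite CK_pairE.
Qed.

Lemma CK_pair_bij j : set_bij (dom2 j (CK_space_in r K U))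
  (CK_space_in r K (pow_dom r j U)) (CK_pair r K j).
Proof.
split.
- by move=> s; exact: dom2_CK_pair.
- move=> s t _ _ /(congr1 (fun w => CK_val w)); rewrite !CK_pairE; exact: pairs_inj.
- move=> t [tK tU]; have [s st] := pairs_surj tK; exists s.
    by apply/dom2_pairs => x; rewrite st.
  by apply: val_inj; rewrite /= CK_pairE.
Qed.

Lemma dom2_CK_line j (s h : pow2 CK j) : compact K -> open U ->
  (forall x, U (total_pt (0 : fib E x))) -> dom2 j (CK_space_in r K U) s ->
  \forall t \near (0 : R), dom2 j (CK_space_in r K U) (s + t *: h).
Proof.
move=> Kc Uo U0; elim: j s h => [|j IH] s h; first exact: (CK_line Xok Eok).
by move=> [/= sU _]; apply: filterS (IH s.1 h.1 sU) => t H; split.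
Qed.

End dom.
End pairs.

Section main.
Context {R : realType} {X : charted R} (r k : option nat).
Hypothesis Xok : mfdr r X.
Hypothesis Xlc : locally_cpt (cmodel X).
Context (K : set X).
Hypothesis Kc : compact K.
Context {c1 c2 : bool} {F1 : tvsType (scalars R c1)} {F2 : tvsType (scalars R c2)}.
Context (E1 : bundle X F1) (E2 : bundle X F2).
Hypothesis E1ok : good_bundle r E1.
Hypothesis E2ok : good_bundle r E2.
Context (U : set (total_space E1)) (f : bundle_map E1 E2).
Hypothesis Uo : open U.
Hypothesis U0 : forall x, U (total_pt (0 : fib E1 x)).
Hypothesis f0 : forall x, @f x 0 = 0.
Hypothesis fk : partially_C_map r k U f.
Hypothesis fC : forall j, le_order j k ->
  @C_map_on R (total_space (pow_bundle r E1 j)) (total_space E2) r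
     (pow_dom r j U) (total_map (delta r U f j)).

(** Near [s], the map [diffn j (CK_map f)] is [CK_map (delta^j f)] composed with the linear
    map [CK_pair j], so that its difference quotients are those of [CK_map (delta^j f)]. *)
Lemma diffn_CK_map_limit j : le_order j.+1 k ->
  (forall s, dom2 j (CK_space_in r K U) s ->
     diffn j (CK_map r K f) s = CK_map r K (delta r U f j) (CK_pair r K j s)) ->
  forall s h, dom2 j (CK_space_in r K U) s ->
  diffquot (diffn j (CK_map r K f)) s h t @[t --> 0^'] -->
    CK_map r K (delta r U f j.+1) (CK_pair r K j.+1 (s, h)).
Proof.
move=> jk IH s h sU; have jk' := le_order_trans (leqnSn j) jk.
have Eo := good_pow Xok E1ok j.
have step : diffquot (CK_map r K (delta r U f j)) (CK_pair r K j s) (CK_pair r K j h) t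
    @[t --> 0^'] --> CK_map r K (delta r U f j.+1) (CK_pair r K j.+1 (s, h)).
  apply: (CK_difference_quotient (U := pow_dom r j U) Xok Kc Eo E2ok).
  - exact: (pow_dom_open Xok E1ok).
  - by move=> x; exact: pow_dom0.
  - by move=> x; exact: (delta0 Xok E2ok E1ok Uo U0 f0 fk).
  - by move=> x; exact: (delta0 Xok E2ok E1ok Uo U0 f0 fk).
  - exact: (fC jk').
  - exact: (fC jk).
  - exact: (is_delta_delta Xok E2ok E1ok Uo fk).
  - by apply: (delta_fibre_differentiable Xok E1ok Uo fk jk); exact: (delta_diffn Xok E2ok E1ok Uo fk).
  - exact: dom2_CK_pair.
  - by rewrite !(CK_pairE Xok E1ok).
move: step; apply: cvg_trans; apply: near_eq_cvg; apply: nbhs_dnbhs.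
apply: filterS (dom2_CK_line Xok E1ok h Kc Uo U0 sU) => t tU.
by rewrite /diffquot IH// IH// (CK_pair_lin Xok E1ok).
Qed.

Lemma diffn_CK_map j : le_order j k -> forall s, dom2 j (CK_space_in r K U) s ->
  diffn j (CK_map r K f) s = CK_map r K (delta r U f j) (CK_pair r K j s).
Proof.
elim: j => [|j IH] jk s sU.
  have -> : CK_pair r K 0 s = s by apply: val_inj; rewrite /= (CK_pairE Xok E1ok).
  by [].
have jk' := le_order_trans (leqnSn j) jk.
case: s sU => s h [/= sU _].
have hCK : hausdorff_space (CK_space r K E2) by exact: (CK_hausdorff Xok Xlc (K := K) E2ok).
apply (diff1_eq hCK).
exact: (diffn_CK_map_limit jk (IH jk')).
Qed.

Lemma diffn_CK_map_continuous j : le_order j k ->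
  {within dom2 j (CK_space_in r K U), continuous (diffn j (CK_map r K f))}.
Proof.
move=> jk; have Eo := good_pow Xok E1ok j.
apply: (@within_congr _ _ _ (CK_map r K (delta r U f j) \o CK_pair r K j)).
  by move=> s sU; rewrite (diffn_CK_map jk).
have dc := CK_map_continuous (K := K) Xok Xlc Eo E2ok (pow_dom_open Xok E1ok Uo j) (fC jk)
  (fun x => delta0 Xok E2ok E1ok Uo U0 f0 fk (j := j) x jk).
apply: (within_comp _ _ dc); first by move=> s; exact: (dom2_CK_pair Xok E1ok).
by apply: within_continuous; exact: (CK_pair_continuous Xok Xlc E1ok).
Qed.

Lemma CK_map_C : C_on k (CK_space_in r K U) (CK_map r K f).
Proof.
elim=> [|n IH] nk; first exact: (diffn_CK_map_continuous nk).
have nk' := le_order_trans (leqnSn n) nk.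
split; first exact: IH.
split.
- exact: diffn_CK_map_continuous.
- move=> s h sU; eexists; exact: (diffn_CK_map_limit nk (diffn_CK_map nk') sU).
- exact: (diffn_CK_map_continuous nk).
Qed.

End main.

Unset Implicit Arguments.

Theorem theorem4p7 (R : realType) (r k : option nat) (X : charted R)
    (c1 c2 : bool) (F1 : tvsType (scalars R c1)) (F2 : tvsType (scalars R c2))
    (E1 : bundle X F1) (E2 : bundle X F2)
    (U : set (total_space E1)) (f : bundle_map E1 E2) :
  is_manifold r X -> sigma_compact X -> finite_dimensional X ->
  is_vector_bundle r E1 -> is_vector_bundle r E2 ->
  open U -> (forall x, U (total_pt (0 : fib E1 x))) -> balanced U ->
  (forall x, f x 0 = 0) ->
  partially_C_map r k U f ->
  (forall j, le_order j k ->
     @C_map_on R (total_space (pow_bundle r E1 j)) (total_space E2) r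
       (pow_dom r j U) (total_map (delta r U f j))) ->
  forall K : set X, compact K ->
  [/\ (forall j, le_order j k -> forall s : section (pow_bundle r E1 j),
         CK_section_in r K (pow_dom r j U) s ->
         CK_section r K E2 (fun x => delta r U f j x (s x))),
      C_on k (CK_space_in r K U) (CK_map r K f)
    & forall j, le_order j k ->
        set_bij (dom2 j (CK_space_in r K U))
          (CK_space_in r K (pow_dom r j U)) (CK_pair r K j) /\
        forall s, dom2 j (CK_space_in r K U) s ->
          diffn j (CK_map r K f) s
          = CK_map r K (delta r U f j) (CK_pair r K j s)].
Proof.
move=> Xm _ [d [e be]] V1 V2 Uo U0 _ f0 fk fC K Kc.
have Xok := is_manifold_mfdr Xm.
have Xlc : locally_cpt (cmodel X).
  by apply: findim_locally_cpt be; case: Xm.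
have E1ok := good_vector_bundle V1; have E2ok := good_vector_bundle V2.
split.
- move=> j jk s sU.
  apply: (CK_section_map Xok (good_pow Xok E1ok j) E2ok _ (fC j jk) _ sU).
    exact: (pow_dom_open Xok E1ok).
  by move=> x; exact: (delta0 Xok E2ok E1ok Uo U0 f0 fk).
- exact: (CK_map_C Xok Xlc Kc E1ok E2ok Uo U0 f0 fk fC).
- move=> j jk; split; first exact (CK_pair_bij Xok K E1ok U j).
  exact: (diffn_CK_map Xok Xlc Kc E1ok E2ok Uo U0 f0 fk fC jk).
Qed.
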